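(* Let $p\in\mathbb N$, let $A\in\Omega^p_T$ and $n\in\mathbb N$. Then $\Gamma^n_{\mathrm{fin}}(A)$ can be computed in finitely many arithmetic operations, given finitely many evaluations of the functions $\mathcal A_p$, $\mathcal B_p$, $\mathcal C_p$, namely the evaluations: $K_n:=\mathcal A_p(A,n)$; $(A^+_{n,k},(A^* )^+_{n,k}):=\mathcal C_p(A,k,n)$, for $k\in K_n$; and $(\alpha_{\max},\beta_{\max},\gamma_{\max}):=\mathcal B_p(A)$. Further, $d_H(\Gamma^n_{\mathrm{fin}}(A),\mathrm{Spec}\,A)\to0$ as $n\to\infty$, and also, where $$\widehat\Gamma^n_{\mathrm{fin}}(A):=\Gamma^n_{\mathrm{fin}}(A)+\tfrac2n\overline{\mathbb D},$$ $d_H(\widehat\Gamma^n_{\mathrm{fin}}(A),\mathrm{Spec}\,A)\to0$ as $n\to\infty$, with $\mathrm{Spec}\,A\subset\widehat\Gamma^n_{\mathrm{fin}}(A)$ for each $n\in\mathbb N$.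
   Context: $X=\mathbb C^p$ with the Euclidean norm, $E=\ell^2(\mathbb Z,X)$. $\Omega^p_T$ is the set of tridiagonal operators $A$ on $E$, $(Ax)_i=\alpha_{i-1}x_{i-1}+\beta_ix_i+\gamma_{i+1}x_{i+1}$, with bounded sequences $\alpha,\beta,\gamma$ of $p\times p$ complex matrices; $\|\alpha\|_\infty:=\sup_j\|\alpha_j\|$, etc. The matrix of $A$ is $[a_{i,j}]$ with $a_{j+1,j}=\alpha_j$, $a_{j,j}=\beta_j$, $a_{j-1,j}=\gamma_j$; $A^*$ has matrix $[a_{j,i}^T]$ (block transposes). For tridiagonal $B$ with matrix $[b_{i,j}]$, $B^+_{n,k}$ is the $(n+2)\times n$ submatrix (entries in $\mathbb C^{p\times p}$) with rows $k,\dots,k+n+1$ and columns $k+1,\dots,k+n$; $I_n^+$ is the $n\times n$ identity (with $p\times p$ identity blocks) with one zero row added on top and one at the bottom. Norms are operator norms induced by Euclidean norms; $\nu(C):=\inf_{\|x\|=1}\|Cx\|$ is the smallest singular value. Input maps (any fixed maps with these properties): (1) $\mathcal A_p:(A,n)\mapsto K_n$, a finite subset of $\mathbb Z$ such that for all $k\in\mathbb Z$ there is $j\in K_n$ with $\|A^+_{n,k}-A^+_{n,j}\|\le1/n$ and $\|(A^* )^+_{n,k}-(A^* )^+_{n,j}\|\le1/n$; (2) $\mathcal B_p:A\mapsto(\alpha_{\max},\beta_{\max},\gamma_{\max})\in\mathbb R^3$ with $\alpha_{\max}\ge\|\alpha\|_\infty$, $\beta_{\max}\ge\|\beta\|_\infty$,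 $\gamma_{\max}\ge\|\gamma\|_\infty$; (3) $\mathcal C_p:(A,k,n)\mapsto(A^+_{n,k},(A^* )^+_{n,k})$. With $K_n=\mathcal A_p(A,n)$, define for $\varepsilon\ge0$ $$\Gamma^{n,\mathrm{fin}}_\varepsilon(A):=\Big\{\lambda\in\mathbb C:\min_{k\in K_n}\min\big(\nu(A^+_{n,k}-\lambda I^+_n),\nu((A^* )^+_{n,k}-\lambda I^+_n)\big)\le\varepsilon\Big\}.$$ With $\mathrm{Grid}(n,r):=\frac1n(\mathbb Z+\mathrm i\mathbb Z)\cap r\mathbb D$, where $\mathbb D$ is the open unit disc and $r\mathbb D=\{rz:z\in\mathbb D\}$, put $R:=\alpha_{\max}+\beta_{\max}+\gamma_{\max}$, $\varepsilon^*_n:=(\alpha_{\max}+\gamma_{\max})\frac{22}{7(n+1)}$, and $$\Gamma^n_{\mathrm{fin}}(A):=\Gamma^{n,\mathrm{fin}}_{\varepsilon^*_n+3/n}(A)\cap\mathrm{Grid}(n,R).$$ ''Arithmetic operations'' means real arithmetic operations and comparisons. $d_H(S,T):=\max(\sup_{s\in S}\mathrm{dist}(s,T),\sup_{t\in T}\mathrm{dist}(t,S))$ for bounded non-empty $S,T\subset\mathbb C$. $S+\frac2n\overline{\mathbb D}$ denotes the Minkowski sum. *)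

(* Defs.v *)
From HB Require Import structures.
From mathcomp Require Import all_boot all_order all_algebra.
From mathcomp Require Import finmap.
From mathcomp Require Import all_classical all_reals all_analysis.
From mathcomp Require Import complex.

Set Implicit Arguments.
Unset Strict Implicit.
Unset Printing Implicit Defensive.

Import Order.TTheory GRing.Theory Num.Theory.
Import numFieldNormedType.Exports.

Local Open Scope classical_set_scope.
Local Open Scope ring_scope.

Notation cmod := ComplexField.Normc.normc.

(** * Finite matrices *)

Definition vnorm (R : realType) (m : nat) (x : 'cV[R[i]]_m) : R :=
  Num.sqrt (\sum_i cmod (x i 0) ^+ 2).

Definition opnorm (R : realType) (m n : nat) (M : 'M[R[i]]_(m, n)) : R :=
  sup [set vnorm (M *m x) | x in [set x : 'cV[R[i]]_n | vnorm x <= 1]].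

(** The smallest singular value. *)
Definition nu (R : realType) (m n : nat) (M : 'M[R[i]]_(m, n)) : R :=
  inf [set vnorm (M *m x) | x in [set x : 'cV[R[i]]_n | vnorm x = 1]].

(** * The space l^2(Z, C^p) and the spectrum *)

(** The extended-real series of the squared norms; [ell2] is the set of the
    sequences for which it is finite. *)
Definition sqsum (R : realType) (p : nat) (x : int -> 'cV[R[i]]_p) : \bar R :=
  \esum_(i in [set: int]) (vnorm (x i) ^+ 2)%:E.

Definition ell2 (R : realType) (p : nat) : set (int -> 'cV[R[i]]_p) :=
  [set x | (sqsum x < +oo)%E].

Definition ell2_norm (R : realType) (p : nat) (x : int -> 'cV[R[i]]_p) : R :=
  Num.sqrt (fine (sqsum x)).

(** Operators on [ell2] are represented by maps on all sequences, of which only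
    the restriction to [ell2] matters. *)
Definition bounded_linear (R : realType) (p : nat)
    (B : (int -> 'cV[R[i]]_p) -> (int -> 'cV[R[i]]_p)) : Prop :=
  [/\ forall x, ell2 x -> ell2 (B x),
      forall (a : R[i]) x y, ell2 x -> ell2 y ->
        B (a *: x + y) = a *: B x + B y
    & exists M : R, forall x, ell2 x -> ell2_norm (B x) <= M * ell2_norm x].

Definition spectrum (R : realType) (p : nat)
    (T : (int -> 'cV[R[i]]_p) -> (int -> 'cV[R[i]]_p)) : set R[i] :=
  [set lambda | ~ exists B, [/\ bounded_linear B,
      forall x, ell2 x -> B (T x - lambda *: x) = x
    & forall x, ell2 x -> T (B x) - lambda *: B x = x]].

(** * Tridiagonal operators *)

Record tridiag (R : realType) (p : nat) := Tridiag {
  alpha : int -> 'M[R[i]]_p ;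
  beta : int -> 'M[R[i]]_p ;
  gamma : int -> 'M[R[i]]_p ;
  alpha_bounded : exists M : R, forall j, opnorm (alpha j) <= M ;
  beta_bounded : exists M : R, forall j, opnorm (beta j) <= M ;
  gamma_bounded : exists M : R, forall j, opnorm (gamma j) <= M }.

Definition tri_op (R : realType) (p : nat) (A : tridiag R p)
    (x : int -> 'cV[R[i]]_p) : int -> 'cV[R[i]]_p :=
  fun i => alpha A (i - 1) *m x (i - 1) + beta A i *m x i
           + gamma A (i + 1) *m x (i + 1).

Definition Spec (R : realType) (p : nat) (A : tridiag R p) : set R[i] :=
  spectrum (tri_op A).

Definition supnorm (R : realType) (p : nat) (c : int -> 'M[R[i]]_p) : R :=
  sup [set opnorm (c j) | j in [set: int]].

Definition mat (R : realType) (p : nat) (A : tridiag R p) (i j : int)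
    : 'M[R[i]]_p :=
  if i == j + 1 then alpha A j
  else if i == j then beta A j
  else if i == j - 1 then gamma A j
  else 0.

(** Plain block transposes: no complex conjugation. *)
Definition mat_adj (R : realType) (p : nat) (A : tridiag R p) (i j : int)
    : 'M[R[i]]_p := (mat A j i)^T.

(** [sect b n k] is the submatrix of [b] with block rows k, ..., k+n+1 and block
    columns k+1, ..., k+n. *)
Definition sect (R : realType) (p : nat) (b : int -> int -> 'M[R[i]]_p)
    (n : nat) (k : int) : 'M[R[i]]_(\sum_(i < n.+2) p, \sum_(j < n) p) :=
  \mxblock_(i < n.+2, j < n) b (k + i%:Z) (k + 1 + j%:Z).

Definition sectI (R : realType) (p n : nat)
    : 'M[R[i]]_(\sum_(i < n.+2) p, \sum_(j < n) p) :=
  \mxblock_(i < n.+2, j < n)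
    (if (i : nat) == j.+1 then 1%:M : 'M[R[i]]_p else 0).

(** * Input maps *)

Definition is_index_map (R : realType) (p : nat)
    (calA : tridiag R p -> nat -> {fset int}) : Prop :=
  forall (A : tridiag R p) (n : nat), (0 < n)%N ->
  forall k : int, exists2 j : int, j \in calA A n &
    opnorm (sect (mat A) n k - sect (mat A) n j) <= n%:R^-1 /\
    opnorm (sect (mat_adj A) n k - sect (mat_adj A) n j) <= n%:R^-1.

Definition is_bound_map (R : realType) (p : nat)
    (calB : tridiag R p -> R * R * R) : Prop :=
  forall A : tridiag R p,
    let: (amax, bmax, cmax) := calB A in
    [/\ supnorm (alpha A) <= amax, supnorm (beta A) <= bmax
      & supnorm (gamma A) <= cmax].

Definition calC (R : realType) (p : nat) (A : tridiag R p) (k : int) (n : nat)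
    : 'M[R[i]]_(\sum_(i < n.+2) p, \sum_(j < n) p)
      * 'M[R[i]]_(\sum_(i < n.+2) p, \sum_(j < n) p) :=
  (sect (mat A) n k, sect (mat_adj A) n k).

(** * The approximating sets *)

(** The minimum over [K] is taken in the extended reals, where it has the
    neutral element +oo. *)
Definition Gamma_eps_fin (R : realType) (p : nat) (A : tridiag R p) (n : nat)
    (K : {fset int}) (eps : R) : set R[i] :=
  [set lambda |
    (\big[Order.min/+oo]_(k <- enum_fset K)
       (Num.min (nu (sect (mat A) n k - lambda *: sectI R p n))
                (nu (sect (mat_adj A) n k - lambda *: sectI R p n)))%:E
     <= eps%:E)%E].

(** The second set is r times the open unit disc; for r = 0 it is {0}, not the
    empty set. *)
Definition Grid (R : realType) (n : nat) (r : R) : set R[i] :=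
  [set z | exists a b : int, z = Complex (a%:~R / n%:R) (b%:~R / n%:R)] `&`
  [set real_complex R r * z | z in [set z : R[i] | cmod z < 1]].

Definition eps_star (R : realType) (amax cmax : R) (n : nat) : R :=
  (amax + cmax) * (22%:R / (7%:R * n.+1%:R)).

Definition Gamma_fin (R : realType) (p : nat)
    (calA : tridiag R p -> nat -> {fset int})
    (calB : tridiag R p -> R * R * R) (A : tridiag R p) (n : nat) : set R[i] :=
  let: (amax, bmax, cmax) := calB A in
  Gamma_eps_fin A n (calA A n) (eps_star amax cmax n + 3%:R / n%:R) `&`
  Grid n (amax + bmax + cmax).

Definition Gamma_hat (R : realType) (p : nat)
    (calA : tridiag R p -> nat -> {fset int})
    (calB : tridiag R p -> R * R * R) (A : tridiag R p) (n : nat) : set R[i] :=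
  [set z + w | z in Gamma_fin calA calB A n
             & w in [set w : R[i] | cmod w <= 2%:R / n%:R]].

(** * Hausdorff distance *)

(** Computed in the extended reals, so that it is not a finite number by
    convention when one of the sets is empty or unbounded. *)
Definition setdist (R : realType) (z : R[i]) (S : set R[i]) : \bar R :=
  ereal_inf [set (cmod (z - s))%:E | s in S].

Definition dH (R : realType) (S T : set R[i]) : \bar R :=
  Order.max (ereal_sup [set setdist s T | s in S])
            (ereal_sup [set setdist t S | t in T]).

(** * Computation with finitely many real arithmetic operations *)

(** A real RAM, presented as a while language.  The machine has natural-number
    registers (used for counting and addressing), arrays of real cells, and an
    output tape of complex numbers.  Exact arithmetic and exact comparisons of
    reals are the only operations on reals; the programs contain no real
    constants other than natural numbers. *)

Inductive iexp :=
  | IReg of nat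
  | INat of nat
  | IAdd of iexp & iexp
  | ISub of iexp & iexp
  | IMul of iexp & iexp.

Inductive rexp :=
  | RCell of nat & iexp
  | ROfNat of iexp
  | RAdd of rexp & rexp
  | RSub of rexp & rexp
  | RMul of rexp & rexp
  | RDiv of rexp & rexp.

Inductive test :=
  | ILt of iexp & iexp
  | RLt of rexp & rexp.

Inductive cmd :=
  | Skip
  | ISet of nat & iexp
  | RSet of nat & iexp & rexp
  | Emit of rexp & rexp
  | Seq of cmd & cmd
  | If of test & cmd & cmd
  | While of test & cmd.

Record state (R : realType) := State {
  ireg : nat -> nat ;
  cell : nat -> nat -> R ;
  outp : seq R[i] }.

Fixpoint ieval (R : realType) (s : state R) (e : iexp) : nat :=
  match e with
  | IReg v => ireg s v
  | INat c => c
  | IAdd e1 e2 => (ieval s e1 + ieval s e2)%N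
  | ISub e1 e2 => (ieval s e1 - ieval s e2)%N
  | IMul e1 e2 => (ieval s e1 * ieval s e2)%N
  end.

Fixpoint reval (R : realType) (s : state R) (e : rexp) : R :=
  match e with
  | RCell a i => cell s a (ieval s i)
  | ROfNat i => (ieval s i)%:R
  | RAdd e1 e2 => reval s e1 + reval s e2
  | RSub e1 e2 => reval s e1 - reval s e2
  | RMul e1 e2 => reval s e1 * reval s e2
  | RDiv e1 e2 => reval s e1 / reval s e2
  end.

Definition teval (R : realType) (s : state R) (b : test) : bool :=
  match b with
  | ILt e1 e2 => (ieval s e1 < ieval s e2)%N
  | RLt e1 e2 => reval s e1 < reval s e2
  end.

Definition set_reg (R : realType) (s : state R) (v c : nat) : state R :=
  State (fun w => if w == v then c else ireg s w) (cell s) (outp s).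

Definition set_mem (R : realType) (s : state R) (a i : nat) (x : R) : state R :=
  State (ireg s)
    (fun b j => if (b == a) && (j == i) then x else cell s b j) (outp s).

Definition emit (R : realType) (s : state R) (z : R[i]) : state R :=
  State (ireg s) (cell s) (rcons (outp s) z).

(** Big-step semantics.  A derivation of [exec c s t] is a finite tree, hence
    describes a run which halts after finitely many operations. *)
Inductive exec (R : realType) : cmd -> state R -> state R -> Prop :=
  | exec_skip s : exec Skip s s
  | exec_iset s v e : exec (ISet v e) s (set_reg s v (ieval s e))
  | exec_rset s a i e :
      exec (RSet a i e) s (set_mem s a (ieval s i) (reval s e))
  | exec_emit s x y :
      exec (Emit x y) s (emit s (Complex (reval s x) (reval s y)))
  | exec_seq s t u c d : exec c s t -> exec d t u -> exec (Seq c d) s u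
  | exec_if_true s t b c d : teval s b -> exec c s t -> exec (If b c d) s t
  | exec_if_false s t b c d : ~~ teval s b -> exec d s t -> exec (If b c d) s t
  | exec_while_end s b c : ~~ teval s b -> exec (While b c) s s
  | exec_while_step s t u b c :
      teval s b -> exec c s t -> exec (While b c) t u -> exec (While b c) s u.

Definition row_major (T : Type) (m n : nat) (M : 'M[T]_(m, n)) : seq T :=
  [seq M i j | i <- enum 'I_m, j <- enum 'I_n].

(** Register 0 holds n and register 1 holds the size of K; array 0 holds the
    three bounds, array 1 the elements of K, arrays 2 and 3 (resp. 4 and 5) the
    real and imaginary parts of the entries of the first (resp. second)
    components of the pairs [C k], in the order of array 1.  Everything else is
    zero. *)
Definition initial_state (R : realType) (n m1 m2 : nat) (K : {fset int})
    (C : int -> 'M[R[i]]_(m1, m2) * 'M[R[i]]_(m1, m2)) (bounds : R * R * R)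
    : state R :=
  let: (amax, bmax, cmax) := bounds in
  let first := flatten [seq row_major (C k).1 | k <- enum_fset K] in
  let second := flatten [seq row_major (C k).2 | k <- enum_fset K] in
  let arrays := [:: [:: amax; bmax; cmax];
                    [seq k%:~R | k <- enum_fset K];
                    [seq complex.Re z | z <- first];
                    [seq complex.Im z | z <- first];
                    [seq complex.Re z | z <- second];
                    [seq complex.Im z | z <- second]] in
  State (fun v => nth 0%N [:: n; size (enum_fset K)] v)
        (fun a i => nth 0 (nth [::] arrays a) i)
        [::].

(** From the initial state [s], the program halts having listed exactly the
    elements of [S], in any order and possibly with repetitions. *)
Definition computes (R : realType) (prog : cmd) (s : state R) (S : set R[i])
    : Prop :=
  exists2 t : state R, exec prog s t & [set z | z \in outp t] = S.

(* Main.v *)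
Require Import Defs.
From HB Require Import structures.
From mathcomp Require Import all_boot all_order all_algebra.
From mathcomp Require Import finmap.
From mathcomp Require Import all_classical all_reals all_analysis.
From mathcomp Require Import complex.
From mathcomp Require Import ring lra zify.

(* Spectral side.  [l] is outside the spectrum of [A] iff both [A - l] and
   [A^T - l] are bounded below, so it suffices to compare lower bounds with the
   singular values of the sections.  Sections of a bounded-below operator inherit
   its lower bound, since a finitely supported vector meets only the rows of one
   section.  Conversely, if every section has [nu >= c], apply this to
   [x] times the window [sin (pi j / (n+1))] and sum over all positions of the
   window: the commutator of [A] with the window costs at most
   [2 sin (pi / (2(n+1)))] times [amax + cmax], and [pi <= 22/7].  Hence the
   spectrum is within [eps_star] of being detected by sections, uniformly in the
   position, and rounding to the grid and to [K_n] costs at most [3/n].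
   Conversely the resolvent bound is uniform on compact sets away from the
   spectrum, so detected points converge to the spectrum, which is not empty.

   Computation.  [nu M <= e] fails iff [M^* M - e^2] is positive definite; after
   replacing complex entries by real 2 x 2 blocks, this holds iff all the pivots
   of Gaussian elimination are positive. *)

Set Implicit Arguments.
Unset Strict Implicit.
Unset Printing Implicit Defensive.

Import Order.TTheory GRing.Theory Num.Theory.
Import numFieldNormedType.Exports.

Local Open Scope classical_set_scope.
Local Open Scope ring_scope.
Local Open Scope complex_scope.

(** * Inner products, adjoints and lower bounds *)

(** A lower bound for [A - l] gives injectivity and closed range only; surjectivity comes from the
    second bound, because [T T'] is coercive when the adjoint [T'] is bounded below. The Hilbert
    adjoint carries complex conjugates which [mat_adj] lacks. Entrywise conjugation is an antilinear
    isometry, and it shows that the plain transpose at [l] has the same lower bounds as the adjoint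
    at [conjc l].

    Sections have two block rows more than block columns, so no part of the image of a vector
    supported in the columns is cut off. Square truncations would lose this and could have small
    singular values unrelated to the spectrum.

    Nonemptiness of the spectrum matters because the distance [dH] to an empty set cannot tend to 0.
    The usual contour integrals of the resolvent are replaced by averages over the [2^j]-th roots of
    a parameter, so that only algebra and norm estimates enter.

    The machine has no square roots. Squaring the tolerance and testing definiteness by pivots makes
    each comparison of [nu] with the tolerance exact, including the case of equality. *)

(* The real part of a Hermitian inner product; [ipZl] encodes sesquilinearity. *)
Record inner (R : realType) (V : lmodType R[i]) := Inner {
  ip :> V -> V -> R;
  ipC : forall x y, ip x y = ip y x;
  ipDl : forall x y z, ip (x + y) z = ip x z + ip y z;
  ipZl : forall (a : R[i]) x y, ip (a *: x) y = ip x (conjc a *: y);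
  ipRl : forall (t : R) x y, ip (t%:C *: x) y = t * ip x y;
  ip_ge0 : forall x, 0 <= ip x x;
  ip_eq0 : forall x, ip x x = 0 -> x = 0 }.

Definition nrm (R : realType) (V : lmodType R[i]) (I : inner V) (x : V) : R :=
  Num.sqrt (I x x).

Section InnerTheory.
Variables (R : realType) (V : lmodType R[i]) (I : inner V).
Implicit Types (x y z : V) (a : R[i]).
Local Notation N := (nrm I).

Lemma ip0l x : I 0 x = 0.
Proof. by rewrite -(scale0r x) (ipRl I 0) mul0r. Qed.

Lemma ipNl x y : I (- x) y = - I x y.
Proof. by apply/eqP; rewrite -addr_eq0 -ipDl addNr ip0l. Qed.

Lemma ipBl x y z : I (x - y) z = I x z - I y z.
Proof. by rewrite ipDl ipNl. Qed.

Lemma ipDr x y z : I z (x + y) = I z x + I z y.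
Proof. by rewrite ipC ipDl !(ipC I z). Qed.

Lemma ipNr x y : I y (- x) = - I y x.
Proof. by rewrite ipC ipNl ipC. Qed.

Lemma ipBr x y z : I z (x - y) = I z x - I z y.
Proof. by rewrite ipDr ipNr. Qed.

Lemma ipRr (t : R) x y : I x (t%:C *: y) = t * I x y.
Proof. by rewrite ipC ipRl ipC. Qed.

Lemma nrm_ge0 x : 0 <= N x.
Proof. exact: sqrtr_ge0. Qed.

Lemma nrm_sqr x : N x ^+ 2 = I x x.
Proof. by rewrite sqr_sqrtr ?ip_ge0. Qed.

Lemma nrm0 : N 0 = 0.
Proof. by rewrite /nrm ip0l sqrtr0. Qed.

Lemma nrm_eq0 x : N x = 0 -> x = 0.
Proof. by move=> h; apply: (@ip_eq0 _ _ I); rewrite -nrm_sqr h expr0n. Qed.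

Lemma nrm_gt0 x : x != 0 -> 0 < N x.
Proof.
by move=> x0; rewrite lt_def nrm_ge0 andbT; apply: contra_neq x0 => /nrm_eq0.
Qed.

(** Expanding the squared norm of [N y * x - N x * y] gives [2 u v (u v - w)], where [u], [v] are
    the norms and [w] is the real product; no phase has to be optimised. *)
Lemma cauchy_schwarz x y : I x y <= N x * N y.
Proof.
have [->|x0] := eqVneq x 0; first by rewrite ip0l nrm0 mul0r.
have [->|y0] := eqVneq y 0; first by rewrite ipC ip0l nrm0 mulr0.
have := ip_ge0 I ((N y)%:C *: x - (N x)%:C *: y).
rewrite ipBl !ipBr !ipRl !ipRr -!nrm_sqr (ipC _ y x).
have := nrm_gt0 x0; have := nrm_gt0 y0.
move: (N x) (N y) (I x y) => u v w v0 u0 h.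
have : 0 <= 2 * (u * v) * (u * v - w) by nra.
by rewrite pmulr_rge0 ?subr_ge0// mulr_gt0// mulr_gt0.
Qed.

Lemma nrmD x y : N (x + y) <= N x + N y.
Proof.
rewrite -(@ler_pXn2r _ 2) ?nnegrE ?addr_ge0 ?nrm_ge0//.
rewrite sqrrD !nrm_sqr ipDl !ipDr (ipC _ y x).
have := cauchy_schwarz x y; rewrite mulr2n; lra.
Qed.

Lemma cmod_sqr (a : R[i]) : (cmod a ^+ 2)%:C = conjc a * a.
Proof.
case: a => a b /=; rewrite sqr_sqrtr ?addr_ge0 ?sqr_ge0//.
by apply/eqP; rewrite eq_complex /=; apply/andP; split; apply/eqP; ring.
Qed.

Lemma cmod_ge0 (a : R[i]) : 0 <= cmod a.
Proof. by case: a => a b; exact: sqrtr_ge0. Qed.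

Lemma nrmZ a x : N (a *: x) = cmod a * N x.
Proof.
rewrite -[LHS]ger0_norm ?nrm_ge0// -sqrtr_sqr nrm_sqr ipZl scalerA -cmod_sqr.
by rewrite ipRr -nrm_sqr -exprMn sqrtr_sqr ger0_norm ?mulr_ge0 ?nrm_ge0 ?cmod_ge0.
Qed.

Lemma nrmN x : N (- x) = N x.
Proof. by rewrite /nrm ipNl ipNr opprK. Qed.

Lemma nrmB x y : N (x - y) <= N x + N y.
Proof. by rewrite -(nrmN y) nrmD. Qed.

Lemma nrmBC x y : N (x - y) = N (y - x).
Proof. by rewrite -nrmN opprB. Qed.

Lemma nrm_leB x y : N x - N y <= N (x - y).
Proof. by rewrite lerBlDr -{1}(subrK y x) nrmD. Qed.

End InnerTheory.

Lemma geometric_le0 (R : realType) (a K q : R) : 0 <= q < 1 ->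
  (forall n, a <= K * q ^+ n) -> a <= 0.
Proof.
move=> /andP[q0 q1] h.
have q1' : `|q| < 1 by rewrite ger0_norm.
have := cvg_geometric K q1' => /(@cvg_lim _ _ _).
move=> /(_ (@Rhausdorff R)) <-.
apply: limr_ge; first by apply/cvg_ex; exists 0; exact: cvg_geometric.
by near=> n; exact: h.
Unshelve. all: end_near. Qed.

Lemma geometric_small (R : realType) (q e : R) : 0 <= q < 1 -> 0 < e ->
  exists J, forall n, (J <= n)%N -> q ^+ n < e.
Proof.
move=> /andP[q0 q1] e0.
have q1' : `|q| < 1 by rewrite ger0_norm.
have /cvgrPdist_lt /(_ e e0) [J _ h] := cvg_expr q1'.
exists J => n /h /=; rewrite sub0r normrN ger0_norm// exprn_ge0//.
Qed.

Section Operators.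
Variables (R : realType) (V : lmodType R[i]) (I : inner V).
Implicit Types (x y z : V) (T : {linear V -> V}) (l : R[i]).
Local Notation N := (nrm I).

Definition op_sub T l : {linear V -> V} := T \- (l \*: idfun).

Definition bounded_below (T : V -> V) (c : R) := forall x, c * N x <= N (T x).

Definition adjoint (T T' : V -> V) := forall x y, I (T x) y = I x (T' y).

(** Completeness for geometrically dominated series, phrased with an explicit tail bound so that no
    topology on [V] is involved. *)
Definition complete_inner := forall (u : nat -> V) (C q : R), 0 <= q < 1 ->
  (forall k, N (u k) <= C * q ^+ k) ->
  exists s, forall n, N (s - \sum_(k < n) u k) <= C * q ^+ n / (1 - q).

Lemma op_subE T l x : op_sub T l x = T x - l *: x.
Proof. by []. Qed.

Lemma adjoint_op_sub T T' l : adjoint T T' ->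
  adjoint (op_sub T l) (op_sub T' (conjc l)).
Proof. by move=> TT' x y; rewrite !op_subE ipBl ipBr TT' ipZl. Qed.

Lemma bounded_below_near T (l m : R[i]) c d :
  bounded_below (op_sub T l) c -> d <= c - cmod (m - l) ->
  bounded_below (op_sub T m) d.
Proof.
move=> h dc x; apply: (le_trans (ler_wpM2r (nrm_ge0 I x) dc)).
have -> : op_sub T m x = op_sub T l x - (m - l) *: x.
  by rewrite !op_subE scalerBl opprB addrA subrK.
by rewrite mulrBl; apply: le_trans (nrm_leB I _ _); rewrite nrmZ lerD2r.
Qed.

Lemma bounded_belowW (T : V -> V) c d : d <= c -> bounded_below T c -> bounded_below T d.
Proof.
by move=> dc h x; apply: le_trans (h x); rewrite ler_wpM2r ?nrm_ge0.
Qed.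

(* Richardson iteration: [1 - t P] is a contraction for [t = c / M^2]. *)
Lemma coercive_surj (P : {linear V -> V}) (c M : R) : complete_inner ->
  0 < c -> (forall x, N (P x) <= M * N x) ->
  (forall x, c * N x ^+ 2 <= I (P x) x) -> forall y, exists x, P x = y.
Proof.
move=> compl c0 PM Pc y.
(* Enlarging [M] gives [c / M < 1], so that [q2] is positive and its square root is a genuine
   contraction factor. *)
wlog cM : M PM / c < M.
  move=> h; apply: (h (Num.max M (c + 1))).
    by move=> x; apply: le_trans (PM x) _; rewrite ler_wpM2r ?nrm_ge0// le_max lexx.
  by rewrite lt_max ltrDl ltr01 orbT.
have M0 : 0 < M by exact: lt_trans cM.
pose t := c / M ^+ 2; pose q2 := 1 - (c / M) ^+ 2; pose q := Num.sqrt q2.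
have cM1 : 0 < c / M < 1 by rewrite divr_gt0//= ltr_pdivrMr// mul1r.
have q2E : 0 < q2 < 1.
  by move: cM1; rewrite /q2 => /andP[a b]; apply/andP; split; nra.
have qE : 0 <= q < 1.
  rewrite sqrtr_ge0/= -(ltr_pXn2r (n:=2))// ?nnegrE ?sqrtr_ge0//.
  by rewrite sqr_sqrtr ?expr1n; case/andP: q2E => // /ltW.
have qq : q ^+ 2 = q2 by rewrite sqr_sqrtr//; case/andP: q2E => /ltW.
pose S x := x - t%:C *: P x.
have t0 : 0 < t by rewrite divr_gt0// exprn_gt0.
(* The squared factor is at most [1 - 2 t c + t^2 M^2]; the chosen [t] minimises it, with value
   [1 - t c = q2]. *)
have Sq x : N (S x) <= q * N x.
  rewrite -(ler_pXn2r (n:=2))// ?nnegrE ?mulr_ge0 ?nrm_ge0//; last by case/andP: qE.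
  rewrite exprMn qq.
  rewrite nrm_sqr /S ipBl !ipBr !ipRl !ipRr (ipC I x (P x)) -!nrm_sqr.
  have h1 := Pc x; have h2 := PM x.
  have h3 : N (P x) ^+ 2 <= M ^+ 2 * N x ^+ 2.
    by rewrite -exprMn ler_pXn2r ?nnegrE ?nrm_ge0// mulr_ge0 ?nrm_ge0// ltW.
  have e1 : t * M ^+ 2 = c by rewrite /t mulfVK ?expf_neq0 ?gt_eqF.
  have e2 : (c / M) ^+ 2 = t * c.
    by rewrite /t expr_div_n expr2 mulrAC.
  rewrite /q2 e2.
  have h4 : t * t * N (P x) ^+ 2 <= t * c * N x ^+ 2.
    by rewrite -mulrA -[leRHS]mulrA ler_pM2l// -e1 -mulrA ler_pM2l.
  have h5 : t * (c * N x ^+ 2) <= t * I (P x) x by rewrite ler_pM2l.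
  lra.
pose u k := iter k S y.
have uN k : N (u k) <= N y * q ^+ k.
  elim: k => [|k IH]; first by rewrite expr0 mulr1.
  rewrite /u iterS; apply: (le_trans (Sq _)).
  by rewrite exprS mulrCA ler_wpM2l//; case/andP: qE.
have [s sE] := compl u (N y) q qE uN.
exists (t%:C *: s); apply/eqP; rewrite -subr_eq0; apply/eqP/(@nrm_eq0 _ _ I).
apply/eqP; rewrite eq_le nrm_ge0 andbT.
apply: (@geometric_le0 _ _ (t * M * (N y / (1 - q)) + N y) _ qE) => n.
(* Since [t P = 1 - S] and [u k] is the [k]-th iterate of [S] on [y], the partial sums of the
   Neumann series telescope. *)
have telescope_sum : P (t%:C *: \sum_(k < n) u k) = y - u n.
  elim: n => [|n IH]; first by rewrite big_ord0 scaler0 linear0 subrr.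
  rewrite big_ord_recr scalerDr linearD IH linearZ /= -/(u n) /S.
  by rewrite opprB addrA addrAC.
have -> : P (t%:C *: s) - y =
    t%:C *: P (s - \sum_(k < n) u k) - u n.
  rewrite linearB scalerBr -!linearZ telescope_sum opprB addrA addrAC.
  by rewrite addrK.
apply: (le_trans (nrmB _ _ _)); rewrite mulrDl lerD// nrmZ /= expr0n addr0 sqrtr_sqr gtr0_norm//.
rewrite -(mulrA t M) -(mulrA t) ler_pM2l//.
by apply: (le_trans (PM _)); rewrite -mulrA ler_pM2l// mulrAC; exact: sE.
Qed.

(** The product of [T (T' x)] with [x] is the squared norm of [T' x], so [T T'] is coercive with
    constant [c ^+ 2], hence onto, and so is [T]. *)
Lemma adjoint_bounded_below_surj T T' (M c : R) : complete_inner ->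
  adjoint T T' -> (forall x, N (T x) <= M * N x) ->
  (forall x, N (T' x) <= M * N x) -> 0 < c -> bounded_below T' c ->
  forall y, exists x, T x = y.
Proof.
move=> compl TT' TM T'M c0 cT' y.
(* A negative [M] is possible only if all norms vanish; otherwise [M ^+ 2] bounds [T T']. *)
have M0 : 0 <= M \/ forall x, N x = 0.
  have [|M0] := leP 0 M; [by left|right => x].
  apply/eqP; rewrite eq_le nrm_ge0 andbT.
  by have := le_trans (nrm_ge0 I _) (TM x); rewrite nmulr_rge0.
case: M0 => [M0|N0]; last by exists 0; rewrite linear0 (nrm_eq0 (N0 y)).
have [||x xE] := @coercive_surj (T \o T') (c ^+ 2) (M ^+ 2) compl (exprn_gt0 2 c0) _ _ y.
- by move=> x; rewrite expr2 -mulrA (le_trans (TM _))// ler_wpM2l.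
- move=> x; rewrite /= TT' -nrm_sqr -exprMn ler_pXn2r// ?nnegrE ?nrm_ge0//.
  by rewrite mulr_ge0 ?nrm_ge0// ltW.
by exists (T' x).
Qed.

(** With a right inverse [B], the squared norm of [y] is the product of [T (B y)] with [y], that is
    of [B y] with [T' y], and Cauchy-Schwarz applies. *)
Lemma adjoint_bounded_below T T' B (M : R) : adjoint T T' -> 0 < M ->
  (forall x, N (B x) <= M * N x) -> (forall x, T (B x) = x) ->
  bounded_below T' M^-1.
Proof.
move=> TT' M0 BM TB y; rewrite ler_pdivrMl//.
have [->|y0] := eqVneq y 0; first by rewrite nrm0 mulr_ge0 ?nrm_ge0// ltW.
have := cauchy_schwarz I (B y) (T' y); rewrite -TT' TB -nrm_sqr => h.
rewrite -(ler_pM2l (nrm_gt0 I y0)) -expr2 (le_trans h)//.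
by rewrite mulrCA mulrA ler_wpM2r ?nrm_ge0.
Qed.

End Operators.

(** * Nonemptiness of the spectrum *)

Lemma le_cmodD (R : realType) (a b : R[i]) : cmod (a + b) <= cmod a + cmod b.
Proof. exact: le_normcD. Qed.

Lemma cmodN (R : realType) (a : R[i]) : cmod (- a) = cmod a.
Proof. exact: normcN. Qed.

Lemma cmodM (R : realType) (a b : R[i]) : cmod (a * b) = cmod a * cmod b.
Proof. exact: ComplexField.Normc.normcM. Qed.

Lemma cmodC (R : realType) (t : R) : cmod t%:C = `|t|.
Proof. by rewrite /= expr0n addr0 sqrtr_sqr. Qed.

Lemma cmod_le_ReIm (R : realType) (z : R[i]) :
  cmod z <= `|complex.Re z| + `|complex.Im z|.
Proof.
case: z => a b /=; rewrite -(ler_pXn2r (n:=2))// ?nnegrE ?sqrtr_ge0 ?addr_ge0//.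
rewrite sqr_sqrtr ?addr_ge0 ?sqr_ge0// sqrrD !real_normK ?num_real//.
by rewrite lerD2r lerDl mulrn_wge0// mulr_ge0.
Qed.

Lemma cmod_ge_Re (R : realType) (z : R[i]) : `|complex.Re z| <= cmod z.
Proof. by case: z => a b /=; rewrite -[leLHS]sqrtr_sqr ler_wsqrtr// lerDl sqr_ge0. Qed.

Lemma cmod_ge_Im (R : realType) (z : R[i]) : `|complex.Im z| <= cmod z.
Proof. by case: z => a b /=; rewrite -[leLHS]sqrtr_sqr ler_wsqrtr// lerDr sqr_ge0. Qed.

(** Compactness of a square containing the disc. Asking [Q w d] for all small [d], not for one, lets
    the filter at [0] from the right take the minimum over a finite cover. *)
Lemma disc_uniform (R : realType) (r : R) (Q : R[i] -> R -> Prop) :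
  (forall z, exists2 c, 0 < c &
     forall w d, cmod (w - z) < c -> 0 < d < c -> Q w d) ->
  exists2 c, 0 < c & forall z, cmod z <= r -> Q z c.
Proof.
move=> H.
have K : compact (`[-r, r] `*` `[-r, r] : set (R * R)).
  by apply: compact_setX; exact: segment_compact.
have := (compact_near_coveringP _).1 K R (0 : R)^'+
  (fun d x => Q (x.1 +i* x.2) d) _.
case.
  move=> [a b] _ /=; have [c c0 cQ] := H (a +i* b).
  have c2 : 0 < c / 2 by rewrite divr_gt0.
  exists (ball a (c / 2) `*` ball b (c / 2), [set d | 0 < d < c]) => /=.
    split.
      by exists (ball a (c / 2), ball b (c / 2)) => //=; split; exact: nbhsx_ballx.
    exists c => //= d /=; rewrite sub0r normrN => dc d0.
    by rewrite d0 -(gtr0_norm d0).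
  move=> [[x1 x2] d] /= [[/= x1a x2b] dc]; apply: cQ => //.
  apply: (le_lt_trans (cmod_le_ReIm _)) => /=; rewrite (splitr c) ltrD//.
    by rewrite distrC.
  by rewrite distrC.
move=> e e0 eQ; exists (e / 2); first by rewrite divr_gt0.
move=> [a b] ab.
apply: (eQ (e / 2) _ _ (a, b)) => //=.
- by rewrite sub0r normrN ger0_norm ?divr_ge0// ?ltW// ltr_pdivrMr// ltr_pMr// ltr1n.
- by rewrite divr_gt0.
- have h1 := le_trans (cmod_ge_Re _) ab; have h2 := le_trans (cmod_ge_Im _) ab.
  by rewrite /= !in_itv/= -!ler_norml.
Qed.

Section Nonempty.
Variables (R : realType) (V : lmodType R[i]) (I : inner V).
Implicit Types (x y : V) (l mu : R[i]).
Variables (T : {linear V -> V}) (M : R).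
Hypotheses (M_gt0 : 0 < M) (T_bounded : forall x, nrm I (T x) <= M * nrm I x).
Local Notation N := (nrm I).
Local Notation "j .-pow" := (iter (2 ^ j) T) (at level 2, format "j .-pow").

Lemma iter_linearZ n (a : R[i]) x : iter n T (a *: x) = a *: iter n T x.
Proof. by elim: n => //= n ->; rewrite linearZ. Qed.

Lemma iter_linearB n x y : iter n T (x - y) = iter n T x - iter n T y.
Proof. by elim: n => //= n ->; rewrite linearB. Qed.

Lemma iter_linearD n x y : iter n T (x + y) = iter n T x + iter n T y.
Proof. by elim: n => //= n ->; rewrite linearD. Qed.

Lemma iter_bounded n x : N (iter n T x) <= M ^+ n * N x.
Proof.
elim: n => [|n IH]; first by rewrite mul1r.
by rewrite iterS exprS -mulrA (le_trans (T_bounded _))// ler_pM2l.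
Qed.

Variable (Res : R[i] -> V -> V).

(* [dyadic_res j mu] stands for mu (T^(2^j) - mu)^-1; the recursion is
   the partial fraction 2 s^2 / (z^2 - s^2) = s / (z - s) - s / (z + s). *)
Fixpoint dyadic_res (j : nat) (mu : R[i]) (x : V) : V :=
  if j is j'.+1 then
    2^-1 *: (dyadic_res j' (sqrtC mu) x + dyadic_res j' (- sqrtC mu) x)
  else mu *: Res mu x.

(** Keeps the iterated roots of a parameter of modulus at most [r ^+ (2 ^ j)] in the disc of radius
    [r], where [Res] is controlled. *)
Lemma cmod_sqrtC mu r j : cmod mu <= r ^+ (2 ^ j.+1) -> 0 <= r ->
  cmod (sqrtC mu) <= r ^+ (2 ^ j).
Proof.
rewrite -{1}(sqrtCK mu) expr2 cmodM -expr2 expnSr exprM => h r0.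
by rewrite -(ler_pXn2r (n:=2))// ?nnegrE ?cmod_ge0// exprn_ge0.
Qed.

Lemma half_sum_le x y a : N x <= a -> N y <= a -> N (2^-1 *: (x + y)) <= a.
Proof.
move=> xa ya; rewrite nrmZ.
have -> : cmod (2^-1 : R[i]) = 2^-1.
  rewrite ComplexField.Normc.normcV -(rmorph_nat (real_complex R) 2) /=.
  by rewrite expr0n addr0 sqrtr_sqr normr_nat.
by rewrite mulrC ler_pdivrMr// mulr2n mulrDr mulr1 (le_trans (nrmD _ _ _))// lerD.
Qed.

Lemma half_double x : 2^-1 *: (x + x) = x.
Proof. by rewrite -mulr2n -(scaler_nat 2 x) scalerA mulVf ?scale1r ?pnatr_eq0. Qed.

Variables (r0 c : R).
Hypotheses (r0_ge0 : 0 <= r0) (c_gt0 : 0 < c).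
Hypothesis ResK : forall l x, cmod l <= r0 -> op_sub T l (Res l x) = x.
Hypothesis KRes : forall l x, cmod l <= r0 -> Res l (op_sub T l x) = x.
Hypothesis bb : forall l, cmod l <= r0 -> bounded_below I (op_sub T l) c.

(** With [P] the power of order [2 ^ j] and [s] a root of [mu], the inductive equations
    [P u = s (u + x)] and [P v = - s (v + x)] make [P] exchange [u + v] and [u - v] up to known
    terms. *)
Lemma dyadic_resK j mu x : cmod mu <= r0 ^+ (2 ^ j) ->
  j.-pow (dyadic_res j mu x) - mu *: dyadic_res j mu x = mu *: x.
Proof.
elim: j mu => [|j IH] mu mur.
  rewrite /= linearZ scalerA mulrC -scalerA -scalerBr; congr (_ *: _).
  by apply: ResK; rewrite -(expr1 r0).
have sr := cmod_sqrtC mur r0_ge0.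
have /IH e1 := sr; have /IH e2 : cmod (- sqrtC mu) <= r0 ^+ (2 ^ j).
  by rewrite cmodN.
rewrite -{2 4}(sqrtCK mu) /= expnSr muln2 -addnn iterD.
move: e1 e2; set s := sqrtC mu; set u := dyadic_res _ _ _; set v := dyadic_res _ _ _.
move=> /(canRL (subrK _)) e1 /(canRL (subrK _)) e2.
have e3 : j.-pow (u + v) = s *: (u - v).
  by rewrite iter_linearD e1 e2 addrACA !scaleNr subrr add0r scalerBr.
have e4 : j.-pow (u - v) = s *: (u + v) + s *: (x + x).
  rewrite iter_linearB e1 e2 !scaleNr !opprD !opprK addrACA !scalerDr addrC.
  by [].
rewrite !iter_linearZ e3 iter_linearZ e4 scalerDr !scalerA -expr2 scalerDr.
rewrite [s ^+ 2 * _]mulrC [_ *: (_ *: _) as X in X + _ - _]scalerA addrC addKr.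
by rewrite scalerA -[2^-1 * _]mulrC -scalerA half_double.
Qed.

Lemma Kdyadic_res j mu x : cmod mu <= r0 ^+ (2 ^ j) ->
  dyadic_res j mu (j.-pow x - mu *: x) = mu *: x.
Proof.
elim: j mu x => [|j IH] mu x mur.
  by rewrite /= KRes// -(expr1 r0).
have sr := cmod_sqrtC mur r0_ge0.
rewrite -{2 3}(sqrtCK mu) /= expnSr muln2 -addnn iterD; set s := sqrtC mu in sr *.
have e (t : R[i]) : t ^+ 2 = s ^+ 2 -> j.-pow (j.-pow x) - s ^+ 2 *: x =
    j.-pow (j.-pow x + t *: x) - t *: (j.-pow x + t *: x).
  move=> <-; rewrite iter_linearD iter_linearZ scalerDr opprD scalerA -expr2.
  by rewrite addrA addrK.
rewrite {1}(e s)// (e (- s)) ?sqrrN// !IH ?cmodN//.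
rewrite -[RHS]half_double; congr (_ *: _).
by rewrite !scalerDr !scalerA mulrNN !scaleNr -expr2 addrACA subrr add0r.
Qed.

(** Averaging does not increase norms, so the bound at level 0 survives with a constant independent
    of [j]. The whole argument rests on this uniformity. *)
Lemma dyadic_res_le j mu x rho : 0 <= rho <= r0 -> cmod mu <= rho ^+ (2 ^ j) ->
  N (dyadic_res j mu x) <= rho / c * N x.
Proof.
move=> /andP[rho0 rr0]; elim: j mu => [|j IH] mu mur.
  rewrite /= nrmZ -mulrA; apply: ler_pM; rewrite ?cmod_ge0 ?nrm_ge0//.
  rewrite ler_pdivlMl//; have mur0 : cmod mu <= r0 by exact: le_trans rr0.
  by have := bb mur0 (Res mu x); rewrite ResK.
have sr := cmod_sqrtC mur rho0.
by apply: half_sum_le; apply: IH; rewrite ?cmodN.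
Qed.

(** A radial change of the parameter by [t] at the level of the roots changes every averaged term by
    [O(1 - t)], by the resolvent identity, again uniformly in [j]. *)
Lemma dyadic_res_scale j mu x t : 0 <= t <= 1 -> cmod mu <= r0 ^+ (2 ^ j) ->
  N (dyadic_res j ((t ^+ (2 ^ j))%:C * mu) x - dyadic_res j mu x) <=
  (1 - t) * r0 * (1 + r0 / c) / c * N x.
Proof.
move=> /andP[t0 t1]; elim: j mu => [|j IH] mu mur.
  rewrite /= expr1 [in leRHS]mulrAC ler_pdivlMr//.
  rewrite expr1 in mur.
  have tmur : cmod (t%:C * mu) <= r0.
    rewrite cmodM cmodC ger0_norm//; apply: le_trans mur.
    by rewrite ler_piMl ?cmod_ge0.
  rewrite mulrC; apply: (le_trans (bb tmur _)).
  set u := t%:C * mu in tmur *.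
  have -> : op_sub T u (u *: Res u x - mu *: Res mu x) =
     - ((1 - t)%:C * mu) *: (x + mu *: Res mu x).
    rewrite linearB.
    have -> : op_sub T u (u *: Res u x) = u *: x by rewrite linearZ_LR ResK.
    have -> : op_sub T u (mu *: Res mu x) =
        mu *: (x + ((1 - t)%:C * mu) *: Res mu x).
      rewrite linearZ_LR; congr (_ *: _).
      rewrite -[X in _ = X + _](ResK x mur) !op_subE -addrA; congr (_ + _).
      apply/eqP; rewrite eq_sym addrC subr_eq [X in _ == X]addrC -scalerBl;
      apply/eqP.
      by congr (_ *: _); rewrite /u rmorphB rmorph1; ring.
    rewrite !scalerDr !scalerA opprD addrA -scalerBl -scaleNr.
    by congr (_ *: _ + _ *: _); rewrite /u rmorphB rmorph1; ring.
  rewrite nrmZ cmodN cmodM cmodC ger0_norm ?subr_ge0//.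
  rewrite -!mulrA ler_wpM2l ?subr_ge0//.
  apply: ler_pM; rewrite ?cmod_ge0 ?nrm_ge0//.
  apply: (le_trans (nrmD _ _ _)); rewrite mulrDl mul1r lerD2l.
  by apply: (@dyadic_res_le 0); rewrite ?r0_ge0 ?lexx ?expr1.
have sr := cmod_sqrtC mur r0_ge0.
have -> : (t ^+ (2 ^ j.+1))%:C * mu = (((t ^+ (2 ^ j))%:C) ^+ 2) * mu.
  by rewrite -rmorphXn -exprM -expnSr.
have tj0 : 0 <= (t ^+ (2 ^ j))%:C by rewrite ler0c exprn_ge0.
(* A nonnegative factor leaves the principal root as its own root, so the two averages run over
   aligned roots and are compared term by term. *)
rewrite /= rootCMl ?exprn_ge0// sqrCK//.
rewrite -scalerBr opprD addrACA; apply: half_sum_le; first exact: IH.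
by rewrite -mulrN; apply: IH; rewrite cmodN.
Qed.

(* If the spectrum misses the disc of radius r0 then the spectral radius estimate
   [pow_small rho] propagates inwards, from [rho] to [u * rho], at a rate [u < 1]
   independent of [rho]; in particular T^(2^j) decays faster than the resolvent
   bound [1 / c] at 0 permits. *)
Definition pow_small (rho : R) := exists J, forall j, (J <= j)%N ->
  forall x, N (j.-pow x) <= 8^-1 * rho ^+ (2 ^ j) * N x.

(** When [T^(2^j)] is small against [mu], the average [F] is close to [- x]: indeed
    [mu (F + x) = T^(2^j) F]. The factor obtained is [1 / 7], rounded up to [1 / 4]. *)
Lemma pow_small_res rho j x : 0 < rho <= r0 ->
  (forall x, N (j.-pow x) <= 8^-1 * rho ^+ (2 ^ j) * N x) ->
  N (dyadic_res j (rho ^+ (2 ^ j))%:C x + x) <= 4^-1 * N x.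
Proof.
move=> /andP[rho0 rr0] /(_ (dyadic_res j (rho ^+ (2 ^ j))%:C x)).
have m0 : 0 < rho ^+ (2 ^ j) by rewrite exprn_gt0.
have mur : cmod (rho ^+ (2 ^ j))%:C <= r0 ^+ (2 ^ j).
  by rewrite cmodC gtr0_norm// ler_pXn2r ?expn_gt0// ?nnegrE// ltW.
have /(canRL (subrK _)) := dyadic_resK x mur => ->.
set F := dyadic_res _ _ _; rewrite -scalerDr nrmZ cmodC gtr0_norm//.
rewrite [8^-1 * _]mulrC -mulrA ler_pM2l// addrC.
have := nrm_leB I (F + x) x; rewrite addrK.
have := nrmB I (F + x) x; rewrite addrK.
have := nrm_ge0 I x; lra.
Qed.

(** At the parameter [nu], of root modulus [u ^+ 2 * rho], the average is still within [1/4 + 1/4]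
    of [-1], which bounds [T^(2^j)] by [3 |nu|]. Only one factor [u] is claimed; the spare
    [u ^+ (2 ^ j) < 1 / 24] turns the constant 3 into [1 / 8]. *)
Lemma pow_small_step rho u : 0 < rho <= r0 -> 0 < u < 1 ->
  (1 - u ^+ 2) * r0 * (1 + r0 / c) / c <= 4^-1 ->
  pow_small rho -> pow_small (u * rho).
Proof.
move=> rhor /andP[u0 u1] ue [J HJ].
have u01 : 0 <= u < 1 by rewrite u1 ltW.
have e24 : 0 < 24^-1 :> R by rewrite invr_gt0.
have [J' HJ'] := geometric_small u01 e24.
exists (maxn J J') => j; rewrite geq_max => /andP[/HJ{HJ} HJ jJ'] y.
have {HJ' jJ'} uj : u ^+ (2 ^ j) < 24^-1.
  by apply: HJ'; apply: leq_trans jJ' _; exact/ltnW/ltn_expl.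
have /andP[rho0 rr0] := rhor.
set mu := (rho ^+ (2 ^ j))%:C.
have mur : cmod mu <= r0 ^+ (2 ^ j).
  by rewrite cmodC gtr0_norm ?exprn_gt0// ler_pXn2r ?expn_gt0// ?nnegrE// ltW.
have u2 : 0 <= u ^+ 2 <= 1 by rewrite exprn_ge0 ?exprn_ile1// ltW.
set nu := ((u ^+ 2) ^+ (2 ^ j))%:C * mu.
have nuE : cmod nu = (u ^+ 2 * rho) ^+ (2 ^ j).
  rewrite /nu /mu -rmorphM cmodC -exprMn ger0_norm// exprn_ge0// mulr_ge0 ?exprn_ge0 ?ltW//.
have nur : cmod nu <= r0 ^+ (2 ^ j).
  have /andP[a b] := u2; rewrite nuE ler_pXn2r ?expn_gt0 ?nnegrE//.
    by apply: le_trans rr0; rewrite ler_piMl// ltW.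
  by rewrite mulr_ge0// ltW.
set z := j.-pow y - nu *: y.
have h1 := dyadic_res_scale z u2 mur.
have h2 := pow_small_res z rhor HJ.
have h3 : N (nu *: y) >= 2^-1 * N z.
  rewrite -(Kdyadic_res y nur) -/z.
  have : N z <= N (dyadic_res j nu z - dyadic_res j mu z) +
      N (dyadic_res j mu z + z) + N (dyadic_res j nu z).
    have {1}-> : z = (dyadic_res j mu z + z) +
      (dyadic_res j nu z - dyadic_res j mu z) - dyadic_res j nu z.
      by rewrite [_ + z]addrC -(addrA z) [X in z + X]addrC subrK addrK.
    by apply: (le_trans (nrmB _ _ _)); rewrite lerD2r addrC nrmD.
  have := ler_wpM2r (nrm_ge0 I z) ue; rewrite -/nu in h1; lra.
have : N (j.-pow y) <= 3 * N (nu *: y).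
  by have := nrm_leB I (j.-pow y) (nu *: y); rewrite -/z; lra.
move=> h4; apply: (le_trans h4); rewrite nrmZ nuE expr2 -mulrA exprMn !mulrA.
rewrite ler_wpM2r ?nrm_ge0// ler_wpM2r ?exprn_ge0 ?mulr_ge0 ?ltW// ; lra.
Qed.

(** After enough steps [rho / c <= 1 / 4], so both [F] and [F + x] have norm at most a quarter of
    that of [x]. *)
Lemma pow_small_absurd u x : 0 < u < 1 ->
  (1 - u ^+ 2) * r0 * (1 + r0 / c) / c <= 4^-1 ->
  0 < r0 -> pow_small r0 -> x = 0.
Proof.
move=> u01 ue r0_gt0 P0; have /andP[u0 u1] := u01.
have P i : pow_small (u ^+ i * r0).
  elim: i => [|i IH]; first by rewrite mul1r.
  rewrite exprS -mulrA; apply: pow_small_step => //.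
  by rewrite mulr_gt0 ?exprn_gt0//= ger_pMl// exprn_ile1 ?ltW.
have u01' : 0 <= u < 1 by rewrite u1 ltW.
have e0 : 0 < c / (4 * r0) by rewrite divr_gt0// mulr_gt0.
have [i /(_ i (leqnn i)) ui] := geometric_small u01' e0.
set rho := u ^+ i * r0.
have rho0 : 0 < rho by rewrite mulr_gt0 ?exprn_gt0.
have rr0 : rho <= r0 by rewrite ger_pMl// exprn_ile1 ?ltW.
have [J /(_ J (leqnn J)) HJ] := P i.
have h1 := pow_small_res x _ HJ.
have h2 := @dyadic_res_le J (rho ^+ (2 ^ J))%:C x rho.
apply: (@nrm_eq0 _ _ I); apply/eqP; rewrite eq_le nrm_ge0 andbT.
have {}h1 := h1 _; have {h1} := h1 (introT andP (conj rho0 rr0)).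
have {h2} := h2 _ _; rewrite ltW// rr0 cmodC gtr0_norm ?exprn_gt0// => /(_ isT (lexx _)).
have rc : rho / c <= 4^-1.
  rewrite ler_pdivrMr//; move: ui; rewrite ltr_pdivlMr ?mulr_gt0// mulrCA -/rho.
  by rewrite -ltr_pdivlMl// => /ltW.
move=> /le_trans/(_ (ler_wpM2r (nrm_ge0 I x) rc)).
set F := dyadic_res _ _ _.
have := nrmB I (F + x) F; rewrite addrC addKr.
have := nrm_ge0 I x; lra.
Qed.

End Nonempty.

Lemma spectrum_nonempty (R : realType) (V : lmodType R[i]) (I : inner V)
    (T : {linear V -> V}) (M : R) (x0 : V) :
  (forall x, nrm I (T x) <= M * nrm I x) ->
  (forall l, exists2 c, 0 < c & bounded_below I (op_sub T l) c) ->
  (forall l y, exists x, op_sub T l x = y) -> x0 = 0.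
Proof.
move=> TM Tc Tsurj.
have [f fE] := choice (fun p : R[i] * V => Tsurj p.1 p.2).
pose Res l x := f (l, x).
have TRes l x : op_sub T l (Res l x) = x by exact: (fE (l, x)).
have ResT l x : Res l (op_sub T l x) = x.
  have [c c0 cb] := Tc l; apply/eqP; rewrite -subr_eq0; apply/eqP/(@nrm_eq0 _ _ I).
  apply/eqP; rewrite eq_le nrm_ge0 andbT -(ler_pM2l c0) mulr0.
  by apply: (le_trans (cb _)); rewrite linearB TRes subrr nrm0.
wlog M1 : M TM / 1 <= M.
  move=> h; apply: (h (Num.max M 1)).
    by move=> x; apply: le_trans (TM x) _; rewrite ler_wpM2r ?nrm_ge0// le_max lexx.
  by rewrite le_max lexx orbT.
have M0 : 0 < M by exact: lt_le_trans M1.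
(* At twice the norm bound, [T^(2^j)] is at most [2^-(2^j)] times [r0 ^+ (2 ^ j)], which starts the
   propagation. *)
pose r0 := M * 2.
have r00 : 0 < r0 by rewrite mulr_gt0.
have [c c0 cb] : exists2 c, 0 < c &
    forall l, cmod l <= r0 -> bounded_below I (op_sub T l) c.
  apply: disc_uniform => l; have [c c0 cb] := Tc l.
  exists (c / 2); first by rewrite divr_gt0.
  move=> w d wl dc; apply: bounded_below_near cb _; lra.
pose K := r0 * (1 + r0 / c) / c.
have K0 : 0 < K by rewrite divr_gt0// mulr_gt0// addr_gt0// divr_gt0.
(* The second entry gives [(1 - u) K <= 1 / 8], hence [(1 - u ^+ 2) K <= 1 / 4]; the first keeps [u]
   positive. *)
pose u := Num.max (2^-1) (1 - (8 * K)^-1).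
have uh : 2^-1 <= u by rewrite le_max lexx.
have uK : 1 - u <= (8 * K)^-1.
  by have : 1 - (8 * K)^-1 <= u; [rewrite le_max lexx orbT|lra].
have u1 : u < 1.
  by rewrite gt_max ltrBlDr ltrDl invr_gt0 mulr_gt0// andbT; lra.
have u0 : 0 < u by lra.
apply: (@pow_small_absurd R V I T Res r0 c _ _ _ _ _ u) => //.
- exact: ltW.
- by rewrite u0.
- have e : (1 - u ^+ 2) * r0 * (1 + r0 / c) / c = (1 - u) * (1 + u) * K.
    by rewrite /K; ring.
  rewrite e.
  have KE : (8 * K)^-1 * K = 8^-1.
    by rewrite invfM mulfVK ?gt_eqF.
  have : (1 - u) * K <= 8^-1 by rewrite -KE ler_pM2r.
  have : 0 <= (1 - u) * K by rewrite mulr_ge0 ?subr_ge0// ltW.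
  rewrite mulrAC; move: ((1 - u) * K) => X X0 X8; nra.
- have h : 0 <= (2^-1 : R) < 1.
    by rewrite invr_ge0 ler0n/= invf_lt1 ?ltr0n ?ltr1n.
  have e8 : 0 < 8^-1 :> R by rewrite invr_gt0.
  have [J HJ] := geometric_small h e8; exists J => j Jj x.
  apply: (le_trans (iter_bounded M0 TM _ _)); rewrite ler_wpM2r ?nrm_ge0//.
  have -> : M = 2^-1 * r0 by rewrite /r0 mulrC mulfK.
  rewrite exprMn ler_pM2r ?exprn_gt0//; apply/ltW/HJ.
  by apply: leq_trans Jj _; exact/ltnW/ltn_expl.
Qed.

(** * Euclidean column vectors, operator norms and smallest singular values *)

Lemma ReD (R : realType) (a b : R[i]) :
  complex.Re (a + b) = complex.Re a + complex.Re b.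
Proof. by case: a b => ? ? [? ?]. Qed.

Lemma ReN (R : realType) (a : R[i]) : complex.Re (- a) = - complex.Re a.
Proof. by case: a. Qed.

Lemma Re_sum (R : realType) (J : Type) (r : seq J) (P : pred J) (F : J -> R[i]) :
  complex.Re (\sum_(j <- r | P j) F j) = \sum_(j <- r | P j) complex.Re (F j).
Proof. by apply: (big_morph (@complex.Re R)) => //; exact: ReD. Qed.

Lemma Re_mulC (R : realType) (t : R) (a : R[i]) :
  complex.Re (t%:C * a) = t * complex.Re a.
Proof. by case: a => a b /=; rewrite mul0r subr0. Qed.

Lemma Re_conj (R : realType) (a : R[i]) : complex.Re (conjc a) = complex.Re a.
Proof. by case: a. Qed.

Lemma Re_mulJ (R : realType) (a : R[i]) : complex.Re (a * conjc a) = cmod a ^+ 2.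
Proof. by rewrite mulrC -cmod_sqr. Qed.

Lemma cmodJ (R : realType) (a : R[i]) : cmod (conjc a) = cmod a.
Proof. by case: a => a b /=; rewrite sqrrN. Qed.

Section ColumnVectors.
Variable R : realType.

Definition cv_ip m (x y : 'cV[R[i]]_m) : R :=
  \sum_j complex.Re (x j 0 * conjc (y j 0)).

Lemma cv_ip_sqr m (x : 'cV[R[i]]_m) : cv_ip x x = \sum_j cmod (x j 0) ^+ 2.
Proof. by apply: eq_bigr => j _; rewrite Re_mulJ. Qed.

Lemma cv_ipC m (x y : 'cV[R[i]]_m) : cv_ip x y = cv_ip y x.
Proof.
by apply: eq_bigr => j _; rewrite -Re_conj rmorphM /= conjcK mulrC.
Qed.

Lemma cv_ipDl m (x y z : 'cV[R[i]]_m) : cv_ip (x + y) z = cv_ip x z + cv_ip y z.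
Proof. by rewrite -big_split; apply: eq_bigr => j _; rewrite mxE mulrDl ReD. Qed.

Lemma cv_ipZl m (a : R[i]) (x y : 'cV[R[i]]_m) :
  cv_ip (a *: x) y = cv_ip x (conjc a *: y).
Proof.
apply: eq_bigr => j _; rewrite !mxE rmorphM /= conjcK.
by rewrite [a * _]mulrC -mulrA.
Qed.

Lemma cv_ipRl m (t : R) (x y : 'cV[R[i]]_m) :
  cv_ip (t%:C *: x) y = t * cv_ip x y.
Proof. by rewrite mulr_sumr; apply: eq_bigr => j _; rewrite !mxE -mulrA Re_mulC. Qed.

Lemma cv_ip_ge0 m (x : 'cV[R[i]]_m) : 0 <= cv_ip x x.
Proof. by rewrite cv_ip_sqr sumr_ge0// => j _; rewrite sqr_ge0. Qed.

Lemma cv_ip_eq0 m (x : 'cV[R[i]]_m) : cv_ip x x = 0 -> x = 0.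
Proof.
rewrite cv_ip_sqr => /eqP; rewrite psumr_eq0; last by move=> j _; rewrite sqr_ge0.
move=> /allP h; apply/colP => j; rewrite mxE.
have := h j; rewrite mem_index_enum => /(_ isT).
by rewrite sqrf_eq0 => /eqP /ComplexField.Normc.eq0_normc.
Qed.

Definition cv_inner m : inner ('cV[R[i]]_m) := Inner (@cv_ipC m) (@cv_ipDl m)
  (@cv_ipZl m) (@cv_ipRl m) (@cv_ip_ge0 m) (@cv_ip_eq0 m).

Lemma vnormE m (x : 'cV[R[i]]_m) : vnorm x = nrm (cv_inner m) x.
Proof. by rewrite /vnorm /nrm /= cv_ip_sqr. Qed.

Definition conjmx m n (A : 'M[R[i]]_(m, n)) := map_mx conjc A.

Lemma conjmxK m n (A : 'M[R[i]]_(m, n)) : conjmx (conjmx A) = A.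
Proof. by apply/matrixP => j k; rewrite !mxE conjcK. Qed.

Lemma conjmxM m n q (A : 'M[R[i]]_(m, n)) (B : 'M[R[i]]_(n, q)) :
  conjmx (A *m B) = conjmx A *m conjmx B.
Proof. by rewrite /conjmx map_mxM. Qed.

Lemma vnorm_conj m (x : 'cV[R[i]]_m) : vnorm (conjmx x) = vnorm x.
Proof. by congr Num.sqrt; apply: eq_bigr => j _; rewrite mxE cmodJ. Qed.

Lemma cv_ip_mul m n (A : 'M[R[i]]_(m, n)) x y :
  cv_ip (A *m x) y = cv_ip x (conjmx A^T *m y).
Proof.
rewrite /cv_ip (eq_bigr (fun j => \sum_k complex.Re (A j k * x k 0 * conjc (y j 0)))).
  rewrite exchange_big; apply: eq_bigr => k _; rewrite mxE rmorph_sum mulr_sumr Re_sum.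
  apply: eq_bigr => j _; congr complex.Re; rewrite !mxE rmorphM /= conjcK.
  by rewrite mulrAC mulrC mulrA.
by move=> j _; rewrite mxE mulr_suml Re_sum.
Qed.

Lemma vnorm_ge0 m (x : 'cV[R[i]]_m) : 0 <= vnorm x.
Proof. exact: sqrtr_ge0. Qed.

Lemma vnormZ m a (x : 'cV[R[i]]_m) : vnorm (a *: x) = cmod a * vnorm x.
Proof. by rewrite !vnormE nrmZ. Qed.

Lemma vnormD m (x y : 'cV[R[i]]_m) : vnorm (x + y) <= vnorm x + vnorm y.
Proof. by rewrite !vnormE nrmD. Qed.

Lemma vnorm0 m : vnorm (0 : 'cV[R[i]]_m) = 0.
Proof. by rewrite vnormE nrm0. Qed.

Lemma vnorm_eq0 m (x : 'cV[R[i]]_m) : vnorm x = 0 -> x = 0.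
Proof. by rewrite vnormE => /nrm_eq0. Qed.

Lemma vnorm_sqr m (x : 'cV[R[i]]_m) : vnorm x ^+ 2 = \sum_j cmod (x j 0) ^+ 2.
Proof. by rewrite vnormE nrm_sqr /= cv_ip_sqr. Qed.

Lemma cmod_le_vnorm m (x : 'cV[R[i]]_m) j : cmod (x j 0) <= vnorm x.
Proof.
rewrite -(ler_pXn2r (n:=2))// ?nnegrE ?cmod_ge0 ?vnorm_ge0//.
by rewrite vnorm_sqr (bigD1 j)//= lerDl sumr_ge0// => k _; rewrite sqr_ge0.
Qed.

Lemma vnorm_sum m (J : Type) (r : seq J) (P : pred J) (F : J -> 'cV[R[i]]_m) :
  vnorm (\sum_(j <- r | P j) F j) <= \sum_(j <- r | P j) vnorm (F j).
Proof.
elim/big_rec2: _ => [|j s t _ h]; first by rewrite vnorm0.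
by apply: (le_trans (vnormD _ _)); rewrite lerD2l.
Qed.

Lemma vnorm_mul_bound m n (A : 'M[R[i]]_(m, n)) :
  exists2 K, 0 <= K & forall x, vnorm (A *m x) <= K * vnorm x.
Proof.
exists (\sum_j vnorm (col j A)); first by rewrite sumr_ge0// => j _; exact: vnorm_ge0.
move=> x; have -> : A *m x = \sum_j x j 0 *: col j A.
  apply/colP => k; rewrite mxE summxE; apply: eq_bigr => j _.
  by rewrite !mxE mulrC.
apply: (le_trans (vnorm_sum _ _ _)); rewrite mulr_suml ler_sum// => j _.
by rewrite vnormZ mulrC ler_wpM2l ?vnorm_ge0// cmod_le_vnorm.
Qed.

Lemma vnorm_normalize m (x : 'cV[R[i]]_m) : vnorm x != 0 ->
  vnorm ((vnorm x)^-1%:C *: x) = 1.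
Proof.
move=> x0; rewrite vnormZ cmodC ger0_norm ?invr_ge0 ?vnorm_ge0//.
by rewrite mulVf.
Qed.

Lemma vnorm_homogeneous_le m n (A : 'M[R[i]]_(m, n)) (c : R) :
  (forall x, vnorm x = 1 -> c <= vnorm (A *m x)) ->
  forall x, c * vnorm x <= vnorm (A *m x).
Proof.
move=> h x; have [x0|x0] := eqVneq (vnorm x) 0.
  by rewrite x0 mulr0 vnorm_ge0.
have := h _ (vnorm_normalize x0); rewrite -scalemxAr vnormZ cmodC.
rewrite ger0_norm ?invr_ge0 ?vnorm_ge0// ler_pdivlMl 1?mulrC//.
by rewrite lt_def x0 vnorm_ge0.
Qed.

Lemma opnorm_le m n (A : 'M[R[i]]_(m, n)) (c : R) : 0 <= c ->
  (forall x, vnorm (A *m x) <= c * vnorm x) -> opnorm A <= c.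
Proof.
move=> c0 h; apply: ge_sup.
  by exists (vnorm (A *m 0)), 0 => //=; rewrite vnorm0 ler01.
by move=> _ [x /= x1 <-]; apply: (le_trans (h x)); rewrite ler_piMr.
Qed.

Lemma vnorm_le_opnorm m n (A : 'M[R[i]]_(m, n)) x :
  vnorm x <= 1 -> vnorm (A *m x) <= opnorm A.
Proof.
move=> x1; apply: ub_le_sup; last by exists x.
have [K K0 KA] := vnorm_mul_bound A; exists K => _ [y /= y1 <-].
by apply: (le_trans (KA y)); rewrite ler_piMr.
Qed.

Lemma opnorm_ge0 m n (A : 'M[R[i]]_(m, n)) : 0 <= opnorm A.
Proof.
by apply: le_trans (vnorm_ge0 (A *m 0)) (vnorm_le_opnorm _ _); rewrite vnorm0 ler01.
Qed.

Lemma vnorm_mul_le m n (A : 'M[R[i]]_(m, n)) x :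
  vnorm (A *m x) <= opnorm A * vnorm x.
Proof.
have [x0|x0] := eqVneq (vnorm x) 0.
  by rewrite (vnorm_eq0 x0) mulmx0 !vnorm0 mulr0.
rewrite -ler_pdivrMr; last by rewrite lt_def x0 vnorm_ge0.
have : vnorm ((vnorm x)^-1%:C *: x) <= 1 by rewrite vnorm_normalize.
move=> /(vnorm_le_opnorm A); apply: le_trans.
by rewrite -scalemxAr vnormZ cmodC ger0_norm ?invr_ge0 ?vnorm_ge0// mulrC.
Qed.

(** Conjugating matrix and vector preserves norms and replaces the transpose by the Hermitian
    adjoint, for which the square of [vnorm z] is the product of [A *m z] with [y]. *)
Lemma vnorm_tr_mul_le m n (A : 'M[R[i]]_(m, n)) (c : R) : 0 <= c ->
  (forall x, vnorm (A *m x) <= c * vnorm x) ->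
  forall x, vnorm (A^T *m x) <= c * vnorm x.
Proof.
move=> c0 h x; rewrite -vnorm_conj conjmxM -(vnorm_conj x).
set y := conjmx x; set z := conjmx A^T *m y.
have [z0|z0] := eqVneq (vnorm z) 0; first by rewrite z0 mulr_ge0 ?vnorm_ge0.
rewrite -(ler_pM2l (_ : 0 < vnorm z)); last by rewrite lt_def z0 vnorm_ge0.
rewrite -expr2 vnormE nrm_sqr /= {2}/z -cv_ip_mul.
apply: (le_trans (cauchy_schwarz (cv_inner m) _ _)); rewrite -!vnormE mulrA.
by rewrite [_ * c]mulrC ler_wpM2r ?vnorm_ge0// h.
Qed.

(** The hypothesis [0 < n] provides a unit vector; on an empty unit sphere [inf] would have its
    default value. *)
Lemma nu_ge m n (A : 'M[R[i]]_(m, n)) (c : R) : (0 < n)%N ->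
  (forall x, vnorm x = 1 -> c <= vnorm (A *m x)) -> c <= nu A.
Proof.
move=> n0 h; apply: lb_le_inf; last by move=> _ [x /= x1 <-]; exact: h.
pose e : 'cV[R[i]]_n := \col_j (j == Ordinal n0)%:R.
suff e0 : vnorm e != 0.
  by exists (vnorm (A *m ((vnorm e)^-1%:C *: e))), ((vnorm e)^-1%:C *: e) => //=;
    exact: vnorm_normalize.
apply/eqP => /vnorm_eq0 /colP /(_ (Ordinal n0)); rewrite !mxE eqxx => /eqP.
by rewrite oner_eq0.
Qed.

Lemma nu_le m n (A : 'M[R[i]]_(m, n)) x : vnorm x = 1 -> nu A <= vnorm (A *m x).
Proof.
move=> x1; apply: ge_inf; last by exists x.
by exists 0 => _ [y _ <-]; exact: vnorm_ge0.
Qed.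

Lemma nu_mul_le m n (A : 'M[R[i]]_(m, n)) x : nu A * vnorm x <= vnorm (A *m x).
Proof. by move: x; apply: vnorm_homogeneous_le => x; exact: nu_le. Qed.

Lemma nu_near m n (A B : 'M[R[i]]_(m, n)) (d : R) : (0 < n)%N ->
  (forall x, vnorm x = 1 -> vnorm ((A - B) *m x) <= d) -> nu A <= nu B + d.
Proof.
move=> n0 h; rewrite -lerBlDr; apply: nu_ge => // x x1; rewrite lerBlDr.
apply: (le_trans (nu_le A x1)).
by rewrite -(subrK B A) mulmxDl addrC (le_trans (vnormD _ _))// lerD2l h.
Qed.

Lemma vnorm_mxcol n (p_ : 'I_n -> nat) (B : forall j, 'cV[R[i]]_(p_ j)) :
  vnorm (\mxcol_j B j) ^+ 2 = \sum_j vnorm (B j) ^+ 2.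
Proof.
rewrite vnorm_sqr (eq_bigr (fun j => \sum_k cmod (B j k 0) ^+ 2)); last first.
  by move=> j _; rewrite vnorm_sqr.
rewrite (sig_big_dep xpredT (fun _ => xpredT) (fun j k => cmod (B j k 0) ^+ 2)) /=.
rewrite (reindex _ (onW_bij _ tagnat.sig_bij)) /=.
by apply: eq_bigr => s _; rewrite mxE.
Qed.

End ColumnVectors.

(** * The space of square-summable sequences *)

Section RealSums.
Variables (R : realType) (T : choiceType).
Implicit Types (a b f g : T -> R) (s : seq T).

Definition esumR a : \bar R := \esum_(j in [set: T]) (a j)%:E.

Definition summableR a := (esumR a < +oo)%E.

Definition psum a : R := fine (esumR a).

Lemma esumR_ge0 a : (forall j, 0 <= a j) -> (0 <= esumR a)%E.
Proof. by move=> a0; apply: esum_ge0 => j _; rewrite lee_fin. Qed.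

Lemma psumE a : (forall j, 0 <= a j) -> summableR a -> esumR a = (psum a)%:E.
Proof. by move=> a0 fa; rewrite fineK// ge0_fin_numE// esumR_ge0. Qed.

Lemma psum_ge0 a : (forall j, 0 <= a j) -> 0 <= psum a.
Proof. by move=> a0; apply/fine_ge0/esumR_ge0. Qed.

Lemma esumR_bound a (C : R) : (forall j, 0 <= a j) ->
  (forall s, uniq s -> \sum_(j <- s) a j <= C) -> (esumR a <= C%:E)%E.
Proof.
move=> a0 h; apply: ge_ereal_sup => _ [A [finA _] <-].
by rewrite fsbig_finite//= sumEFin lee_fin; apply: h.
Qed.

Lemma summableR_bound a (C : R) : (forall j, 0 <= a j) ->
  (forall s, uniq s -> \sum_(j <- s) a j <= C) -> summableR a.
Proof. by move=> a0 h; apply: le_lt_trans (esumR_bound a0 h) _; rewrite ltry. Qed.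

Lemma psum_bound a (C : R) : (forall j, 0 <= a j) ->
  (forall s, uniq s -> \sum_(j <- s) a j <= C) -> psum a <= C.
Proof.
move=> a0 h; rewrite -lee_fin -psumE ?esumR_bound//.
exact: summableR_bound h.
Qed.

Lemma psum_ge a s : (forall j, 0 <= a j) -> summableR a -> uniq s ->
  \sum_(j <- s) a j <= psum a.
Proof.
move=> a0 fa us; rewrite -lee_fin -psumE// -sumEFin.
apply: esum_ge; exists [set` s] => //.
by rewrite fsbig_seq.
Qed.

Lemma psum_ge1 a j : (forall j, 0 <= a j) -> summableR a -> a j <= psum a.
Proof. by move=> a0 fa; have := @psum_ge a [:: j] a0 fa isT; rewrite big_seq1. Qed.

Lemma le_summableR a b : (forall j, a j <= b j) -> summableR b -> summableR a.
Proof.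
by move=> ab; apply: le_lt_trans; apply: le_esum => j _; rewrite lee_fin.
Qed.

Lemma le_psum a b : (forall j, 0 <= a j) -> (forall j, a j <= b j) ->
  summableR b -> psum a <= psum b.
Proof.
move=> a0 ab fb; have b0 j : 0 <= b j by exact: le_trans (ab j).
rewrite -lee_fin -!psumE//; last exact: le_summableR fb.
by apply: le_esum => j _; rewrite lee_fin.
Qed.

Lemma esumRD a b : (forall j, 0 <= a j) -> (forall j, 0 <= b j) ->
  esumR (fun j => a j + b j) = (esumR a + esumR b)%E.
Proof. by move=> a0 b0; rewrite /esumR -esumD// => j _; rewrite lee_fin. Qed.

Lemma summableRD a b : (forall j, 0 <= a j) -> (forall j, 0 <= b j) ->
  summableR a -> summableR b -> summableR (fun j => a j + b j).
Proof. by move=> a0 b0 fa fb; rewrite /summableR esumRD// lte_add_pinfty. Qed.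

Lemma psumD a b : (forall j, 0 <= a j) -> (forall j, 0 <= b j) ->
  summableR a -> summableR b -> psum (fun j => a j + b j) = psum a + psum b.
Proof. by move=> a0 b0 fa fb; rewrite /psum esumRD// psumE// psumE. Qed.

Lemma esumRZ_le a (t : R) : (forall j, 0 <= a j) -> 0 <= t -> summableR a ->
  (esumR (fun j => (t * a j)%R) <= (t * psum a)%:E)%E.
Proof.
move=> a0 t0 fa; apply: esumR_bound => [j|s us]; first by rewrite mulr_ge0.
by rewrite -mulr_sumr ler_wpM2l// psum_ge.
Qed.

Lemma summableRZ a (t : R) : (forall j, 0 <= a j) -> 0 <= t -> summableR a ->
  summableR (fun j => t * a j).
Proof. by move=> a0 t0 fa; apply: le_lt_trans (esumRZ_le a0 t0 fa) _; rewrite ltry. Qed.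

Lemma psumZ a (t : R) : (forall j, 0 <= a j) -> 0 <= t -> summableR a ->
  psum (fun j => t * a j) = t * psum a.
Proof.
move=> a0 t0 fa; have [->|tn0] := eqVneq t 0.
  rewrite mul0r /psum /esumR esum1// => j _; by rewrite mul0r.
have tp : 0 < t by rewrite lt_def tn0.
have ta0 j : 0 <= t * a j by rewrite mulr_ge0.
have fta : summableR (fun j => t * a j) by exact: summableRZ.
apply/eqP; rewrite eq_le; apply/andP; split.
  by rewrite -lee_fin -psumE// esumRZ_le.
rewrite -ler_pdivlMl//; have tV : 0 <= t^-1 by rewrite invr_ge0 ltW.
have := esumRZ_le ta0 tV fta; rewrite (_ : (fun j => t^-1 * _) = a).
  by rewrite psumE.
by apply/funext => j; rewrite mulKf.
Qed.

Lemma eq_psum0 a : (forall j, 0 <= a j) -> summableR a -> psum a = 0 ->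
  forall j, a j = 0.
Proof.
move=> a0 fa h j; apply/eqP; rewrite eq_le a0 andbT -h.
exact: psum_ge1.
Qed.

(* Signed sums of absolutely summable families; [|f| + f] and [|f|] are
   nonnegative with difference [f]. *)
Definition isum f : R := psum (fun j => `|f j| + f j) - psum (fun j => `|f j|).

Definition abs_summable f := summableR (fun j => `|f j|).

(** Adding [b] to [|f| + f] gives the same family as adding [a] to [|f|], so any decomposition
    computes the sum. Linearity of [isum] then reduces to a choice of decompositions. *)
Lemma isumE a b f : (forall j, 0 <= a j) -> (forall j, 0 <= b j) ->
  summableR a -> summableR b -> (forall j, f j = a j - b j) ->
  isum f = psum a - psum b.
Proof.
move=> a0 b0 fa fb fE.
have ff : summableR (fun j => `|f j|).
  apply: le_summableR (summableRD a0 b0 fa fb) => j.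
  by rewrite fE (le_trans (ler_normB _ _))// !ger0_norm.
have p0 j : 0 <= `|f j| + f j by have := ler_norm (- f j); rewrite normrN; lra.
have fp : summableR (fun j => `|f j| + f j).
  have n0 j : 0 <= `|f j| by [].
  apply: le_summableR (summableRD n0 n0 ff ff) => j.
  by rewrite lerD2l ler_norm.
apply/eqP; rewrite subr_eq addrAC eq_sym subr_eq; apply/eqP.
have n0 j : 0 <= `|f j| by [].
rewrite -(psumD a0 n0 fa ff) -(psumD p0 b0 fp fb).
by congr psum; apply/funext => j; rewrite fE; ring.
Qed.

Lemma abs_summable_pos f : abs_summable f ->
  summableR (fun j => `|f j| + f j) /\ forall j, 0 <= `|f j| + f j.
Proof.
move=> ff; split; last by move=> j; have := ler_norm (- f j); rewrite normrN; lra.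
have n0 j : 0 <= `|f j| by [].
by apply: le_summableR (summableRD n0 n0 ff ff) => j; rewrite lerD2l ler_norm.
Qed.

Lemma isum_ge0 a : (forall j, 0 <= a j) -> summableR a -> isum a = psum a.
Proof.
move=> a0 fa; have z0 : psum (fun=> 0) = 0.
  by rewrite /psum /esumR esum1.
rewrite (@isumE a (fun=> 0))// ?z0 ?subr0//; last by move=> j; rewrite subr0.
by rewrite /summableR /esumR esum1// ltry.
Qed.

Lemma isumD f g : abs_summable f -> abs_summable g ->
  isum (fun j => f j + g j) = isum f + isum g.
Proof.
move=> ff fg; have [pf pf0] := abs_summable_pos ff.
have [pg pg0] := abs_summable_pos fg.
have nf j : 0 <= `|f j| by []. have ng j : 0 <= `|g j| by [].
rewrite (@isumE (fun j => (`|f j| + f j) + (`|g j| + g j))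
                (fun j => `|f j| + `|g j|)).
- by rewrite (psumD pf0 pg0 pf pg) (psumD nf ng ff fg) opprD addrACA.
- by move=> j; rewrite addr_ge0.
- by move=> j; rewrite addr_ge0.
- exact: summableRD.
- exact: summableRD.
- by move=> j; ring.
Qed.

Lemma isumN f : abs_summable f -> isum (fun j => - f j) = - isum f.
Proof.
move=> ff; have [pf pf0] := abs_summable_pos ff.
rewrite /isum opprB; apply: isumE => // j.
by ring.
Qed.

Lemma isumZ f (t : R) : abs_summable f -> isum (fun j => t * f j) = t * isum f.
Proof.
wlog t0 : t / 0 <= t.
  move=> h ff; have [/h ->//|t0] := leP 0 t.
  have tN : 0 <= - t by rewrite oppr_ge0 ltW.
  rewrite -[t]opprK mulNr -h// -isumN.
    by congr isum; apply/funext => j; rewrite mulNr.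
  by have := summableRZ (fun j => normr_ge0 (f j)) tN ff;
    congr summableR; apply/funext => j; rewrite normrM (ger0_norm tN).
move=> ff; have [pf pf0] := abs_summable_pos ff.
rewrite /isum mulrBr -!psumZ//; apply: isumE => //.
- by move=> j; rewrite mulr_ge0.
- by move=> j; rewrite mulr_ge0.
- exact: summableRZ.
- exact: summableRZ.
- by move=> j; ring.
Qed.

End RealSums.

Lemma esumR_shift (R : realType) (a : int -> R) (k : int) :
  esumR (fun j => a (j + k)) = esumR a.
Proof.
rewrite /esumR (@reindex_esum _ _ _ setT setT (fun j => j + k) (EFin \o a))//.
split => //; first by move=> x y _ _ /addIr.
by move=> y _; exists (y - k) => //; rewrite subrK.
Qed.

Lemma psum_shift (R : realType) (a : int -> R) (k : int) :
  psum (fun j => a (j + k)) = psum a.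
Proof. by rewrite /psum esumR_shift. Qed.

Lemma summableR_shift (R : realType) (a : int -> R) (k : int) :
  summableR (fun j => a (j + k)) = summableR a.
Proof. by rewrite /summableR esumR_shift. Qed.

Lemma isum_shift (R : realType) (a : int -> R) (k : int) :
  isum (fun j => a (j + k)) = isum a.
Proof.
by rewrite /isum (psum_shift (fun j => `|a j| + a j)) (psum_shift (fun j => `|a j|)).
Qed.

Section Ell2Space.
Variables (R : realType) (p : nat).
Implicit Types x y : int -> 'cV[R[i]]_p.

Definition sqv x : int -> R := fun j => vnorm (x j) ^+ 2.

Lemma sqv_ge0 x j : 0 <= sqv x j.
Proof. exact: sqr_ge0. Qed.

Lemma ell2E x : ell2 x = summableR (sqv x).
Proof. by []. Qed.

Definition ell2p : {pred int -> 'cV[R[i]]_p} := fun x => x \in @ell2 R p.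

Lemma ell2pP x : reflect (ell2 x) (x \in ell2p).
Proof. by rewrite /ell2p unfold_in; apply: (iffP idP); [exact: set_mem|exact: mem_set]. Qed.

Lemma ell2_submod_closed : submod_closed ell2p.
Proof.
split.
  apply/ell2pP; rewrite ell2E (_ : sqv 0 = fun=> 0).
    by rewrite /summableR /esumR esum1// ltry.
  by apply/funext => j; rewrite /sqv vnorm0 expr0n.
move=> a x y /ell2pP; rewrite ell2E => fx /ell2pP; rewrite ell2E => fy.
apply/ell2pP; rewrite ell2E.
have a0 : 0 <= 2 * cmod a ^+ 2 by rewrite mulr_ge0// sqr_ge0.
have p0 j : 0 <= 2 * cmod a ^+ 2 * sqv x j by rewrite mulr_ge0// sqv_ge0.
have q0 j : 0 <= 2 * sqv y j by rewrite mulr_ge0// sqv_ge0.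
have h := summableRD p0 q0 (summableRZ (sqv_ge0 x) a0 fx) (summableRZ (sqv_ge0 y) (ler0n _ 2) fy).
apply: le_summableR h => j; rewrite /sqv.
have := vnormD (a *: x j) (y j); rewrite vnormZ.
have := vnorm_ge0 (a *: x j + y j); have := cmod_ge0 a.
have := vnorm_ge0 (x j); have := vnorm_ge0 (y j).
change ((a *: x + y) j) with (a *: x j + y j).
move: (vnorm (x j)) (vnorm (y j)) (cmod a) (vnorm (_ + _)).
move=> u v w t v0 u0 w0 t0 twuv.
have : t ^+ 2 <= (w * u + v) ^+ 2.
  by rewrite ler_pXn2r ?nnegrE// addr_ge0 ?mulr_ge0.
have := sqr_ge0 (w * u - v).
rewrite !expr2; lra.
Qed.

HB.instance Definition _ := GRing.isSubmodClosed.Build _ _ ell2p ell2_submod_closed.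

(** As a subtype, [ell2] inherits a module structure and falls under the abstract results on
    [inner]. *)
Record ell2T := MkEll2 { eseq :> int -> 'cV[R[i]]_p ; _ : eseq \in ell2p }.

HB.instance Definition _ := [isSub for eseq].
HB.instance Definition _ := [Choice of ell2T by <:].
HB.instance Definition _ := [SubChoice_isSubLmodule of ell2T by <:].

Lemma ell2TP (x : ell2T) : summableR (sqv x).
Proof. by have /ell2pP := valP x. Qed.

Lemma ell2TD (x y : ell2T) j : (x + y) j = x j + y j.
Proof. by []. Qed.

Lemma ell2TZ a (x : ell2T) j : (a *: x) j = a *: x j.
Proof. by []. Qed.

Lemma ell2TB (x y : ell2T) j : (x - y) j = x j - y j.
Proof. by []. Qed.

Lemma ell2T_sum (n : nat) (u : nat -> ell2T) j :
  (\sum_(k < n) u k) j = \sum_(k < n) u k j.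
Proof.
elim: n => [|n IH]; first by rewrite !big_ord0.
by rewrite big_ord_recr [RHS]big_ord_recr ell2TD IH.
Qed.

Definition ell2_ip (x y : ell2T) : R := isum (fun j => cv_ip (x j) (y j)).

Lemma cv_ip_abs_le m (v w : 'cV[R[i]]_m) : `|cv_ip v w| <= vnorm v ^+ 2 + vnorm w ^+ 2.
Proof.
have h1 := cauchy_schwarz (cv_inner R m) v w.
have h2 := cauchy_schwarz (cv_inner R m) (- v) w.
rewrite nrmN ipNl -!vnormE /= in h1 h2.
have : 0 <= (vnorm v - vnorm w) ^+ 2 by rewrite sqr_ge0.
have := sqr_ge0 (vnorm v); have := sqr_ge0 (vnorm w).
rewrite ler_norml !expr2 => a b c; apply/andP; split; nra.
Qed.

Lemma ell2_ip_summable (x y : ell2T) : abs_summable (fun j => cv_ip (x j) (y j)).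
Proof.
apply: le_summableR (summableRD (sqv_ge0 x) (sqv_ge0 y) (ell2TP x) (ell2TP y)) => j.
exact: cv_ip_abs_le.
Qed.

Lemma ell2_ipxx (x : ell2T) : ell2_ip x x = psum (sqv x).
Proof.
rewrite -isum_ge0//; [|exact: sqv_ge0|exact: ell2TP].
by congr isum; apply/funext => j; rewrite /sqv vnormE nrm_sqr.
Qed.

Lemma ell2_ipC (x y : ell2T) : ell2_ip x y = ell2_ip y x.
Proof. by congr isum; apply/funext => j; rewrite cv_ipC. Qed.

Lemma ell2_ipDl (x y z : ell2T) : ell2_ip (x + y) z = ell2_ip x z + ell2_ip y z.
Proof.
rewrite -isumD; [|exact: ell2_ip_summable|exact: ell2_ip_summable].
by congr isum; apply/funext => j; rewrite ell2TD cv_ipDl.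
Qed.

Lemma ell2_ipZl (a : R[i]) (x y : ell2T) :
  ell2_ip (a *: x) y = ell2_ip x (conjc a *: y).
Proof. by congr isum; apply/funext => j; rewrite !ell2TZ cv_ipZl. Qed.

Lemma ell2_ipRl (t : R) (x y : ell2T) : ell2_ip (t%:C *: x) y = t * ell2_ip x y.
Proof.
rewrite -isumZ; last exact: ell2_ip_summable.
by congr isum; apply/funext => j; rewrite !ell2TZ cv_ipRl.
Qed.

Lemma ell2_ip_ge0 (x : ell2T) : 0 <= ell2_ip x x.
Proof. by rewrite ell2_ipxx psum_ge0// => j; exact: sqv_ge0. Qed.

Lemma ell2_ip_eq0 (x : ell2T) : ell2_ip x x = 0 -> x = 0.
Proof.
rewrite ell2_ipxx => /(eq_psum0 (sqv_ge0 x) (ell2TP x)) h.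
apply/val_inj/funext => j; apply: vnorm_eq0.
by have /eqP := h j; rewrite sqrf_eq0 => /eqP.
Qed.

Definition ell2_inner : inner ell2T :=
  Inner ell2_ipC ell2_ipDl ell2_ipZl ell2_ipRl ell2_ip_ge0 ell2_ip_eq0.

Lemma ell2_nrmE (x : ell2T) : nrm ell2_inner x = ell2_norm x.
Proof. by rewrite /nrm /= ell2_ipxx. Qed.

Lemma ell2_nrm_sqr (x : ell2T) : nrm ell2_inner x ^+ 2 = psum (sqv x).
Proof. by rewrite nrm_sqr /= ell2_ipxx. Qed.

Lemma vnorm_le_ell2 (x : ell2T) j : vnorm (x j) <= nrm ell2_inner x.
Proof.
rewrite -(ler_pXn2r (n:=2))// ?nnegrE ?vnorm_ge0 ?nrm_ge0//.
by rewrite ell2_nrm_sqr; apply: (psum_ge1 _ (sqv_ge0 x)); exact: ell2TP.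
Qed.

Lemma geometric_cvg (u : nat -> R) (C q : R) : 0 <= q < 1 ->
  (forall k, `|u k| <= C * q ^+ k) ->
  exists l : R, (fun n => \sum_(k < n) u k) @ \oo --> l.
Proof.
move=> /andP[q0 q1] h; exists (lim (series u @ \oo)).
rewrite (_ : (fun n => _) = series u); last first.
  by apply/funext => n; rewrite /series /= big_mkord.
have g0 n : 0 <= geometric C q n by apply: le_trans (normr_ge0 _) (h n).
apply: normed_cvg; apply: (series_le_cvg (fun n => normr_ge0 (u n)) g0 h).
by apply: is_cvg_geometric_series; rewrite ger0_norm.
Qed.

Lemma sqv_ReIm (m : nat) (v : 'cV[R[i]]_m) : vnorm v ^+ 2 =
  \sum_k (complex.Re (v k 0) ^+ 2 + complex.Im (v k 0) ^+ 2).
Proof.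
rewrite vnorm_sqr; apply: eq_bigr => k _; case: (v k 0) => a b /=.
by rewrite sqr_sqrtr// addr_ge0 ?sqr_ge0.
Qed.

Lemma sum_ReIm (n : nat) (F : nat -> R[i]) : \sum_(k < n) F k =
  (\sum_(k < n) complex.Re (F k)) +i* (\sum_(k < n) complex.Im (F k)).
Proof.
elim: n => [|n IH]; first by rewrite !big_ord0.
by rewrite !big_ord_recr IH /=; case: (F n).
Qed.

Lemma nrm_geometric_tail (V : lmodType R[i]) (I : inner V) (u : nat -> V) (C q : R) :
  0 <= q < 1 -> (forall k, nrm I (u k) <= C * q ^+ k) -> forall n m,
  nrm I (\sum_(k < n + m) u k - \sum_(k < n) u k) <= C * q ^+ n / (1 - q).
Proof.
move=> /andP[q0 q1] h n m; have q1' : 0 < 1 - q by rewrite subr_gt0.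
have C0 : 0 <= C by have := le_trans (nrm_ge0 I _) (h 0%N); rewrite mulr1.
suff : nrm I (\sum_(k < n + m) u k - \sum_(k < n) u k) <=
    C * q ^+ n * (1 - q ^+ m) / (1 - q).
  move/le_trans; apply; rewrite ler_pM2r ?invr_gt0//.
  by rewrite ler_piMr ?mulr_ge0 ?exprn_ge0// gerBl exprn_ge0.
elim: m => [|m IH]; first by rewrite addn0 subrr nrm0 subrr mulr0 mul0r.
rewrite addnS big_ord_recr /= addrAC; apply: (le_trans (nrmD _ _ _)).
apply: (le_trans (lerD IH (h _))); rewrite exprD exprS le_eqVlt; apply/orP; left.
by apply/eqP; field; rewrite gt_eqF.
Qed.

(** The coordinates converge absolutely and define [s0]; the uniform tail bound then passes to the
    limit on finite sets of indices, as in Fatou's lemma. The case [n = 0] shows that [s0] is square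
    summable. *)
Lemma ell2_complete : complete_inner ell2_inner.
Proof.
move=> u C q qE h.
have C0 : 0 <= C by have := le_trans (nrm_ge0 _ _) (h 0%N); rewrite mulr1.
have coord k j a : cmod (u k j a 0) <= C * q ^+ k.
  by apply: le_trans (h k); apply: le_trans (vnorm_le_ell2 _ j); exact: cmod_le_vnorm.
have [re reE] := choice (fun ja : int * 'I_p => @geometric_cvg
  (fun k => complex.Re (u k ja.1 ja.2 0)) C q qE
  (fun k => le_trans (cmod_ge_Re _) (coord k ja.1 ja.2))).
have [im imE] := choice (fun ja : int * 'I_p => @geometric_cvg
  (fun k => complex.Im (u k ja.1 ja.2 0)) C q qE
  (fun k => le_trans (cmod_ge_Im _) (coord k ja.1 ja.2))).
pose s0 (j : int) : 'cV[R[i]]_p := \col_a (re (j, a) +i* im (j, a)).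
pose sn n := \sum_(k < n) u k.
(* For a finite set [r] the sum is a limit over [m] of sums that [nrm_geometric_tail] bounds
   uniformly in [m >= n]. *)
have bound n (r : seq int) : uniq r ->
    \sum_(j <- r) vnorm (s0 j - sn n j) ^+ 2 <= (C * q ^+ n / (1 - q)) ^+ 2.
  move=> ur.
  pose f m := \sum_(j <- r) vnorm (sn m j - sn n j) ^+ 2.
  have fs : f @ \oo --> \sum_(j <- r) vnorm (s0 j - sn n j) ^+ 2.
    rewrite /f; apply: (cvg_big (op := +%R)) => [|j _]; first exact: add_continuous.
    under eq_fun do rewrite sqv_ReIm.
    rewrite sqv_ReIm; apply: (cvg_big (op := +%R)) => [|a _]; first exact: add_continuous.
    have Ea m : sn m j a 0 = (\sum_(k < m) complex.Re (u k j a 0)) +i*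
        (\sum_(k < m) complex.Im (u k j a 0)).
      by rewrite /sn ell2T_sum summxE (sum_ReIm m (fun k => u k j a 0)).
    have ReB m : complex.Re ((sn m j - sn n j) a 0) =
       \sum_(k < m) complex.Re (u k j a 0) - complex.Re (sn n j a 0).
      by rewrite !mxE ReD ReN (Ea m).
    have ImB m : complex.Im ((sn m j - sn n j) a 0) =
       \sum_(k < m) complex.Im (u k j a 0) - complex.Im (sn n j a 0).
      by rewrite !mxE (Ea m); case: (sn n j a 0).
    under eq_fun do rewrite ReB ImB.
    have -> : complex.Re ((s0 j - sn n j) a 0) = re (j, a) - complex.Re (sn n j a 0).
      by rewrite !mxE ReD ReN.
    have -> : complex.Im ((s0 j - sn n j) a 0) = im (j, a) - complex.Im (sn n j a 0).
      by rewrite !mxE; case: (sn n j a 0).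
    apply: cvgD; under eq_fun do rewrite expr2; rewrite expr2.
      by apply: cvgM; (apply: cvgB; [exact: (reE (j, a))|exact: cvg_cst]).
    by apply: cvgM; (apply: cvgB; [exact: (imE (j, a))|exact: cvg_cst]).
  rewrite -(cvg_lim (@Rhausdorff R) fs); apply: limr_le; first by apply/cvg_ex; exists (\sum_(j <- r) vnorm (s0 j - sn n j) ^+ 2).
  exists n => // m /= nm; rewrite /f.
  have e : \sum_(j <- r) vnorm (sn m j - sn n j) ^+ 2 <= nrm ell2_inner (sn m - sn n) ^+ 2.
    rewrite ell2_nrm_sqr (eq_bigr (sqv (sn m - sn n))) => [|j _].
      exact: (psum_ge (sqv_ge0 (sn m - sn n)) (ell2TP _) ur).
    by rewrite /sqv ell2TB.
  have /andP[q0 q1] := qE.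
  have tail : nrm ell2_inner (sn m - sn n) <= C * q ^+ n / (1 - q).
    have := @nrm_geometric_tail _ ell2_inner u C q qE h n (m - n).
    rewrite (subnKC nm) -/(sn m) -/(sn n).
    by [].
  apply: (le_trans e); apply: lerXn2r; rewrite ?nnegrE ?nrm_ge0//.
  by rewrite mulr_ge0 ?mulr_ge0 ?exprn_ge0// invr_ge0 subr_ge0 ltW.
have s0P n : summableR (sqv (s0 - sn n)).
  by apply: summableR_bound (bound n) => j; exact: sqr_ge0.
have s0E : s0 \in ell2p.
  apply/ell2pP; rewrite ell2E; move: (s0P 0%N); congr summableR.
  by apply/funext => j; rewrite /sqv /sn big_ord0 /= fctE subr0.
exists (MkEll2 s0E) => n.
case/andP: qE => q0 q1.
rewrite -(ler_pXn2r (n:=2))// ?nnegrE ?nrm_ge0//.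
  rewrite ell2_nrm_sqr; apply: psum_bound; first by move=> j; exact: sqr_ge0.
  by move=> r ur; exact: bound.
by rewrite mulr_ge0 ?mulr_ge0 ?exprn_ge0// invr_ge0 subr_ge0 ltW.
Qed.

End Ell2Space.

(** * Tridiagonal operators and their sections *)

Section TridiagonalOperators.
Variables (R : realType) (p : nat).
Local Notation M := 'M[R[i]]_p.
Local Notation N := (nrm (ell2_inner R p)).
Implicit Types (A : tridiag R p) (c : int -> M) (x y : ell2T R p) (k : int).

Definition mat_bound c (m : R) := forall j v, vnorm (c j *m v) <= m * vnorm v.

Definition bounded_coef c := exists m, mat_bound c m.

Lemma bounded_coefP c : (exists m : R, forall j, opnorm (c j) <= m) -> bounded_coef c.
Proof.
move=> [m h]; exists m => j v; apply: (le_trans (vnorm_mul_le _ _)).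
by rewrite ler_wpM2r ?vnorm_ge0.
Qed.

Lemma supnorm_bound c : (exists m : R, forall j, opnorm (c j) <= m) ->
  mat_bound c (supnorm c).
Proof.
move=> [m h] j v; apply: (le_trans (vnorm_mul_le _ _)).
rewrite ler_wpM2r ?vnorm_ge0//; apply: ub_le_sup; last by exists j.
by exists m => _ [j' _ <-].
Qed.

Lemma supnorm_ge0 c : (exists m : R, forall j, opnorm (c j) <= m) -> 0 <= supnorm c.
Proof.
move=> [m h]; apply: (le_trans (opnorm_ge0 (c 0))).
apply: ub_le_sup; last by exists 0.
by exists m => _ [j' _ <-].
Qed.

Lemma bounded_coef_shift c k : bounded_coef c -> bounded_coef (fun j => c (j + k)).
Proof. by move=> [m h]; exists m => j v; exact: h. Qed.

Lemma dshift_sqv c (m : R) k x j : mat_bound c m ->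
  vnorm (c j *m x (j + k)) ^+ 2 <= m ^+ 2 * sqv x (j + k).
Proof.
move=> h; rewrite /sqv -exprMn; apply: lerXn2r; rewrite ?nnegrE ?vnorm_ge0//.
by apply: le_trans (h j _); exact: vnorm_ge0.
Qed.

Lemma dshift_summable c k x : bounded_coef c ->
  (fun j => c j *m x (j + k)) \in @ell2p R p.
Proof.
move=> [m h]; apply/ell2pP; rewrite ell2E.
apply: le_summableR (summableRZ (t := m ^+ 2) _ _ _) => [j||//|].
- exact: (dshift_sqv k x j h).
- by move=> j; exact: sqv_ge0.
- exact: sqr_ge0.
- by rewrite summableR_shift; exact: ell2TP.
Qed.

(** A single diagonal acting on [ell2]. A tridiagonal operator is a sum of three of these, each with
    an evident norm bound and adjoint. *)
Definition dshift c k (hc : bounded_coef c) x : ell2T R p :=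
  MkEll2 (dshift_summable k x hc).

Lemma nrm_dshift c k (hc : bounded_coef c) (m : R) x : 0 <= m -> mat_bound c m ->
  N (dshift k hc x) <= m * N x.
Proof.
move=> m0 h; rewrite -(ler_pXn2r (n:=2)) ?nnegrE ?mulr_ge0 ?nrm_ge0//.
rewrite exprMn !ell2_nrm_sqr -(psum_shift (sqv x) k) -psumZ ?sqr_ge0//.
- apply: le_psum => [j|j|]; first exact: sqv_ge0.
    exact: dshift_sqv.
  apply: summableRZ; [by move=> j; exact: sqv_ge0|exact: sqr_ge0|].
  by rewrite summableR_shift; exact: ell2TP.
- by move=> j; exact: sqv_ge0.
- by rewrite summableR_shift; exact: ell2TP.
Qed.

Lemma dshift_adjoint c c' k k' (hc : bounded_coef c) (hc' : bounded_coef c') x y :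
  k' = - k -> (forall j, c' j = conjmx (c (j - k))^T) ->
  ell2_ip (dshift k hc x) y = ell2_ip x (dshift k' hc' y).
Proof.
move=> -> cc'; rewrite /ell2_ip.
rewrite -(isum_shift (fun j => cv_ip (x j) _) k); congr isum; apply/funext => j.
by rewrite /= cv_ip_mul cc' addrK.
Qed.

(** The sequences [alpha] and [gamma] are indexed by columns but [dshift] by rows, hence the offsets
    here and in [gamma_coef]. *)
Definition alpha_coef A : bounded_coef (fun j => alpha A (j - 1)) :=
  bounded_coef_shift (-1) (bounded_coefP (alpha_bounded A)).

Definition beta_coef A : bounded_coef (beta A) := bounded_coefP (beta_bounded A).

Definition gamma_coef A : bounded_coef (fun j => gamma A (j + 1)) :=
  bounded_coef_shift 1 (bounded_coefP (gamma_bounded A)).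

Lemma tri_opE A x : tri_op A x =
  dshift (-1) (alpha_coef A) x + dshift 0 (beta_coef A) x + dshift 1 (gamma_coef A) x.
Proof. by apply/funext => j; rewrite /tri_op !ell2TD /= addr0. Qed.

Lemma tri_op_ell2 A x : tri_op A x \in @ell2p R p.
Proof. by rewrite tri_opE; exact: valP. Qed.

Definition tri_ell2 A x : ell2T R p := MkEll2 (tri_op_ell2 A x).

Lemma tri_ell2E A x : tri_ell2 A x =
  dshift (-1) (alpha_coef A) x + dshift 0 (beta_coef A) x + dshift 1 (gamma_coef A) x.
Proof. by apply: val_inj; rewrite /= tri_opE. Qed.

Lemma tri_ell2_linear A : linear (tri_ell2 A).
Proof.
move=> a x y; apply/val_inj/funext => j.
change (tri_op A (a *: x + y) j = a *: tri_op A x j + tri_op A y j).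
rewrite /tri_op !ell2TD !ell2TZ !mulmxDr -!scalemxAr !scalerDr.
by rewrite (addrACA (a *: (alpha A (j - 1) *m x (j - 1)))) [LHS]addrACA.
Qed.

HB.instance Definition _ A := GRing.isLinear.Build R[i] (ell2T R p) (ell2T R p)
  _ (tri_ell2 A) (tri_ell2_linear A).

Lemma nrm_tri_ell2 A (a b c : R) x : 0 <= a -> 0 <= b -> 0 <= c ->
  mat_bound (alpha A) a -> mat_bound (beta A) b -> mat_bound (gamma A) c ->
  N (tri_ell2 A x) <= (a + b + c) * N x.
Proof.
move=> a0 b0 c0 ha hb hc; rewrite tri_ell2E.
have ea := nrm_dshift (-1) (alpha_coef A) x a0 (fun j => ha (j - 1)).
have eb := nrm_dshift 0 (beta_coef A) x b0 hb.
have ec := nrm_dshift 1 (gamma_coef A) x c0 (fun j => hc (j + 1)).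
rewrite !mulrDl; apply: (le_trans (nrmD _ _ _) (lerD _ ec)).
exact: (le_trans (nrmD _ _ _) (lerD ea eb)).
Qed.

Lemma tri_ell2_bounded A : exists2 m : R, 0 < m & forall x, N (tri_ell2 A x) <= m * N x.
Proof.
have a0 := supnorm_ge0 (alpha_bounded A); have b0 := supnorm_ge0 (beta_bounded A).
have c0 := supnorm_ge0 (gamma_bounded A).
exists (supnorm (alpha A) + supnorm (beta A) + supnorm (gamma A) + 1).
  exact: ltr_wpDl (addr_ge0 (addr_ge0 a0 b0) c0) ltr01.
move=> x; rewrite mulrDl mul1r; apply: ler_wpDr (nrm_ge0 _ _) _.
exact: (nrm_tri_ell2 _ a0 b0 c0 (supnorm_bound (alpha_bounded A))
  (supnorm_bound (beta_bounded A)) (supnorm_bound (gamma_bounded A))).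
Qed.

Lemma opnorm_tr (m n : nat) (B : 'M[R[i]]_(m, n)) : opnorm B^T <= opnorm B.
Proof.
apply: opnorm_le; first exact: opnorm_ge0.
by apply: vnorm_tr_mul_le; [exact: opnorm_ge0|exact: vnorm_mul_le].
Qed.

Lemma opnorm_conj (m n : nat) (B : 'M[R[i]]_(m, n)) : opnorm (conjmx B) <= opnorm B.
Proof.
apply: opnorm_le => [|x]; first exact: opnorm_ge0.
by rewrite -[x in _ *m x]conjmxK -conjmxM vnorm_conj -(vnorm_conj x) vnorm_mul_le.
Qed.

Lemma tr_bounded c k : (exists m : R, forall j, opnorm (c j) <= m) ->
  exists m : R, forall j, opnorm (c (j + k))^T <= m.
Proof. by move=> [m h]; exists m => j; exact: le_trans (opnorm_tr _) (h _). Qed.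

Lemma tr_bounded0 c : (exists m : R, forall j, opnorm (c j) <= m) ->
  exists m : R, forall j, opnorm (c j)^T <= m.
Proof. by move=> [m h]; exists m => j; exact: le_trans (opnorm_tr _) (h _). Qed.

Lemma conj_bounded c : (exists m : R, forall j, opnorm (c j) <= m) ->
  exists m : R, forall j, opnorm (conjmx (c j)) <= m.
Proof. by move=> [m h]; exists m => j; exact: le_trans (opnorm_conj _) (h _). Qed.

(** The coefficients are inferred from the boundedness proofs: the new [alpha] at [j] is the
    transpose of [gamma A (j + 1)], the new [gamma] that of [alpha A (j - 1)]. *)
Definition tri_tr A : tridiag R p := Tridiag
  (tr_bounded 1 (gamma_bounded A)) (tr_bounded0 (beta_bounded A))
  (tr_bounded (-1) (alpha_bounded A)).

Definition tri_conj A : tridiag R p := Tridiag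
  (conj_bounded (alpha_bounded A)) (conj_bounded (beta_bounded A))
  (conj_bounded (gamma_bounded A)).

Lemma mat_tr A i j : mat (tri_tr A) i j = mat_adj A i j.
Proof.
rewrite /mat_adj /mat /= (_ : (j == i + 1) = (i == j - 1)); last by lia.
rewrite (_ : (j == i - 1) = (i == j + 1)); last by lia.
rewrite [j == i]eq_sym.
have [->|ij1] := eqVneq i (j + 1).
  have e1 : (j + 1 == j - 1) = false by lia.
  have e2 : (j + 1 == j) = false by lia.
  by rewrite e1 e2.
have [->|ij] := eqVneq i j.
  have e1 : (j == j - 1) = false by lia.
  by rewrite e1.
by have [->|ij2] := eqVneq i (j - 1); rewrite ?subrK// trmx0.
Qed.

Lemma tri_adjoint A : adjoint (ell2_inner R p) (tri_ell2 A) (tri_ell2 (tri_conj (tri_tr A))).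
Proof.
move=> x y; set A' := tri_conj (tri_tr A).
have ha : ell2_ip (dshift (-1) (alpha_coef A) x) y =
    ell2_ip x (dshift 1 (gamma_coef A') y).
  by apply: dshift_adjoint => // j; rewrite /= opprK.
have hb : ell2_ip (dshift 0 (beta_coef A) x) y =
    ell2_ip x (dshift 0 (beta_coef A') y).
  by apply: dshift_adjoint => [|j]; rewrite ?oppr0// subr0.
have hc : ell2_ip (dshift 1 (gamma_coef A) x) y =
    ell2_ip x (dshift (-1) (alpha_coef A') y).
  by apply: dshift_adjoint.
have Dr (u v w : ell2T R p) : ell2_ip u (v + w) = ell2_ip u v + ell2_ip u w.
  exact: (ipDr (ell2_inner R p)).
change (ell2_ip (tri_ell2 A x) y = ell2_ip x (tri_ell2 A' y)).
rewrite (tri_ell2E A x) (tri_ell2E A' y).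
move: (dshift _ (alpha_coef A) x) (dshift _ (beta_coef A) x)
  (dshift _ (gamma_coef A) x) (dshift _ (alpha_coef A') y)
  (dshift _ (beta_coef A') y) (dshift _ (gamma_coef A') y) ha hb hc.
move=> a b c a' b' c' ha hb hc; rewrite !ell2_ipDl !Dr ha hb hc.
by rewrite [LHS]addrC addrA [LHS]addrAC.
Qed.

Lemma conj_ell2 x : (fun j => conjmx (x j)) \in @ell2p R p.
Proof.
apply/ell2pP; rewrite ell2E; have := ell2TP x; congr summableR.
by apply/funext => j; rewrite /sqv vnorm_conj.
Qed.

Definition ell2_conj x : ell2T R p := MkEll2 (conj_ell2 x).

Lemma nrm_conj x : N (ell2_conj x) = N x.
Proof.
rewrite /nrm /= !ell2_ipxx; congr (Num.sqrt (psum _)).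
by apply/funext => j; rewrite /sqv vnorm_conj.
Qed.

Lemma ell2_conjK x : ell2_conj (ell2_conj x) = x.
Proof. by apply/val_inj/funext => j; rewrite /= conjmxK. Qed.

Lemma tri_conjE A l x :
  op_sub (tri_ell2 (tri_conj A)) (conjc l) (ell2_conj x) =
  ell2_conj (op_sub (tri_ell2 A) l x).
Proof.
rewrite !op_subE; apply/val_inj/funext => j.
change (tri_op (tri_conj A) (ell2_conj x) j - conjc l *: conjmx (x j) =
  conjmx (tri_op A x j - l *: x j)).
rewrite /tri_op /= /conjmx raddfB !raddfD /= !map_mxM; congr (_ - _).
by apply/matrixP => a b; rewrite !mxE rmorphM.
Qed.

Lemma bounded_below_conj A l (c : R) :
  bounded_below (ell2_inner R p) (op_sub (tri_ell2 A) l) c ->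
  bounded_below (ell2_inner R p) (op_sub (tri_ell2 (tri_conj A)) (conjc l)) c.
Proof.
move=> h x; have := h (ell2_conj x).
by rewrite -(nrm_conj (op_sub _ _ _)) -tri_conjE ell2_conjK nrm_conj.
Qed.

Lemma tri_conjK A : tri_ell2 (tri_conj (tri_conj A)) =1 tri_ell2 A.
Proof.
move=> x; apply/val_inj/funext => j.
by rewrite /= /tri_op /= !conjmxK.
Qed.

(** Removes the conjugates of the Hilbert adjoint with no loss in the constant, so that sections of
    [mat_adj] can stand for the adjoint. *)
Lemma bounded_below_conj_tr A l (c : R) :
  bounded_below (ell2_inner R p) (op_sub (tri_ell2 (tri_conj (tri_tr A))) (conjc l)) c ->
  bounded_below (ell2_inner R p) (op_sub (tri_ell2 (tri_tr A)) l) c.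
Proof.
move=> /bounded_below_conj; rewrite conjcK => h x; apply: le_trans (h x) _.
rewrite (_ : op_sub _ l x = op_sub (tri_ell2 (tri_tr A)) l x)// !op_subE.
by congr (_ - _); exact: tri_conjK.
Qed.

(** A bounded inverse gives the first bound directly and the second through the adjoint. Conversely
    the bound on the transpose yields surjectivity, the bound on [A - l] injectivity and the
    boundedness of the inverse. *)
Lemma not_SpecP A l : ~ Spec A l <-> exists2 c : R, 0 < c &
  bounded_below (ell2_inner R p) (op_sub (tri_ell2 A) l) c /\
  bounded_below (ell2_inner R p) (op_sub (tri_ell2 (tri_tr A)) l) c.
Proof.
have [m m0 mA] := tri_ell2_bounded A.
split.
  move=> /contrapT [B [[Bell Blin [K BK]] BT TB]].
  pose K' := Num.max K 1; have K0 : 0 < K' by rewrite lt_max ltr01 orbT.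
  have B2 (x : ell2T R p) : B x \in @ell2p R p by apply/ell2pP/Bell/ell2TP.
  pose B' x := MkEll2 (B2 x).
  have B'K x : N (B' x) <= K' * N x.
    rewrite !ell2_nrmE; apply: (le_trans (BK _ (ell2TP x))).
    by rewrite ler_wpM2r ?sqrtr_ge0// le_max lexx.
  have TB' x : op_sub (tri_ell2 A) l (B' x) = x.
    by apply: val_inj; exact: TB (ell2TP x).
  have BT' x : B' (op_sub (tri_ell2 A) l x) = x.
    by apply: val_inj; exact: BT (ell2TP x).
  exists K'^-1; first by rewrite invr_gt0.
  split; first by move=> x; rewrite ler_pdivrMl// -{1}(BT' x) B'K.
  apply: bounded_below_conj_tr.
  exact: adjoint_bounded_below (adjoint_op_sub _ (tri_adjoint A)) K0 B'K TB'.
move=> [c c0 [cT cTt]] nB; apply: nB.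
have [m' m'0 mA'] := tri_ell2_bounded (tri_conj (tri_tr A)).
pose K := Num.max m m' + cmod l.
have KT x : N (op_sub (tri_ell2 A) l x) <= K * N x.
  rewrite op_subE; apply: (le_trans (nrmB _ _ _)); rewrite mulrDl nrmZ lerD2r.
  by apply: (le_trans (mA x)); rewrite ler_wpM2r ?nrm_ge0// le_max lexx.
have KT' x : N (op_sub (tri_ell2 (tri_conj (tri_tr A))) (conjc l) x) <= K * N x.
  rewrite op_subE; apply: (le_trans (nrmB _ _ _)); rewrite mulrDl nrmZ cmodJ lerD2r.
  by apply: (le_trans (mA' x)); rewrite ler_wpM2r ?nrm_ge0// le_max lexx orbT.
have surj := adjoint_bounded_below_surj (@ell2_complete R p)
  (adjoint_op_sub l (tri_adjoint A)) KT KT' c0 (bounded_below_conj cTt).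
have [f fE] := choice surj.
(* Operators are maps on all sequences; outside [ell2] the inverse is given the value 0. *)
pose B (x : int -> 'cV[R[i]]_p) : int -> 'cV[R[i]]_p :=
  if insub x is Some u then f u else 0.
have BE (x : ell2T R p) : B x = f x.
  by rewrite /B -[eseq x]/(val x) valK.
have lift (x : int -> 'cV[R[i]]_p) : ell2 x -> exists u : ell2T R p, x = u.
  by move=> /ell2pP xp; exists (MkEll2 xp).
(* The preimages in [f] are merely chosen; injectivity makes [f] linear and a left inverse. *)
have inj (x y : ell2T R p) : op_sub (tri_ell2 A) l x = op_sub (tri_ell2 A) l y -> x = y.
  move=> e; apply/eqP; rewrite -subr_eq0; apply/eqP/(@nrm_eq0 _ _ (ell2_inner R p)).
  apply/eqP; rewrite eq_le nrm_ge0 andbT -(ler_pM2l c0) mulr0.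
  by apply: (le_trans (cT _)); rewrite linearB e subrr nrm0.
exists B; split; [split|..].
- by move=> x /lift [u ->]; rewrite BE; exact: ell2TP.
- move=> a x y /lift [u ->] /lift [v ->].
  have -> : a *: (u : int -> _) + v = (a *: u + v : ell2T R p) by [].
  rewrite !BE.
  suff -> : f (a *: u + v) = a *: f u + f v by [].
  by apply: inj; rewrite linearP !fE.
- exists c^-1 => x /lift [u ->]; rewrite BE -!ell2_nrmE.
  by rewrite ler_pdivlMl// (le_trans (cT _))// fE.
- move=> x /lift [u ->].
  have -> : tri_op A u - l *: (u : int -> _) = op_sub (tri_ell2 A) l u by [].
  by rewrite BE; congr eseq; apply: inj; rewrite fE.
- move=> x /lift [u ->]; rewrite BE.
  have -> : tri_op A (f u) - l *: (f u : int -> _) = op_sub (tri_ell2 A) l (f u) by [].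
  by rewrite fE.
Qed.

End TridiagonalOperators.

(** * The sine window and the bound on [pi] *)

Section Trigonometry.
Variable R : realType.

Lemma sin_le_id (x : R) : 0 <= x -> sin x <= x.
Proof.
rewrite le_eqVlt => /predU1P[<-|x0]; first by rewrite sin0.
have [|y _] := @MVT R sin cos 0 x x0 (fun y _ => is_derive_sin y).
  by apply/continuous_subspaceT => y; exact: continuous_sin.
by rewrite sin0 !subr0 => ->; rewrite ger_pMl// cos_le1.
Qed.

(** The left side is [4 sin^2 (t / 2)]. *)
Lemma two_sub_two_cos_le (t : R) : 0 <= t <= pi -> 2 - 2 * cos t <= t ^+ 2.
Proof.
move=> /andP[t0 tpi]; have -> : t = (t / 2) *+ 2 by rewrite -mulr_natr mulfVK.
rewrite cos_mulr2n cos2sin2.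
have h : 0 <= t / 2 by rewrite divr_ge0.
have s0 : 0 <= sin (t / 2).
  rewrite sin_ge0_pi// h/= ler_pdivrMr//; apply: (le_trans tpi).
  by rewrite ler_pMr ?pi_gt0// ler1n.
have : sin (t / 2) ^+ 2 <= (t / 2) ^+ 2 by apply: lerXn2r; rewrite ?nnegrE// sin_le_id.
rewrite !mulr2n !expr2; lra.
Qed.

(** The true value is about [-0.0006]. The Taylor polynomial of degree 8 is already negative, and
    the later terms are grouped in pairs of negative sum, the ratio of consecutive terms being at
    most [x ^+ 2 / 12 < 1]. *)
Lemma cos_11_7_lt0 : cos (11 / 7 : R) < 0.
Proof.
set x : R := 11 / 7.
rewrite -(opprK (cos _)) oppr_lt0; have /cvgN h := @cvg_cos_coeff' R x.
rewrite -(cvg_lim (@Rhausdorff R) h).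
have E n : cos_coeff' x n = (-1) ^+ n * x ^+ n.*2 / (n.*2)`!%:R.
  by rewrite /cos_coeff' exprnP.
have F0 n : 0 < (n`!)%:R :> R by rewrite ltr0n fact_gt0.
have FS n : (n.+1)`!%:R = n.+1%:R * n`!%:R :> R by rewrite factS natrM.
apply: (@lt_trans _ _ (\sum_(0 <= i < 5) - cos_coeff' x i)).
  do 5 rewrite big_nat_recl//; rewrite big_nil !E.
  rewrite -[0.*2]/0%N -[1.*2]/2%N -[2.*2]/4%N -[3.*2]/6%N -[4.*2]/8%N.
  rewrite !FS fact0 /x; lra.
rewrite -seriesN; apply: lt_sum_lim_series => [|d].
  by move/cvgP in h; rewrite seriesN.
rewrite addnS.
have sg n : odd n -> cos_coeff' x n = - (x ^+ n.*2 / (n.*2)`!%:R).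
  by move=> on; rewrite E -signr_odd on expr1 mulN1r mulNr.
have sg' n : ~~ odd n -> cos_coeff' x n = x ^+ n.*2 / (n.*2)`!%:R.
  by move=> on; rewrite E -signr_odd (negbTE on) expr0 mul1r.
have od : odd (5 + d.*2) by rewrite oddD odd_double.
move: (5 + d.*2)%N od => m om.
have em : ~~ odd m.+1 by rewrite oddS om.
rewrite (sg _ om) (sg' _ em) opprK subr_gt0 doubleS !FS.
have x0 : 0 < x by rewrite /x; lra.
have xm : 0 < x ^+ m.*2 by rewrite exprn_gt0.
have a4 : 4 <= (m.*2.+2)%:R :> R by rewrite ler_nat; case: (m) om => //= n _.
have b3 : 3 <= (m.*2.+1)%:R :> R by rewrite ler_nat; case: (m) om => //= n _.
rewrite [x ^+ _]exprS [x ^+ m.*2.+1]exprS.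
move: (x ^+ m.*2) (m.*2.+2)%:R (m.*2.+1)%:R (m.*2`!)%:R xm a4 b3 (F0 m.*2).
move=> P a b F P0 a4 b3 F1.
have a0 : 0 < a by lra.
have b0 : 0 < b by lra.
have -> : x * (x * P) / (a * (b * F)) = P / F * (x ^+ 2 / (a * b)).
  by field; rewrite !gt_eqF.
rewrite gtr_pMr ?divr_gt0// ltr_pdivrMr ?mulr_gt0// mul1r.
have : 12 <= a * b by nra.
rewrite /x; lra.
Qed.

(** Otherwise [11 / 7 < pi / 2], where the cosine is positive. *)
Lemma pi_le_22_7 : pi <= 22 / 7 :> R.
Proof.
have p2 : pi <= 4 :> R by have := @pihalf_lt2 R; lra.
rewrite leNgt; apply/negP => h.
suff : 0 < cos (11 / 7 : R) by have := cos_11_7_lt0; lra.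
by apply: cos_gt0_pihalf; lra.
Qed.

(** Summation by parts for an eigenvector of the discrete Laplacian with eigenvalue [2 - 2 C]. The
    last two terms come from the boundary and vanish once [s m = 0]. *)
Lemma sum_diff_sqr (s : nat -> R) (C : R) : s 0%N = 0 ->
  (forall m, s m.+2 = 2 * C * s m.+1 - s m) -> forall m,
  \sum_(j < m) (s j.+1 - s j) ^+ 2 =
  (2 - 2 * C) * (\sum_(j < m) s j ^+ 2) + (1 - 2 * C) * s m ^+ 2 + s m * s m.+1.
Proof.
move=> s0 rec; elim=> [|m IH]; first by rewrite !big_ord0 s0; ring.
by rewrite !big_ord_recr /= IH rec; ring.
Qed.

(** The sine is the lowest Dirichlet eigenvector, so no window vanishing at both ends has a smaller
    ratio. For [n = 0] it vanishes identically, hence the alternative. *)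
Lemma sin_window (n : nat) : exists s : nat -> R,
  [/\ s 0%N = 0, s n.+1 = 0, 0 < s 1%N \/ n = 0%N &
   \sum_(j < n.+1) (s j.+1 - s j) ^+ 2 <=
     (22 / (7 * n.+1%:R)) ^+ 2 * \sum_(j < n.+1) s j ^+ 2].
Proof.
pose t : R := pi / n.+1%:R; exists (fun m => sin (m%:R * t)).
have n0 : 0 < n.+1%:R :> R by rewrite ltr0n.
have t0 : 0 < t by rewrite divr_gt0// pi_gt0.
have tpi : t <= pi by rewrite ler_pdivrMr// ler_pMr ?pi_gt0// ler1n.
have e : n.+1%:R * t = pi by rewrite mulrC divfK ?gt_eqF.
split.
- by rewrite mul0r sin0.
- by rewrite e sinpi.
- case: (n) @t n0 t0 tpi e => [|k] t n0 t0 tpi e; [by right|left].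
  rewrite mul1r sin_gt0_pi// t0/= ltr_pdivrMr// ltr_pMr ?pi_gt0//.
  by rewrite ltr1n.
have s0 : sin (0%:R * t) = 0 by rewrite mul0r sin0.
have rec m : sin (m.+2%:R * t) = 2 * cos t * sin (m.+1%:R * t) - sin (m%:R * t).
  rewrite -[in m.+2%:R]addn2 -[in m.+1%:R]addn1 !natrD.
  rewrite (_ : (m%:R + 2) * t = (m%:R + 1) * t + t); last by ring.
  rewrite (_ : m%:R * t = (m%:R + 1) * t - t); last by ring.
  by rewrite sinD sinB; ring.
rewrite (@sum_diff_sqr (fun m => sin (m%:R * t)) (cos t) s0 rec).
rewrite e sinpi expr0n mulr0 mul0r !addr0.
apply: ler_wpM2r; first by apply: sumr_ge0 => j _; exact: sqr_ge0.
apply: (le_trans (two_sub_two_cos_le _)); first by rewrite ltW.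
have tk : t <= 22 / (7 * n.+1%:R).
  rewrite ler_pdivrMr// invfM mulrA divfK ?gt_eqF//; exact: pi_le_22_7.
by apply: lerXn2r; rewrite ?nnegrE ?(ltW t0)//; exact: le_trans (ltW t0) tk.
Qed.

End Trigonometry.

(** * Sections acting on finitely supported vectors *)

Section Sections.
Variables (R : realType) (p : nat).
Local Notation N := (nrm (ell2_inner R p)).
Implicit Types (A : tridiag R p) (k : int) (l : R[i]).

Lemma mat_mul A (r c : int) (v : 'cV[R[i]]_p) : mat A r c *m v =
  (if c == r - 1 then alpha A c *m v else 0) +
  (if c == r then beta A c *m v else 0) +
  (if c == r + 1 then gamma A c *m v else 0).
Proof.
rewrite /mat (_ : (r == c + 1) = (c == r - 1)); last by lia.
rewrite [r == c]eq_sym (_ : (r == c - 1) = (c == r + 1)); last by lia.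
have [e1|e1] := eqVneq c (r - 1).
  have e2 : (c == r) = false by lia.
  have e3 : (c == r + 1) = false by lia.
  by rewrite e2 e3 !addr0.
have [e2|e2] := eqVneq c r.
  have e3 : (c == r + 1) = false by lia.
  by rewrite e3 add0r addr0.
by rewrite !add0r; case: ifP => // _; rewrite mul0mx.
Qed.

Definition outside (n : nat) k (c : int) := (c < k + 1) || (k + 1 + n%:Z <= c).

Lemma sum_delta (V : nmodType) (n : nat) k (G : int -> V) (c0 : int) :
  (forall c, outside n k c -> G c = 0) ->
  \sum_(j < n) (if k + 1 + j%:Z == c0 then G (k + 1 + j%:Z) else 0) = G c0.
Proof.
move=> G0; have [out|ins] := boolP (outside n k c0).
  rewrite G0// big1// => j _; case: eqP => // e.
  by move: out; rewrite /outside -e; have := ltn_ord j; lia.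
have jn : (absz (c0 - (k + 1))%R < n)%N by move: ins; rewrite /outside; lia.
have je : k + 1 + (absz (c0 - (k + 1))%R)%:Z = c0 by move: ins; rewrite /outside; lia.
rewrite (bigD1 (Ordinal jn))//= je eqxx big1 ?addr0// => j jne.
case: eqP => // e; move: jne; rewrite -val_eqE /=; lia.
Qed.

Definition window (n : nat) k (x : int -> 'cV[R[i]]_p) : 'cV[R[i]]_(\sum_(j < n) p) :=
  \mxcol_(j < n) x (k + 1 + j%:Z).

(** As [x] vanishes outside the columns of the section, each row of the block product is the full
    row of [(A - l) x]; nothing is lost at the borders. *)
Lemma sect_window A n k l (x : int -> 'cV[R[i]]_p) :
  (forall c, outside n k c -> x c = 0) ->
  (sect (mat A) n k - l *: sectI R p n) *m window n k x =
  \mxcol_(j < n.+2) (tri_op A x (k + j%:Z) - l *: x (k + j%:Z)).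
Proof.
move=> x0; rewrite mulmxBl -scalemxAl /sect /sectI /window !mul_mxblock_mxrow.
rewrite -[l *: _]mul_scalar_mx.
have -> : l%:M *m (\mxcol_(j < n.+2) \sum_(j0 < n)
    (if (j : nat) == j0.+1 then 1%:M : 'M[R[i]]_p else 0) *m x (k + 1 + j0%:Z)) =
    \mxcol_(j < n.+2) (l *: \sum_(j0 < n)
    (if (j : nat) == j0.+1 then 1%:M : 'M[R[i]]_p else 0) *m x (k + 1 + j0%:Z)).
  by rewrite mul_scalar_mx; apply/matrixP => a b; rewrite !mxE.
rewrite -mxcolB; apply/eq_mxcolP => i; congr (_ - _ *: _).
  under eq_bigr do rewrite mat_mul; rewrite !big_split /=.
  rewrite (sum_delta (G := fun c => alpha A c *m x c)); last first.
    by move=> c /x0 ->; rewrite mulmx0.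
  rewrite (sum_delta (G := fun c => beta A c *m x c)); last first.
    by move=> c /x0 ->; rewrite mulmx0.
  rewrite (sum_delta (G := fun c => gamma A c *m x c)); last first.
    by move=> c /x0 ->; rewrite mulmx0.
  by [].
rewrite -[RHS](sum_delta _ x0); apply: eq_bigr => j _.
rewrite (_ : (k + 1 + j%:Z == k + i%:Z) = ((i : nat) == j.+1)); last by lia.
by case: ifP => _; rewrite ?mul1mx ?mul0mx.
Qed.

Lemma psum_support (n : nat) k (a : int -> R) : (forall c, 0 <= a c) ->
  (forall c, (c < k) || (k + n%:Z <= c) -> a c = 0) ->
  summableR a /\ psum a = \sum_(j < n) a (k + j%:Z).
Proof.
move=> a0 out; set s := [seq k + j%:Z | j <- iota 0 n].
have us : uniq s by rewrite map_inj_uniq ?iota_uniq// => u v; lia.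
have e : esumR a = (\sum_(j < n) a (k + j%:Z))%:E.
  transitivity (\esum_(j in [set` s]) (a j)%:E).
    rewrite [RHS]esum_mkcond; apply: eq_esum => j _.
    case: ifPn => // js; rewrite out//; apply/negPn/negP => h; case/negP: js.
    rewrite inE /=; apply/mapP; exists (absz (j - k)%R); last by lia.
    by rewrite mem_iota; lia.
  rewrite esum_fset; [|exact: finite_seq|by move=> j _; rewrite lee_fin].
  rewrite -fsbig_seq// big_map (_ : iota 0 n = index_iota 0 n).
    by rewrite big_mkord -sumEFin.
  by rewrite /index_iota subn0.
by rewrite /summableR /psum e ltry.
Qed.

Lemma nu_sect_ge A n k l (c : R) : (0 < \sum_(j < n) p)%N ->
  bounded_below (ell2_inner R p) (op_sub (tri_ell2 A) l) c ->
  c <= nu (sect (mat A) n k - l *: sectI R p n).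
Proof.
move=> np h; apply: nu_ge => // v v1.
pose x (r : int) : 'cV[R[i]]_p :=
  \sum_(j < n) if k + 1 + j%:Z == r then submxcol v j else 0.
have x0 r : outside n k r -> x r = 0.
  move=> out; rewrite /x big1// => j _; case: eqP => // e.
  by move: out; rewrite /outside -e; have := ltn_ord j; lia.
have vE : v = window n k x.
  rewrite -[v]submxcolK; apply/eq_mxcolP => j.
  rewrite /x (bigD1 j)//= eqxx big1 ?addr0// => j' jj'.
  case: eqP => // e; move: jj'; rewrite -val_eqE /=; lia.
have [sx px] : summableR (sqv x) /\ psum (sqv x) = \sum_(j < n) sqv x (k + 1 + j%:Z).
  by apply: psum_support => [r|r out]; rewrite /sqv ?sqr_ge0// x0// vnorm0 expr0n.
have xp : x \in @ell2p R p by apply/ell2pP.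
pose X : ell2T R p := MkEll2 xp.
have NX : N X = 1.
  apply/eqP; rewrite -sqrp_eq1 ?nrm_ge0// ell2_nrm_sqr px.
  by rewrite -vnorm_mxcol -/(window n k x) -vE v1 expr1n.
have := h X; rewrite NX mulr1 => /le_trans; apply.
rewrite vE sect_window//; rewrite -(ler_pXn2r (n:=2))// ?nnegrE ?nrm_ge0 ?vnorm_ge0//.
rewrite vnorm_mxcol ell2_nrm_sqr.
(* A tridiagonal operator enlarges the support by one index on each side, exactly up to the rows [k]
   and [k + n + 1]. *)
have out2 r : (r < k) || (k + n.+2%:Z <= r) -> sqv (op_sub (tri_ell2 A) l X) r = 0.
  move=> out; rewrite /sqv -[_ r]/(tri_op A x r - l *: x r) /tri_op.
  rewrite !x0 ?mulmx0 ?scaler0 ?addr0 ?subr0 ?vnorm0 ?expr0n//; rewrite /outside; lia.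
by have [_ ->] := psum_support (sqv_ge0 _) out2.
Qed.

End Sections.

(** * Gluing the lower bounds of all sections *)

Section Windows.
Variables (R : realType) (p : nat).
Local Notation N := (nrm (ell2_inner R p)).
Implicit Types (A : tridiag R p) (k : int) (l : R[i]).

(** Used to sum over all positions of the window: each term of [f] is met once for every [j], so it
    gets the total weight of [q]. *)
Lemma psum_comb (f : int -> R) (m : nat) (q : nat -> R) (z : nat -> int) :
  (forall r, 0 <= f r) -> summableR f -> (forall j, 0 <= q j) ->
  summableR (fun k => \sum_(j < m) q j * f (k + z j)) /\
  psum (fun k => \sum_(j < m) q j * f (k + z j)) = (\sum_(j < m) q j) * psum f.
Proof.
move=> f0 sf q0; elim: m => [|m [IH1 IH2]].
  rewrite (_ : (fun k => _) = fun=> 0); last first.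
    by apply/funext => k; rewrite big_ord0.
  by rewrite /psum /summableR /esumR esum1// big_ord0 mul0r ltry.
have s0 r : 0 <= f (r + z m) by [].
have ss : summableR (fun r => f (r + z m)) by rewrite summableR_shift.
have t0 r : 0 <= q m * f (r + z m) by rewrite mulr_ge0.
have ts : summableR (fun r => q m * f (r + z m)) by exact: summableRZ.
have u0 k : 0 <= \sum_(j < m) q j * f (k + z j).
  by apply: sumr_ge0 => j _; rewrite mulr_ge0.
rewrite (_ : (fun k => _) =
  fun k => \sum_(j < m) q j * f (k + z j) + q m * f (k + z m)); last first.
  by apply/funext => k; rewrite big_ord_recr.
split; first exact: summableRD.
rewrite psumD// IH2 psumZ// psum_shift big_ord_recr /=; ring.
Qed.

(** Two convexity bounds: the one for [S + T] is weighted by [th], the one for [a u + g v] by [a]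
    and [g]. The latter weights add up to [(a + g) ^+ 2] after summation, whence the factor
    [amax + cmax] of [eps_star]. *)
Lemma sqr_le_weighted (t S T a g u v th : R) : 0 < th -> 0 <= a -> 0 <= g ->
  0 <= t <= S + T -> 0 <= S -> 0 <= T <= a * u + g * v ->
  t ^+ 2 <= (1 + th) * S ^+ 2 +
    (1 + th^-1) * (a + g) * a * u ^+ 2 + (1 + th^-1) * (a + g) * g * v ^+ 2.
Proof.
move=> th0 a0 g0 /andP[t0 tST] S0 /andP[T0 Tuv].
have e1 : t ^+ 2 <= (S + T) ^+ 2 by apply: lerXn2r; rewrite ?nnegrE ?addr_ge0.
have e2 : T ^+ 2 <= (a * u + g * v) ^+ 2.
  by apply: lerXn2r; rewrite ?nnegrE//; exact: le_trans Tuv.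
have e3 : (a * u + g * v) ^+ 2 <= (a + g) * (a * u ^+ 2 + g * v ^+ 2).
  have : 0 <= a * g * (u - v) ^+ 2 by rewrite mulr_ge0 ?sqr_ge0 ?mulr_ge0.
  rewrite !expr2; lra.
have e4 : (S + T) ^+ 2 <= (1 + th) * S ^+ 2 + (1 + th^-1) * T ^+ 2.
  have : 0 <= (th * S - T) ^+ 2 * th^-1 by rewrite mulr_ge0 ?sqr_ge0 ?invr_ge0 ?ltW.
  have -> : (th * S - T) ^+ 2 * th^-1 = th * S ^+ 2 - 2 * S * T + th^-1 * T ^+ 2.
    by field; rewrite gt_eqF.
  rewrite !expr2; lra.
have e5 : (1 + th^-1) * T ^+ 2 <= (1 + th^-1) * ((a + g) * (a * u ^+ 2 + g * v ^+ 2)).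
  by rewrite ler_wpM2l ?(le_trans e2)// addr_ge0// invr_ge0 ltW.
apply: (le_trans e1); apply: (le_trans e4); apply: (le_trans (lerD (lexx _) e5)).
by rewrite le_eqVlt; apply/orP; left; apply/eqP; ring.
Qed.

Section Row.
Variables (A : tridiag R p) (l : R[i]) (w : int -> R) (x : ell2T R p).
Let y := op_sub (tri_ell2 A) l x.

(** The last two terms are the commutator of [A] with multiplication by [w]. The diagonal commutes
    with it, so [bmax] does not enter [eps_star]. *)
Lemma windowed_row (r : int) (W := fun r => (w r)%:C *: x r) :
  tri_op A W r - l *: W r = (w r)%:C *: y r +
   ((w (r - 1) - w r)%:C *: (alpha A (r - 1) *m x (r - 1)) +
    (w (r + 1) - w r)%:C *: (gamma A (r + 1) *m x (r + 1))).
Proof.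
have -> : y r = tri_op A x r - l *: x r by [].
rewrite /tri_op /W.
rewrite -!scalemxAr !rmorphB /= !scalerBl !scalerBr !scalerDr.
move: (alpha A (r - 1) *m _) (beta A r *m _) (gamma A (r + 1) *m _) => a b c.
rewrite !scalerA [l * _]mulrC.
move: (w r)%:C (w (r - 1))%:C (w (r + 1))%:C => d e f.
apply/matrixP => i j; rewrite !mxE; ring.
Qed.

Lemma windowed_row_le (a g th : R) (r : int) (W := fun r => (w r)%:C *: x r) :
  0 < th -> 0 <= a -> 0 <= g -> mat_bound (alpha A) a -> mat_bound (gamma A) g ->
  vnorm (tri_op A W r - l *: W r) ^+ 2 <= (1 + th) * w r ^+ 2 * sqv y r +
    (1 + th^-1) * (a + g) * a * (w (r - 1) - w r) ^+ 2 * sqv x (r - 1) +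
    (1 + th^-1) * (a + g) * g * (w (r + 1) - w r) ^+ 2 * sqv x (r + 1).
Proof.
move=> th0 a0 g0 ha hg; rewrite windowed_row /sqv.
have nC (t : R) (v : 'cV[R[i]]_p) : vnorm (t%:C *: v) = `|t| * vnorm v.
  by rewrite vnormZ cmodC.
have sq (t : R) : t ^+ 2 = `|t| ^+ 2 by rewrite real_normK ?num_real.
rewrite (sq (w r)) (sq (w (r - 1) - w r)) (sq (w (r + 1) - w r)).
rewrite -!(mulrA _ (_ ^+ 2) (_ ^+ 2)) -!exprMn.
apply: (@sqr_le_weighted _ _
  (vnorm ((w (r - 1) - w r)%:C *: (alpha A (r - 1) *m x (r - 1)) +
    (w (r + 1) - w r)%:C *: (gamma A (r + 1) *m x (r + 1))))) => //.
- by rewrite vnorm_ge0/= -nC vnormD.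
- by rewrite mulr_ge0 ?vnorm_ge0.
- rewrite vnorm_ge0/=; apply: (le_trans (vnormD _ _)); rewrite !nC.
  by apply: lerD; rewrite mulrCA ler_wpM2l.
Qed.

End Row.

Lemma window_ends (n : nat) (r : int) : (0 <= r) && (r <= n.+1%:Z) ->
  (r <= 0) || (n.+1%:Z <= r) -> r = 0 \/ r = n.+1%:Z.
Proof. lia. Qed.

Lemma outside_sub (n : nat) k r :
  outside n k r -> (r - k <= 0) || (n.+1%:Z <= r - k).
Proof. rewrite /outside; lia. Qed.

(* Weighted Cauchy-Schwarz with parameter [th] separates the windowed image from the
   commutator; [th] is chosen so large that the commutator keeps a factor below [c]. *)
Lemma nu_sect_sup_le A (n : nat) l (a g c : R) : (0 < n)%N ->
  0 <= a -> 0 <= g -> mat_bound (alpha A) a -> mat_bound (gamma A) g ->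
  (a + g) * (22 / (7 * n.+1%:R)) < c ->
  (forall k, c <= nu (sect (mat A) n k - l *: sectI R p n)) ->
  exists2 d : R, 0 < d & bounded_below (ell2_inner R p) (op_sub (tri_ell2 A) l) d.
Proof.
move=> n0 a0 g0 ha hg kc hc.
have [s [s0 sn s1 sD]] := sin_window R n.
set kap := 22 / _ in kc sD; set D := \sum_(j < _) _ in sD; set S := \sum_(j < _) _ in sD.
have {}s1 : 0 < s 1%N by case: s1 => // n00; rewrite n00 in n0.
have S0 : 0 < S.
  have [m nE] : exists m, n.+1 = m.+2 by exists n.-1; rewrite prednK.
  rewrite /S nE !big_ord_recl /= s0 expr0n add0r ltr_wpDr ?exprn_gt0//.
  by apply: sumr_ge0 => j _; exact: sqr_ge0.
have kap0 : 0 <= kap by rewrite divr_ge0// mulr_ge0.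
have B0 : 0 <= (a + g) * kap by rewrite mulr_ge0// addr_ge0.
have c0 : 0 < c by exact: le_lt_trans kc.
(* Extended by 0, the window also vanishes at [0] and [n + 1]; translated by [k], it lives on the
   [n] columns of the section. *)
pose w (r : int) : R := if (0 <= r) && (r <= n.+1%:Z) then s (absz r) else 0.
have wn (j : nat) : (j <= n.+1)%N -> w j%:Z = s j.
  by move=> jn; rewrite /w lez_nat jn.
have w0 (r : int) : (r <= 0) || (n.+1%:Z <= r) -> w r = 0.
  rewrite /w; case: ifP => // h1 h2.
  by have [->|->] := window_ends h1 h2.
have W1 : \sum_(j < n) w (1 + j%:Z) ^+ 2 = S.
  rewrite /S big_ord_recl s0 expr0n add0r; apply: eq_bigr => j _.
  by rewrite -[1 + j%:Z]/(j.+1%:Z) wn // leqW.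
have W2 : \sum_(j < n.+2) w j%:Z ^+ 2 = S.
  rewrite big_ord_recr /= wn// sn expr0n addr0; apply: eq_bigr => j _.
  by rewrite wn// ltnW.
(* There is one row more than there are differences in [D]; the extra term lies between two zeros of
   [w], on the left here and on the right in [D2]. *)
have D1 : \sum_(j < n.+2) (w (j%:Z - 1) - w j%:Z) ^+ 2 = D.
  rewrite big_ord_recl /= !w0 ?subrr ?expr0n ?add0r//; apply: eq_bigr => j _.
  rewrite /bump /= (_ : (1 + j)%N%:Z - 1 = j%:Z); last by lia.
  by rewrite !wn ?add1n// 1?ltnW// -sqrrN opprB.
have D2 : \sum_(j < n.+2) (w (j%:Z + 1) - w j%:Z) ^+ 2 = D.
  rewrite big_ord_recr /= (w0 (n.+1%:Z + 1)) ?(w0 n.+1%:Z) ?lerDl ?lexx ?orbT//.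
  rewrite subrr expr0n addr0.
  apply: eq_bigr => j _; rewrite (_ : j%:Z + 1 = j.+1%:Z); last by lia.
  by rewrite !wn// ltnW.
pose B := (a + g) * kap.
have cB : 0 < c ^+ 2 - B ^+ 2 by rewrite subr_gt0 ltrXn2r// nnegrE// ltW.
(* Chosen to give [(1 + th^-1) B^2 <= (c^2 + B^2) / 2 < c^2]; the [+ 1] keeps [th] positive when
   [B = 0]. *)
pose th := (2 * (B ^+ 2 + 1)) / (c ^+ 2 - B ^+ 2).
have th0 : 0 < th by rewrite divr_gt0// mulr_gt0// ltr_wpDl ?sqr_ge0.
have thB : (1 + th^-1) * B ^+ 2 <= (c ^+ 2 + B ^+ 2) / 2.
  have : th^-1 * B ^+ 2 <= (c ^+ 2 - B ^+ 2) / 2.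
    rewrite /th invf_div; move: (c ^+ 2 - B ^+ 2) cB => E E0.
    rewrite mulrAC ler_pdivrMr; last by rewrite mulr_gt0// ltr_wpDl ?sqr_ge0.
    lra.
  lra.
(* The squared section inequality at position [k], summed over all [k]. Its four sums are
   combinations of shifts of [sqv x] or [sqv y], evaluated by [psum_comb]. *)
have key (x : ell2T R p) : c ^+ 2 * S * psum (sqv x) <=
    (1 + th) * S * psum (sqv (op_sub (tri_ell2 A) l x)) +
    (1 + th^-1) * (a + g) ^+ 2 * D * psum (sqv x).
  set y := op_sub (tri_ell2 A) l x.
  have sx := ell2TP x; have sy := ell2TP y.
  have q0 (j : nat) : 0 <= c ^+ 2 * w (1 + j%:Z) ^+ 2 by rewrite mulr_ge0 ?sqr_ge0.
  have q1 (j : nat) : 0 <= (1 + th) * w j%:Z ^+ 2.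
    by rewrite mulr_ge0 ?sqr_ge0// addr_ge0// ltW.
  have thV : 0 <= (1 + th^-1) * (a + g).
    by apply: mulr_ge0; rewrite addr_ge0// invr_ge0 ltW.
  have q2 (j : nat) : 0 <= (1 + th^-1) * (a + g) * a * (w (j%:Z - 1) - w j%:Z) ^+ 2.
    by rewrite mulr_ge0 ?sqr_ge0// mulr_ge0.
  have q3 (j : nat) : 0 <= (1 + th^-1) * (a + g) * g * (w (j%:Z + 1) - w j%:Z) ^+ 2.
    by rewrite mulr_ge0 ?sqr_ge0// mulr_ge0.
  have [f0 e0] := psum_comb n (fun j => 1 + j%:Z) (sqv_ge0 x) sx q0.
  have [f1 e1] := psum_comb n.+2 (fun j => j%:Z) (sqv_ge0 y) sy q1.
  have [f2 e2] := psum_comb n.+2 (fun j => j%:Z - 1) (sqv_ge0 x) sx q2.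
  have [f3 e3] := psum_comb n.+2 (fun j => j%:Z + 1) (sqv_ge0 x) sx q3.
  rewrite -!mulr_sumr W1 in e0; rewrite -!mulr_sumr W2 in e1.
  rewrite -!mulr_sumr D1 in e2; rewrite -!mulr_sumr D2 in e3.
  have sum0 (m : nat) (q : nat -> R) (z : nat -> int) (f : int -> R) :
      (forall j, 0 <= q j) -> (forall r, 0 <= f r) ->
      forall k, 0 <= \sum_(j < m) q j * f (k + z j).
    by move=> qq ff k; apply: sumr_ge0 => j _; rewrite mulr_ge0.
  have p0 := sum0 n _ (fun j => 1 + j%:Z) _ q0 (sqv_ge0 x).
  have p1 := sum0 n.+2 _ (fun j => j%:Z) _ q1 (sqv_ge0 y).
  have p2 := sum0 n.+2 _ (fun j => j%:Z - 1) _ q2 (sqv_ge0 x).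
  have p3 := sum0 n.+2 _ (fun j => j%:Z + 1) _ q3 (sqv_ge0 x).
  have f12 := summableRD p1 p2 f1 f2.
  have p12 k := addr_ge0 (p1 k) (p2 k).
  have f123 := summableRD p12 p3 f12 f3.
  have -> : (1 + th) * S * psum (sqv y) + (1 + th^-1) * (a + g) ^+ 2 * D * psum (sqv x) =
    (1 + th) * S * psum (sqv y) + (1 + th^-1) * (a + g) * a * D * psum (sqv x) +
    (1 + th^-1) * (a + g) * g * D * psum (sqv x) by ring.
  rewrite -e0 -e1 -e2 -e3 -(psumD p1 p2 f1 f2) -(psumD p12 p3 f12 f3).
  apply: le_psum => // k.
  have kE (z : int) : k + z - k = z by rewrite addrC addKr.
  pose W r : 'cV[R[i]]_p := (w (r - k))%:C *: x r.
  have Wout r : outside n k r -> W r = 0.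
    by move=> /outside_sub out; rewrite /W (w0 _ out) scale0r.
  have h1 : c ^+ 2 * vnorm (window n k W) ^+ 2 <=
      vnorm ((sect (mat A) n k - l *: sectI R p n) *m window n k W) ^+ 2.
    rewrite -exprMn; apply: lerXn2r; [|exact: vnorm_ge0|].
      exact: mulr_ge0 (ltW c0) (vnorm_ge0 _).
    by apply: le_trans (nu_mul_le _ _); apply: ler_wpM2r (hc k); exact: vnorm_ge0.
  rewrite (sect_window A l Wout) !vnorm_mxcol in h1.
  have h2 : \sum_(j < n) c ^+ 2 * w (1 + j%:Z) ^+ 2 * sqv x (k + (1 + j%:Z)) =
      c ^+ 2 * \sum_(j < n) vnorm (W (k + 1 + j%:Z)) ^+ 2.
    rewrite mulr_sumr; apply: eq_bigr => j _; rewrite -mulrA; congr (_ * _).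
    rewrite /W vnormZ cmodC exprMn real_normK ?num_real//.
    by rewrite -(addrA k 1) kE.
  rewrite h2; apply: (le_trans h1); rewrite -!big_split /=; apply: ler_sum => j _.
  have : vnorm (tri_op A W (k + j%:Z) - l *: W (k + j%:Z)) ^+ 2 <= _ :=
    @windowed_row_le A l (fun r => w (r - k)) x a g th (k + j%:Z) th0 a0 g0 ha hg.
  have -> : tri_op A x - l *: (x : int -> _) = y by [].
  move: (vnorm _ ^+ 2) => t.
  by rewrite -/y -(addrA k j%:Z 1) -(addrA k j%:Z (-1)) !kE.
(* What is left of [c ^+ 2] after the commutator has been absorbed. *)
pose e := (c ^+ 2 - B ^+ 2) / 2.
have e0 : 0 < e by rewrite divr_gt0.
have th1 : 0 < 1 + th by rewrite ltr_wpDl.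
exists (Num.sqrt (e / (1 + th))); first by rewrite sqrtr_gt0 divr_gt0.
move=> x; rewrite -(ler_pXn2r (n:=2)) ?nnegrE ?mulr_ge0 ?sqrtr_ge0 ?nrm_ge0//.
have eth : 0 <= e / (1 + th) by rewrite divr_ge0// ltW.
rewrite exprMn (sqr_sqrtr eth) !ell2_nrm_sqr.
have P0 : 0 <= psum (sqv x) by apply: psum_ge0; exact: sqv_ge0.
rewrite mulrAC ler_pdivrMr// [leRHS]mulrC -(ler_pM2r S0).
have := key x; set P := psum (sqv x) in P0 *; set Q := psum _.
have h : (1 + th^-1) * (a + g) ^+ 2 * D * P <= (c ^+ 2 + B ^+ 2) / 2 * S * P.
  apply: (ler_wpM2r P0).
  have thV : 0 <= 1 + th^-1 by rewrite addr_ge0// invr_ge0 ltW.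
  have sD' : (a + g) ^+ 2 * D <= B ^+ 2 * S.
    rewrite /B exprMn -(mulrA _ (kap ^+ 2)); exact: (ler_wpM2l (sqr_ge0 _) sD).
  have := ler_wpM2l thV sD'; rewrite (mulrA _ _ D) (mulrA _ _ S) => /le_trans; apply.
  exact: (ler_wpM2r (ltW S0) thB).
move=> h'; rewrite /e; lra.
Qed.

End Windows.

(** * Approximation of the spectrum *)

Section GridRounding.
Variable R : realType.

(** Rounding toward zero can cost a full unit but never increases the modulus, so rounded points
    stay in the disc. *)
Lemma truncate_toward_zero (t : R) :
  exists a : int, `|a%:~R| <= `|t| /\ `|a%:~R - t| <= 1.
Proof.
have pos (u : R) : 0 <= u -> exists a : int, `|a%:~R| <= u /\ `|a%:~R - u| <= 1.
  move=> u0; exists (Num.floor u).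
  have h1 := floor_le u; have h2 := lt_succ_floor u.
  have h0 : 0 <= (Num.floor u)%:~R :> R by rewrite ler0z floor_ge0.
  by split; [rewrite ger0_norm|rewrite ler_norml; apply/andP; split; lra].
have [t0|t0] := leP 0 t; first by have [a ?] := pos t t0; exists a; rewrite (ger0_norm t0).
have [|a [a1 a2]] := pos (- t); first by rewrite oppr_ge0 ltW.
exists (- a); rewrite rmorphN /= normrN (ltr0_norm t0); split=> //.
by rewrite -normrN opprD opprK; move: a2; rewrite opprK.
Qed.

Lemma grid_mem (n : nat) (r : R) (a b : int) (z := Complex (a%:~R / n%:R) (b%:~R / n%:R) : R[i]) :
  z = 0 \/ cmod z < r -> Grid n r z.
Proof.
move=> h; split; first by exists a, b.
case: h => [->|zr].
  exists 0; last by rewrite mulr0.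
  by rewrite /= expr0n addr0 sqrtr0.
have r0 : 0 < r by exact: le_lt_trans (cmod_ge0 z) zr.
exists (r^-1%:C * z).
  by change (cmod (r^-1%:C * z) < 1); rewrite cmodM cmodC gtr0_norm ?invr_gt0// ltr_pdivrMl// mulr1.
by rewrite mulrA -rmorphM mulfV ?gt_eqF// rmorph1 mul1r.
Qed.

Lemma grid_cmod (n : nat) (r : R) (z : R[i]) : 0 <= r -> Grid n r z -> cmod z <= r.
Proof.
move=> r0 [_ [u /= u1 <-]]; rewrite cmodM cmodC ger0_norm//.
by rewrite ler_piMr// ltW.
Qed.

(* Shrinking [l] slightly first makes the truncation land strictly inside the disc. *)
Lemma grid_approx (n : nat) (r : R) (l : R[i]) : (0 < n)%N -> cmod l <= r ->
  exists2 z, Grid n r z & cmod (z - l) <= (3 / 2) / n%:R.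
Proof.
move=> n0 lr; have n0' : 0 < n%:R :> R by rewrite ltr0n.
have r0 : 0 <= r by exact: le_trans (cmod_ge0 _) lr.
(* Multiplying by [1 - e] moves [l] by at most [e * r <= 1 / (20 n)]; [r + 1] keeps the denominator
   positive when [r = 0]. *)
pose e : R := (20 * n%:R * (r + 1))^-1.
have r1 : 1 <= r + 1 by rewrite lerDr.
have n1 : 1 <= n%:R :> R by rewrite ler1n.
have d0 : 0 < 20 * n%:R * (r + 1) :> R by rewrite !mulr_gt0//; lra.
have e0 : 0 < e by rewrite invr_gt0.
have e1 : e < 1.
  rewrite invf_lt1//; have : n%:R <= n%:R * (r + 1) by rewrite ler_pMr.
  lra.
pose m := (1 - e)%:C * l.
have ml : cmod (m - l) <= (20 * n%:R)^-1.
  have -> : m - l = (- e)%:C * l by rewrite /m rmorphB rmorph1 rmorphN; ring.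
  rewrite cmodM cmodC normrN gtr0_norm//.
  apply: (le_trans (ler_wpM2l (ltW e0) lr)).
  have r10 : 0 < r + 1 by lra.
  have -> : e * r = (20 * n%:R)^-1 * (r / (r + 1)).
    by rewrite /e; field; rewrite !gt_eqF.
  rewrite ler_piMr ?invr_ge0 ?mulr_ge0//.
  by rewrite ler_pdivrMr// mul1r lerDl.
have mr : m = 0 \/ cmod m < r.
  have [l0|l0] := eqVneq l 0; first by left; rewrite /m l0 mulr0.
  right; rewrite cmodM cmodC gtr0_norm ?subr_gt0//.
  have : 0 < cmod l.
    rewrite lt_def cmod_ge0 andbT; apply: contra_neq l0.
    exact: ComplexField.Normc.eq0_normc.
  move=> l0'; apply: lt_le_trans lr; rewrite gtr_pMl// gtrBl//.
have [a [a1 a2]] := truncate_toward_zero (n%:R * complex.Re m).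
have [b [b1 b2]] := truncate_toward_zero (n%:R * complex.Im m).
pose z : R[i] := Complex (a%:~R / n%:R) (b%:~R / n%:R).
have part (t : R) (j : int) : `|j%:~R| <= `|n%:R * t| -> `|j%:~R - n%:R * t| <= 1 ->
    `|j%:~R / n%:R| <= `|t| /\ `|j%:~R / n%:R - t| <= n%:R^-1.
  rewrite !normrM (gtr0_norm n0') => h1 h2; split.
    by rewrite normrV ?unitfE ?gt_eqF// (gtr0_norm n0') ler_pdivrMr// mulrC.
  have -> : j%:~R / n%:R - t = (j%:~R - n%:R * t) / n%:R by field; rewrite gt_eqF.
  by rewrite normrM normfV (gtr0_norm n0') ler_piMl// invr_ge0 ltW.
have [p1 p2] := part _ _ a1 a2; have [q1 q2] := part _ _ b1 b2.
have sq (s t : R) : `|s| <= `|t| -> s ^+ 2 <= t ^+ 2.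
  by move=> h; rewrite -[s ^+ 2]real_normK ?num_real// -[t ^+ 2]real_normK ?num_real// lerXn2r.
have zm : cmod z <= cmod m.
  by rewrite /z; case: (m) p1 q1 => u v /= p1 q1; rewrite ler_wsqrtr// lerD// sq.
exists z.
  apply: grid_mem; case: mr => [m0|mr]; last by right; exact: le_lt_trans mr.
  left; apply: ComplexField.Normc.eq0_normc; apply/eqP; rewrite eq_le cmod_ge0 andbT.
  by move: zm; rewrite m0 /= expr0n addr0 sqrtr0.
have -> : z - l = (z - m) + (m - l) by rewrite addrA subrK.
apply: (le_trans (le_cmodD _ _)).
(* Each coordinate is off by at most [1 / n], and [(29 / 20)^2 >= 2]. Together with the [1 / 20]
   spent on shrinking this makes [3 / 2]. *)
have zm2 : cmod (z - m) <= (29 / 20) / n%:R.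
  have n20 : 0 <= (29 / 20) / n%:R :> R by rewrite divr_ge0// ltW.
  rewrite -(ler_pXn2r (n:=2)) ?nnegrE ?cmod_ge0//.
  have -> : cmod (z - m) ^+ 2 = (a%:~R / n%:R - complex.Re m) ^+ 2 +
      (b%:~R / n%:R - complex.Im m) ^+ 2.
    by rewrite /z; case: (m) => u v /=; rewrite sqr_sqrtr// addr_ge0 ?sqr_ge0.
  have nV0 : 0 <= n%:R^-1 :> R by rewrite invr_ge0 ltW.
  have h1 : (a%:~R / n%:R - complex.Re m) ^+ 2 <= n%:R^-1 ^+ 2.
    by apply: sq; rewrite (ger0_norm nV0).
  have h2 : (b%:~R / n%:R - complex.Im m) ^+ 2 <= n%:R^-1 ^+ 2.
    by apply: sq; rewrite (ger0_norm nV0).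
  rewrite exprMn; have := sqr_ge0 (n%:R^-1 : R); move: (n%:R^-1 ^+ 2) h1 h2 => q *.
  lra.
apply: (le_trans (lerD zm2 ml)); rewrite invfM.
by move: (n%:R^-1) => q; lra.
Qed.

End GridRounding.

Lemma le_bigmin_exists (R : realType) (J : eqType) (s : seq J) (f : J -> R) (e : R) :
  (\big[Order.min/+oo]_(k <- s) (f k)%:E <= e%:E)%E <-> exists2 k, k \in s & f k <= e.
Proof.
elim: s => [|k s IH]; first by rewrite big_nil leye_eq; split => // -[].
rewrite big_cons ge_min lee_fin; split.
  case/orP => [fk|/IH [j js fj]]; first by exists k => //; rewrite mem_head.
  by exists j => //; rewrite in_cons js orbT.
move=> [j]; rewrite in_cons => /orP[/eqP ->|js] fj; first by rewrite fj.
by apply/orP; right; apply/IH; exists j.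
Qed.

Section SpectralApproximation.
Variables (R : realType) (p : nat).
Hypothesis p_gt0 : (0 < p)%N.
Local Notation E := (ell2_inner R p).
Local Notation N := (nrm (ell2_inner R p)).
Implicit Types (A : tridiag R p) (k : int) (l z : R[i]).

Definition approx_eig A (n : nat) k l : R :=
  Num.min (nu (sect (mat A) n k - l *: sectI R p n))
          (nu (sect (mat_adj A) n k - l *: sectI R p n)).

Lemma approx_eigP A (n : nat) k l (e : R) : approx_eig A n k l <= e <->
  nu (sect (mat A) n k - l *: sectI R p n) <= e \/
  nu (sect (mat_adj A) n k - l *: sectI R p n) <= e.
Proof.
rewrite /approx_eig; move: (nu _) (nu _) => u v.
by rewrite ge_min; split; move/orP.
Qed.

Lemma mat_trE A : mat (tri_tr A) = mat_adj A.
Proof. by apply/funext => i; apply/funext => j; exact: mat_tr. Qed.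

Lemma sum_dim_gt0 (n : nat) : (0 < n)%N -> (0 < \sum_(j < n) p)%N.
Proof. by move=> n0; rewrite sum_nat_const card_ord muln_gt0 n0. Qed.

Lemma vnorm_sectI_le (n : nat) (v : 'cV[R[i]]_(\sum_(j < n) p)) :
  vnorm (sectI R p n *m v) <= vnorm v.
Proof.
rewrite -[v]submxcolK /sectI mul_mxblock_mxrow.
rewrite -(ler_pXn2r (n:=2))// ?nnegrE ?vnorm_ge0// !vnorm_mxcol.
set u := submxcol v.
rewrite big_ord_recl big1 => [|j _]; last by rewrite mul0mx.
rewrite vnorm0 expr0n add0r big_ord_recr /= [X in _ + vnorm X ^+ 2]big1 => [|j _]; last first.
  by rewrite ifF ?mul0mx//; apply/eqP; rewrite /bump /=; have := ltn_ord j; lia.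
rewrite vnorm0 expr0n addr0; apply: ler_sum => i _.
rewrite (bigD1 i)//= ifT; last by rewrite /bump.
rewrite mul1mx big1 ?addr0// => j ji; rewrite ifF ?mul0mx//.
apply: contraNF ji; rewrite /bump /= => /eqP h.
by rewrite -val_eqE /=; apply/eqP; lia.
Qed.

Lemma nu_sect_near (b : int -> int -> 'M[R[i]]_p) (n : nat) j k l z : (0 < n)%N ->
  nu (sect b n j - z *: sectI R p n) <=
  nu (sect b n k - l *: sectI R p n) + (opnorm (sect b n k - sect b n j) + cmod (z - l)).
Proof.
move=> n0; apply: nu_near; first exact: sum_dim_gt0.
move=> v v1; set Sj := sect b n j; set Sk := sect b n k; set J := sectI R p n.
have -> : (Sj - z *: J - (Sk - l *: J)) = - (Sk - Sj) - (z - l) *: J.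
  by rewrite scalerBl !opprB; apply/matrixP => a c; rewrite !mxE; ring.
rewrite mulmxDl mulNmx; apply: (le_trans (vnormD _ _)); rewrite mulNmx.
have vN m (u : 'cV[R[i]]_m) : vnorm (- u) = vnorm u by rewrite !vnormE nrmN.
rewrite !vN; apply: lerD; first by apply: vnorm_le_opnorm; rewrite v1.
rewrite -scalemxAl vnormZ; apply: ler_piMr (cmod_ge0 _) _.
by rewrite -v1; exact: vnorm_sectI_le.
Qed.

Lemma tri_tr_alpha A (c : R) : 0 <= c -> mat_bound (gamma A) c ->
  mat_bound (alpha (tri_tr A)) c.
Proof. by move=> c0 h j v; exact: (vnorm_tr_mul_le c0 (h (j + 1))). Qed.

Lemma tri_tr_beta A (b : R) : 0 <= b -> mat_bound (beta A) b ->
  mat_bound (beta (tri_tr A)) b.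
Proof. by move=> b0 h j v; exact: (vnorm_tr_mul_le b0 (h j)). Qed.

Lemma tri_tr_gamma A (a : R) : 0 <= a -> mat_bound (alpha A) a ->
  mat_bound (gamma (tri_tr A)) a.
Proof. by move=> a0 h j v; exact: (vnorm_tr_mul_le a0 (h (j - 1))). Qed.

(** Beyond this radius the triangle inequality bounds [A - l] and its transpose below; transposition
    exchanges [a] and [c] and keeps the sum. *)
Lemma spec_bound A (a b c : R) l : 0 <= a -> 0 <= b -> 0 <= c ->
  mat_bound (alpha A) a -> mat_bound (beta A) b -> mat_bound (gamma A) c ->
  Spec A l -> cmod l <= a + b + c.
Proof.
move=> a0 b0 c0 ha hb hc sl; rewrite leNgt; apply/negP => labc.
have bb (B : tridiag R p) (a' b' c' : R) : 0 <= a' -> 0 <= b' -> 0 <= c' ->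
    mat_bound (alpha B) a' -> mat_bound (beta B) b' -> mat_bound (gamma B) c' ->
    bounded_below E (op_sub (tri_ell2 B) l) (cmod l - (a' + b' + c')).
  move=> a0' b0' c0' ha' hb' hc' x; rewrite op_subE mulrBl -nrmZ nrmBC.
  apply: le_trans (nrm_leB _ _ _); rewrite lerD2l lerN2.
  exact: (nrm_tri_ell2 x a0' b0' c0' ha' hb' hc').
suff : ~ Spec A l by apply.
apply/not_SpecP; exists (cmod l - (a + b + c)); first by rewrite subr_gt0.
split; first exact: bb.
have -> : a + b + c = c + b + a by ring.
exact: bb (tri_tr_alpha c0 hc) (tri_tr_beta b0 hb) (tri_tr_gamma a0 ha).
Qed.

(** The slack [e] is there because an infimum over all integer positions may not be attained; it
    also supplies the strict inequality of [nu_sect_sup_le]. *)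
Lemma spec_approx_eig A (n : nat) (a c e : R) l : (0 < n)%N -> 0 <= a -> 0 <= c ->
  mat_bound (alpha A) a -> mat_bound (gamma A) c -> Spec A l -> 0 < e ->
  exists k, approx_eig A n k l <= eps_star a c n + e.
Proof.
move=> n0 a0 c0 ha hc sl e0; apply: contrapT => /forallNP h.
have kc : (a + c) * (22 / (7 * n.+1%:R)) < eps_star a c n + e.
  by rewrite ltrDl.
have h' k : eps_star a c n + e <= nu (sect (mat A) n k - l *: sectI R p n) /\
    eps_star a c n + e <= nu (sect (mat_adj A) n k - l *: sectI R p n).
  have /negP := h k; rewrite /approx_eig; move: (nu _) (nu _) (_ + e) => u v w.
  by rewrite -ltNge lt_min => /andP[/ltW ? /ltW].
have h1 k := (h' k).1; have h2 k := (h' k).2; rewrite -mat_trE in h2.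
have [d1 d10 b1] := nu_sect_sup_le n0 a0 c0 ha hc kc h1.
rewrite [a + c]addrC in kc.
have [d2 d20 b2] := nu_sect_sup_le n0 c0 a0 (tri_tr_alpha c0 hc) (tri_tr_gamma a0 ha) kc h2.
suff : ~ Spec A l by apply.
apply/not_SpecP; exists (Num.min d1 d2); first by rewrite lt_min d10.
by split; [apply: bounded_belowW b1|apply: bounded_belowW b2];
  rewrite ge_min lexx ?orbT.
Qed.

Lemma approx_eig_ge A (n : nat) k l (c : R) : (0 < n)%N ->
  bounded_below E (op_sub (tri_ell2 A) l) c ->
  bounded_below E (op_sub (tri_ell2 (tri_tr A)) l) c -> c <= approx_eig A n k l.
Proof.
move=> n0 h1 h2; rewrite /approx_eig -mat_trE le_min; apply/andP; split.
  exact: (nu_sect_ge k (sum_dim_gt0 n0) h1).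
exact: (nu_sect_ge k (sum_dim_gt0 n0) h2).
Qed.

Lemma not_Spec_surj A l : ~ Spec A l ->
  forall y, exists x, op_sub (tri_ell2 A) l x = y.
Proof.
move=> /contrapT [B [[Bell _ _] _ TB]] y.
have By : B y \in @ell2p R p by apply/ell2pP/Bell/ell2TP.
by exists (MkEll2 By); apply: val_inj; exact: TB (ell2TP y).
Qed.

Lemma Spec_nonempty A : exists l, Spec A l.
Proof.
apply: contrapT => /forallNP h.
pose d (r : int) : 'cV[R[i]]_p := if r == 0 then const_mx 1 else 0.
have [sd _] : summableR (sqv d) /\ psum (sqv d) = \sum_(j < 1) sqv d (0 + j%:Z).
  apply: psum_support => [r|r out]; first exact: sqv_ge0.
  rewrite /sqv /d ifF ?vnorm0 ?expr0n//; lia.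
have dp : d \in @ell2p R p by apply/ell2pP.
have [m _ mA] := tri_ell2_bounded A.
have d0 : MkEll2 dp = 0.
  apply: (@spectrum_nonempty R _ E (tri_ell2 A) m (MkEll2 dp) mA) => l.
    by have /not_SpecP [c c0 [cT _]] := h l; exists c.
  exact: not_Spec_surj (h l).
have : d 0 = 0 by rewrite -[d]/(eseq (MkEll2 dp)) d0.
rewrite /d eqxx => /matrixP /(_ (Ordinal p_gt0) 0); rewrite !mxE => /eqP.
by rewrite oner_eq0.
Qed.

(** The alternative is locally stable: around a spectral point the first case persists, around any
    other point the second does with half the constant. Hence [disc_uniform] applies. *)
Lemma near_Spec A (r e : R) : 0 < e -> exists2 c : R, 0 < c &
  forall l, cmod l <= r -> (exists2 s, Spec A s & cmod (l - s) <= e) \/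
    bounded_below E (op_sub (tri_ell2 A) l) c /\
    bounded_below E (op_sub (tri_ell2 (tri_tr A)) l) c.
Proof.
move=> e0; apply: disc_uniform => l.
have [sl|/not_SpecP [c c0 [h1 h2]]] := pselect (Spec A l).
  by exists e => // w d /ltW wl _; left; exists l.
exists (c / 2); first by rewrite divr_gt0.
move=> w d wl /andP[d0 dc]; right.
split; [apply: (bounded_below_near h1)|apply: (bounded_below_near h2)]; lra.
Qed.

Variables (calA : tridiag R p -> nat -> {fset int}) (calB : tridiag R p -> R * R * R).
Hypotheses (calAP : is_index_map calA) (calBP : is_bound_map calB).
Variables (A : tridiag R p) (amax bmax cmax : R).
Hypothesis calBE : calB A = (amax, bmax, cmax).

Lemma bounds_ge0 : [/\ 0 <= amax, 0 <= bmax & 0 <= cmax].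
Proof.
have := calBP A; rewrite calBE => -[ha hb hc]; split.
- exact: le_trans (supnorm_ge0 (alpha_bounded A)) ha.
- exact: le_trans (supnorm_ge0 (beta_bounded A)) hb.
- exact: le_trans (supnorm_ge0 (gamma_bounded A)) hc.
Qed.

Lemma bounds_mat : [/\ mat_bound (alpha A) amax, mat_bound (beta A) bmax
  & mat_bound (gamma A) cmax].
Proof.
have := calBP A; rewrite calBE => -[ha hb hc]; split=> j v.
- by apply: (le_trans (supnorm_bound (alpha_bounded A) j v)); rewrite ler_wpM2r ?vnorm_ge0.
- by apply: (le_trans (supnorm_bound (beta_bounded A) j v)); rewrite ler_wpM2r ?vnorm_ge0.
- by apply: (le_trans (supnorm_bound (gamma_bounded A) j v)); rewrite ler_wpM2r ?vnorm_ge0.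
Qed.

Lemma Gamma_finP (n : nat) z : Gamma_fin calA calB A n z <->
  (exists2 k, k \in calA A n &
     approx_eig A n k z <= eps_star amax cmax n + 3%:R / n%:R) /\
  Grid n (amax + bmax + cmax) z.
Proof.
rewrite /Gamma_fin calBE; split=> -[h1 h2]; split=> //.
  by have /le_bigmin_exists [k kK hk] := h1; exists k.
by apply/le_bigmin_exists; case: h1 => k kK hk; exists k.
Qed.

(** The budget behind [3 / n]: a half for the unattained infimum, one for passing from [k] to an
    element of [K_n], three halves for the grid. *)
Lemma combine_slack (ep u v d q m : R) : 0 < m -> u <= ep + (1 / 2) / m ->
  v <= u + (d + q) -> d <= m^-1 -> q <= (3 / 2) / m -> v <= ep + 3 / m.
Proof.
move=> m0 h1 h2 h3 h4.
have -> : 3 / m = (1 / 2) / m + m^-1 + (3 / 2) / m by field; rewrite gt_eqF.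
lra.
Qed.

Lemma Spec_approx (n : nat) l : (0 < n)%N -> Spec A l ->
  exists2 z, Gamma_fin calA calB A n z & cmod (z - l) <= (3 / 2) / n%:R.
Proof.
move=> n0 sl; have [a0 b0 c0] := bounds_ge0; have [ha hb hc] := bounds_mat.
have n0' : 0 < n%:R :> R by rewrite ltr0n.
have lr := spec_bound a0 b0 c0 ha hb hc sl.
have [z gz zl] := grid_approx n0 lr.
exists z => //; apply/Gamma_finP; split=> //.
have e0 : 0 < (1 / 2) / n%:R :> R by rewrite divr_gt0.
have [k hk] := spec_approx_eig n0 a0 c0 ha hc sl e0.
have [j jK [j1 j2]] := calAP A n0 k; exists j => //.
have h1 := nu_sect_near (mat A) j k l z n0.
have h2 := nu_sect_near (mat_adj A) j k l z n0.
apply/approx_eigP; case/approx_eigP: hk => hk; [left|right].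
  exact: combine_slack n0' hk h1 j1 zl.
exact: combine_slack n0' hk h2 j2 zl.
Qed.

Lemma Gamma_fin_approx (e : R) : 0 < e -> \forall n \near \oo,
  forall z, Gamma_fin calA calB A n z -> exists2 s, Spec A s & cmod (z - s) <= e.
Proof.
move=> e0; have [a0 b0 c0] := bounds_ge0.
have r0 : 0 <= amax + bmax + cmax by rewrite !addr_ge0.
have [c cp hc] := near_Spec A (amax + bmax + cmax) e0.
(* Chosen so that the tolerance is at most [K / n], after [n + 1] is replaced by [n] in
   [eps_star]. *)
pose K := (amax + cmax) * (22 / 7) + 3.
have K0 : 0 < K by rewrite ltr_wpDl// mulr_ge0// addr_ge0.
have cK : 0 < c / K by rewrite divr_gt0.
have [m _ hm] := near_infty_natSinv_lt (PosNum cK).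
exists m.+1 => // n /= mn z /Gamma_finP [[k _ hk] gz].
have n0 : (0 < n)%N by exact: leq_trans mn.
have n0' : 0 < n%:R :> R by rewrite ltr0n.
have [//|[b1 b2]] := hc z (grid_cmod r0 gz).
have /le_trans/(_ hk) := approx_eig_ge k n0 b1 b2.
suff : eps_star amax cmax n + 3%:R / n%:R < c by lra.
have nK : n%:R^-1 < c / K.
  have := hm n.-1; rewrite /= prednK//; apply.
  by rewrite -ltnS prednK.
apply: le_lt_trans (_ : K / n%:R < c); last first.
  by move: nK; rewrite ltr_pdivlMr// mulrC.
have -> : K / n%:R = (amax + cmax) * (22 / (7 * n%:R)) + 3 / n%:R.
  by rewrite /K; field; rewrite gt_eqF.
rewrite /eps_star lerD2r; apply: ler_wpM2l; first by rewrite addr_ge0.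
apply: ler_wpM2l => //.
by rewrite lef_pV2 ?posrE ?mulr_gt0 ?ltr0n// ler_wpM2l// ler_nat.
Qed.

Lemma Spec_subset_Gamma_hat (n : nat) : (0 < n)%N -> Spec A `<=` Gamma_hat calA calB A n.
Proof.
move=> n0 l sl; have [z gz zl] := Spec_approx n0 sl.
exists z => //; exists (l - z); last by rewrite addrC subrK.
rewrite /= -cmodN opprB; apply: (le_trans zl).
by rewrite ler_wpM2r ?invr_ge0 ?ler0n//; lra.
Qed.

Lemma setdist_le z (S : set R[i]) s (e : R) : S s -> cmod (z - s) <= e ->
  (setdist z S <= e%:E)%E.
Proof.
move=> Ss zs; apply: (le_trans (ereal_inf_lbound _)); first by exists s.
by rewrite lee_fin.
Qed.

Lemma setdist_ge0 z (S : set R[i]) : (0 <= setdist z S)%E.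
Proof. by apply: le_ereal_inf_tmp => _ [s _ <-]; rewrite lee_fin cmod_ge0. Qed.

(** A point of [T] makes [dH] nonnegative; for two empty sets both suprema would be [-oo]. *)
Lemma dH_cvg0 (S : nat -> set R[i]) (T : set R[i]) : (exists t, T t) ->
  (forall e : R, 0 < e -> \forall n \near \oo,
    (forall s, S n s -> exists2 t, T t & cmod (s - t) <= e) /\
    (forall t, T t -> exists2 s, S n s & cmod (t - s) <= e)) ->
  dH (S n) T @[n --> \oo] --> (0 : \bar R)%E.
Proof.
move=> [t0 Tt0] h.
have ge0 n : (0 <= dH (S n) T)%E.
  rewrite /dH le_max; apply/orP; right.
  apply: le_trans (setdist_ge0 t0 (S n)) (ereal_sup_ubound _).
  by exists t0.
have le (e : R) : 0 < e -> \forall n \near \oo, (dH (S n) T <= e%:E)%E.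
  move=> /h; apply: filterS => n [h1 h2].
  rewrite /dH ge_max; apply/andP; split; apply: ge_ereal_sup => _ [s Ss <-].
    by have [t Tt st] := h1 s Ss; exact: setdist_le st.
  by have [t Tt st] := h2 s Ss; exact: setdist_le st.
apply/fine_cvgP; split.
  have := le 1 ltr01; apply: filterS => n h1.
  by rewrite ge0_fin_numE//; exact: le_lt_trans h1 (ltry _).
apply/cvgrPdist_le => e e0; have := le e e0; apply: filterS => n h1.
rewrite sub0r normrN /= ger0_norm ?fine_ge0// -lee_fin fineK//.
by rewrite ge0_fin_numE//; exact: le_lt_trans h1 (ltry _).
Qed.

Lemma near_inv_lt (c e : R) : 0 < c -> 0 < e ->
  \forall n \near \oo, (0 < n)%N /\ c / n%:R <= e.
Proof.
move=> c0 e0; have ec : 0 < e / c by rewrite divr_gt0.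
have [m _ hm] := near_infty_natSinv_lt (PosNum ec).
exists m.+1 => // n /= mn; have n0 : (0 < n)%N by exact: leq_trans mn.
split=> //; have := hm n.-1; rewrite /= prednK// => /(_ _)/ltW.
by rewrite ler_pdivlMr// mulrC; apply; rewrite -ltnS prednK.
Qed.

Lemma dH_Gamma_fin : dH (Gamma_fin calA calB A n) (Spec A) @[n --> \oo] --> (0 : \bar R)%E.
Proof.
apply: dH_cvg0 => [|e e0]; first exact: Spec_nonempty.
have c0 : 0 < 3 / 2 :> R by rewrite divr_gt0.
apply: filterS2 (Gamma_fin_approx e0) (near_inv_lt c0 e0) => n h1 [n0 h2].
split=> // t /(Spec_approx n0) [z gz zt]; exists z => //.
by rewrite -cmodN opprB; exact: le_trans h2.
Qed.

Lemma dH_Gamma_hat : dH (Gamma_hat calA calB A n) (Spec A) @[n --> \oo] --> (0 : \bar R)%E.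
Proof.
apply: dH_cvg0 => [|e e0]; first exact: Spec_nonempty.
have e2 : 0 < e / 2 by rewrite divr_gt0.
apply: filterS2 (Gamma_fin_approx e2) (near_inv_lt (ltr0n _ 2) e2) => n h1 [n0 h2].
split; last first.
  move=> t /(Spec_subset_Gamma_hat n0) ht; exists t => //.
  by rewrite subrr ComplexField.Normc.normc0 ltW.
move=> _ [z gz [w /= wn <-]]; have [s Ss zs] := h1 z gz; exists s => //.
have -> : z + w - s = (z - s) + w by ring.
by apply: (le_trans (le_cmodD _ _)); lra.
Qed.

End SpectralApproximation.

(** * Gaussian elimination *)

Section Elimination.
Variable R : realType.
Implicit Types (g h : nat -> nat -> R) (y : nat -> R).

(** Row and column [k] stay in place instead of being cleared: [qform k.+1] never reads them, and
    the program can work in place. *)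
Definition elim_step (k : nat) g (i j : nat) : R :=
  if (k < i)%N && (k < j)%N then g i j - g i k * g k j / g k k else g i j.

Fixpoint elim (k : nat) g : nat -> nat -> R :=
  if k is k'.+1 then elim_step k' (elim k' g) else g.

Definition pivots_pos (n : nat) g := [forall k : 'I_n, 0 < elim k g k k].

Definition qform (k n : nat) g y : R :=
  \sum_(k <= i < n) \sum_(k <= j < n) g i j * y i * y j.

Definition symmetric_on (n : nat) g := forall i j, (i < n)%N -> (j < n)%N -> g i j = g j i.

Lemma elim_step_sym n k g : (k < n)%N -> symmetric_on n g -> symmetric_on n (elim_step k g).
Proof.
move=> kn sg i j iN jN; rewrite /elim_step andbC; case: ifP => _; last exact: sg.
by rewrite (sg i j)// (sg i k)// (sg k j)// [g k i * _]mulrC.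
Qed.

(** Completing the square in [y k]; [elim_step] is the Schur complement of the pivot. *)
Lemma qform_step k n g y : (k < n)%N -> symmetric_on n g -> g k k != 0 ->
  let t := \sum_(k.+1 <= j < n) g k j / g k k * y j in
  qform k n g y = g k k * (y k + t) ^+ 2 + qform k.+1 n (elim_step k g) y.
Proof.
move=> kn sg gk0 t; rewrite /qform big_ltn// (big_ltn kn).
have tE : \sum_(k.+1 <= j < n) g k j * y j = g k k * t.
  by rewrite mulr_sumr; apply: eq_bigr => j _; field.
have e1 : \sum_(k.+1 <= j < n) g k j * y k * y j = y k * g k k * t.
  rewrite -mulrA -tE mulr_sumr; apply: eq_bigr => j _; ring.
rewrite e1.
have e2 : \sum_(k.+1 <= i < n) \sum_(k <= j < n) g i j * y i * y j =
   y k * g k k * t + \sum_(k.+1 <= i < n) \sum_(k.+1 <= j < n) g i j * y i * y j.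
  rewrite -e1 -big_split /= !big_nat; apply: eq_bigr => i /andP[ki iN].
  by rewrite big_ltn// (sg i k)//; congr (_ + _); ring.
rewrite e2.
have e3 : \sum_(k.+1 <= i < n) \sum_(k.+1 <= j < n) elim_step k g i j * y i * y j =
   \sum_(k.+1 <= i < n) \sum_(k.+1 <= j < n) g i j * y i * y j - g k k * t ^+ 2.
  have -> : g k k * t ^+ 2 = \sum_(k.+1 <= i < n) \sum_(k.+1 <= j < n)
      (g i k * g k j / g k k) * y i * y j.
    have -> : g k k * t ^+ 2 = t * \sum_(k.+1 <= j < n) g k j * y j.
      by rewrite tE; ring.
    rewrite {1}/t mulr_suml big_nat [RHS]big_nat; apply: eq_bigr => i /andP[ki iN].
    rewrite mulr_sumr; apply: eq_bigr => j _; rewrite (sg i k)//; field.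
    by [].
  rewrite -sumrB !big_nat; apply: eq_bigr => i /andP[ki iN].
  rewrite -sumrB !big_nat; apply: eq_bigr => j /andP[kj jN].
  by rewrite /elim_step ki kj /=; ring.
rewrite e3; ring.
Qed.

Lemma eq_qform k n g y y' : (forall i, (k <= i < n)%N -> y i = y' i) ->
  qform k n g y = qform k n g y'.
Proof.
move=> h; rewrite /qform !big_nat; apply: eq_bigr => i hi.
by rewrite !big_nat; apply: eq_bigr => j hj; rewrite !h.
Qed.

Lemma linear_form_bound (a : nat -> R) (k n : nat) : exists2 L, 0 <= L &
  forall y, (\sum_(k <= j < n) a j * y j) ^+ 2 <= L * \sum_(k <= j < n) y j ^+ 2.
Proof.
have [nk|kn] := leqP n k.
  by exists 0 => // y; rewrite !big_geq// expr0n mulr0.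
elim: n kn => // n IH; rewrite ltnS leq_eqVlt => /predU1P[<-|kn].
  exists (a k ^+ 2); first exact: sqr_ge0.
  by move=> y; rewrite !big_nat1 exprMn.
have [L L0 hL] := IH kn; exists (2 * L + 2 * a n ^+ 2).
  by rewrite addr_ge0// mulr_ge0// sqr_ge0.
move=> y; rewrite !big_nat_recr ?(ltnW kn)//=; have := hL y.
set S := \sum_(k <= j < n) a j * y j; set Q := \sum_(k <= j < n) y j ^+ 2 => hS.
have Q0 : 0 <= Q by apply: sumr_ge0 => j _; exact: sqr_ge0.
have h1 : 0 <= a n ^+ 2 * Q by rewrite mulr_ge0 ?sqr_ge0.
have h2 : 0 <= L * y n ^+ 2 by rewrite mulr_ge0 ?sqr_ge0.
have h3 : 0 <= (S - a n * y n) ^+ 2 by exact: sqr_ge0.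
have h4 : (S - a n * y n) ^+ 2 = S ^+ 2 - 2 * S * (a n * y n) + (a n * y n) ^+ 2 by ring.
have h5 : (S + a n * y n) ^+ 2 = S ^+ 2 + 2 * S * (a n * y n) + (a n * y n) ^+ 2 by ring.
have h6 : (a n * y n) ^+ 2 = a n ^+ 2 * y n ^+ 2 by ring.
rewrite h5 mulrDr !mulrDl -!mulrA; lra.
Qed.

(** A uniform gap [c] is carried instead of mere positivity, so that a strict lower bound on an
    infimum follows without compactness of the sphere. Elimination is written by [iteri] from [k],
    so that the induction can restart on the trailing block. *)
Lemma qform_pos m k n g : n = (k + m)%N -> symmetric_on n g ->
  (forall j, (k + j < n)%N -> 0 < iteri j (fun r h => elim_step (k + r) h) g (k + j)%N (k + j)%N) ->
  exists2 c, 0 < c & forall y, c * \sum_(k <= i < n) y i ^+ 2 <= qform k n g y.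
Proof.
elim: m k g => [|m IH] k g nE sg hp.
  by exists 1 => // y; rewrite /qform !big_geq ?mulr0 ?nE ?addn0.
have kn : (k < n)%N by rewrite nE addnS ltnS leq_addr.
have d0 : 0 < g k k by have := hp 0%N; rewrite addn0; apply.
have shift j : iteri j (fun r h => elim_step (k.+1 + r) h) (elim_step k g) =
    iteri j.+1 (fun r h => elim_step (k + r) h) g.
  elim: j => [|j IHj]; first by rewrite /= addn0.
  by rewrite iteriS IHj [RHS]iteriS addSnnS.
have [|||c c0 hc] := IH k.+1 (elim_step k g).
- by rewrite nE addSnnS.
- exact: elim_step_sym.
- by move=> j jn; rewrite shift addSnnS; apply: hp; rewrite -addSnnS.
have [L L0 hL] := linear_form_bound (fun j => g k j / g k k) k.+1 n.
(* From [y_k^2 <= 2 (y_k + t)^2 + 2 L Y]: the first entry lets the pivot absorb the square, the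
   second lets [c] absorb [(2 L + 1) Y]. *)
pose c1 := Num.min (g k k / 2) (c / (2 * L + 1)).
have L1 : 0 < 2 * L + 1 by rewrite ltr_wpDl// mulr_ge0.
have c10 : 0 < c1 by rewrite lt_min !divr_gt0.
have c1d : c1 <= g k k / 2 by rewrite ge_min lexx.
have c1c : c1 * (2 * L + 1) <= c by rewrite -ler_pdivlMr// ge_min lexx orbT.
exists c1 => // y; rewrite (qform_step y kn sg (lt0r_neq0 d0)).
have := hc y; have := hL y; rewrite (big_ltn kn) /=.
set t := \sum_(k.+1 <= j < n) g k j / g k k * y j.
set Y := \sum_(k.+1 <= i < n) y i ^+ 2; set Q := qform _ _ _ _ => htL hcQ.
have Y0 : 0 <= Y by apply: sumr_ge0 => j _; exact: sqr_ge0.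
have h1 : y k ^+ 2 <= 2 * (y k + t) ^+ 2 + 2 * t ^+ 2.
  have : 0 <= (y k + 2 * t) ^+ 2 by exact: sqr_ge0.
  rewrite !expr2; lra.
have h2 : c1 * y k ^+ 2 <= c1 * (2 * (y k + t) ^+ 2 + 2 * (L * Y)).
  rewrite ler_pM2l//; lra.
have h3 : c1 * (2 * (y k + t) ^+ 2) <= g k k * (y k + t) ^+ 2.
  rewrite mulrA ler_wpM2r ?sqr_ge0//; lra.
have h4 : c1 * (2 * L + 1) * Y <= c * Y by rewrite ler_wpM2r.
rewrite mulrDr; lra.
Qed.

(** At the first bad pivot a coordinate vector is a witness. Going back, each earlier coordinate is
    set to [- t], which kills the completed square. *)
Lemma qform_nonpos m k n g j : n = (k + m)%N -> symmetric_on n g -> (k + j < n)%N ->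
  iteri j (fun r h => elim_step (k + r) h) g (k + j)%N (k + j)%N <= 0 ->
  (forall j', (j' < j)%N ->
     0 < iteri j' (fun r h => elim_step (k + r) h) g (k + j')%N (k + j')%N) ->
  exists y, (exists2 i, (k <= i < n)%N & y i != 0) /\ qform k n g y <= 0.
Proof.
elim: m k g j => [|m IH] k g j nE sg jn hj hp.
  by move: jn; rewrite nE addn0 ltnNge leq_addr.
have kn : (k < n)%N by rewrite nE addnS ltnS leq_addr.
case: j => [|j] in jn hj hp *.
  exists (fun i => (i == k)%:R); split; first by exists k; rewrite ?leqnn ?eqxx ?oner_eq0.
  rewrite addn0 /= in hj; rewrite /qform big_ltn// (big_ltn kn).
  rewrite [X in _ + X + _]big_nat [X in _ + X + _]big1 => [|i /andP[ki _]]; last first.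
    by rewrite (gtn_eqF ki) mulr0.
  rewrite [X in _ + X]big_nat big1 => [|i /andP[ki _]]; last first.
    by rewrite big1// => i' _; rewrite (gtn_eqF ki) mulr0 mul0r.
  by rewrite eqxx !mulr1 !addr0.
have d0 : 0 < g k k by have := hp 0%N; rewrite addn0; apply.
have shift j' : iteri j' (fun r h => elim_step (k.+1 + r) h) (elim_step k g) =
    iteri j'.+1 (fun r h => elim_step (k + r) h) g.
  elim: j' => [|j' IHj]; first by rewrite /= addn0.
  by rewrite iteriS IHj [RHS]iteriS addSnnS.
have [|||||y [[i0 /andP[ki0 i0n] yi0] yQ]] := IH k.+1 (elim_step k g) j.
- by rewrite nE addSnnS.
- exact: elim_step_sym.
- by rewrite addSnnS.
- by rewrite shift addSnnS.
- by move=> j' jj'; rewrite shift addSnnS; apply: hp.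
pose t := \sum_(k.+1 <= j < n) g k j / g k k * y j.
exists (fun i => if i == k then - t else y i); split.
  by exists i0; rewrite ?(ltnW ki0)// gtn_eqF.
rewrite (qform_step _ kn sg (lt0r_neq0 d0)) eqxx.
have -> : \sum_(k.+1 <= i < n) g k i / g k k * (if i == k then - t else y i) = t.
  by rewrite /t !big_nat; apply: eq_bigr => i /andP[ki _]; rewrite gtn_eqF.
rewrite addNr expr0n mulr0 add0r (@eq_qform _ _ _ _ y)// => i /andP[ki _].
by rewrite gtn_eqF.
Qed.

Lemma elim_iteri k g : elim k g = iteri k (fun r h => elim_step (0 + r) h) g.
Proof. by elim: k => // k IH; rewrite iteriS /= IH. Qed.

Lemma pivots_posP n g : symmetric_on n g ->
  if pivots_pos n g then exists2 c, 0 < c & forall y,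
      c * \sum_(0 <= i < n) y i ^+ 2 <= qform 0 n g y
  else exists y, (exists2 i, (i < n)%N & y i != 0) /\ qform 0 n g y <= 0.
Proof.
move=> sg; case: ifP => [/forallP h|/negbT].
  apply: (@qform_pos n) => // j jn; rewrite -elim_iteri add0n in jn *.
  exact: h (Ordinal jn).
rewrite negb_forall => /existsP ex.
have ex' : exists k, (k < n)%N && (elim k g k k <= 0).
  by case: ex => k hk; exists k; rewrite ltn_ord leNgt.
case: (ex_minnP ex') => k /andP[kn hk] kmin.
have [|j' jk|y [[i ni yi] hy]] := @qform_nonpos n 0 n g k (erefl n) sg kn.
- by rewrite -elim_iteri.
- rewrite -elim_iteri add0n ltNge; apply/negP => h.
  by have := kmin j'; rewrite h (ltn_trans jk kn) leqNgt jk => /(_ isT).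
by exists y; split=> //; exists i.
Qed.

End Elimination.

(** * The program *)

Section ProgramLogic.
Variable R : realType.
Implicit Types (s t u : state R) (c d : cmd) (Q : state R -> Prop).

(** Total correctness: a derivation of [exec] is finite, so this includes halting. With the
    postcondition as a continuation, specifications compose through [runs_seq]. *)
Definition runs c s Q := exists2 t, exec c s t & Q t.

Lemma runs_conseq c s Q Q' : (forall t, Q t -> Q' t) -> runs c s Q -> runs c s Q'.
Proof. by move=> h [t et /h qt]; exists t. Qed.

Lemma runs_skip s Q : Q s -> runs Skip s Q.
Proof. by exists s => //; constructor. Qed.

Lemma runs_iset s v e Q : Q (set_reg s v (ieval s e)) -> runs (ISet v e) s Q.
Proof. by eexists; [constructor|]. Qed.

Lemma runs_rset s a i e Q : Q (Defs.set_mem s a (ieval s i) (reval s e)) -> runs (RSet a i e) s Q.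
Proof. by eexists; [constructor|]. Qed.

Lemma runs_emit s x y Q : Q (emit s (Complex (reval s x) (reval s y))) -> runs (Emit x y) s Q.
Proof. by eexists; [constructor|]. Qed.

Lemma runs_seq c d s Q : runs c s (fun t => runs d t Q) -> runs (Seq c d) s Q.
Proof. by move=> [t et [u eu qu]]; exists u => //; exact: exec_seq et eu. Qed.

Lemma runs_if b c d s Q : (if teval s b then runs c s Q else runs d s Q) ->
  runs (If b c d) s Q.
Proof.
case: ifPn => hb [t et qt]; exists t => //; [exact: exec_if_true|exact: exec_if_false].
Qed.

(** The invariant is indexed by the number of completed turns, and the total [n] is fixed
    beforehand; this gives termination. *)
Lemma runs_while (Inv : nat -> state R -> Prop) (n : nat) b c s Q :
  Inv 0%N s -> (forall i t, (i < n)%N -> Inv i t -> teval t b /\ runs c t (Inv i.+1)) ->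
  (forall t, Inv n t -> ~~ teval t b /\ Q t) -> runs (While b c) s Q.
Proof.
move=> h0 hs hn.
suff [m mE] : exists m, n = (0 + m)%N.
  move: mE h0; move: 0%N s; elim: m => [|m IH] i s nE hi.
    have [nb q] : ~~ teval s b /\ Q s by apply: hn; rewrite nE addn0.
    by exists s => //; exact: exec_while_end.
  have iN : (i < n)%N by rewrite nE addnS ltnS leq_addr.
  have [tb [t et ht]] := hs i s iN hi.
  have [u eu qu] := IH i.+1 t (etrans nE (esym (addSnnS i m))) ht.
  by exists u => //; exact: exec_while_step eu.
by exists n.
Qed.

Definition For (v : nat) (e : iexp) (c : cmd) : cmd :=
  Seq (ISet v (INat 0))
    (While (ILt (IReg v) e) (Seq c (ISet v (IAdd (IReg v) (INat 1))))).

(** The bound [e] is evaluated anew at every turn, hence the premise that it keeps the value [n];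
    the body must leave the counter as it found it. *)
Lemma runs_for (Inv : nat -> state R -> Prop) (n : nat) v e c s Q :
  Inv 0%N (set_reg s v 0) ->
  (forall i t, (i < n)%N -> Inv i t -> ireg t v = i ->
    runs c t (fun u => ireg u v = i /\ Inv i.+1 (set_reg u v i.+1))) ->
  (forall i t, Inv i t -> ireg t v = i -> ieval t e = n) ->
  (forall t, Inv n t -> ireg t v = n -> Q t) ->
  runs (For v e c) s Q.
Proof.
move=> h0 hs he hn; apply/runs_seq/runs_iset => /=.
apply: (@runs_while (fun i t => Inv i t /\ ireg t v = i) n) => /=.
- by split; rewrite /= ?eqxx.
- move=> i t iN [hi ti]; rewrite ti (he i t hi ti); split=> //.
  apply: runs_seq; apply: runs_conseq (hs i t iN hi ti) => u [ui hu].
  by apply: runs_iset; rewrite /= ui addn1 eqxx.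
- move=> t [hi ti]; rewrite ti (he n t hi ti) ltnn; split=> //; exact: hn.
Qed.

(* [agree V As s t]: only the registers in [V] and the arrays in [As] may differ. *)
Definition agree (V As : seq nat) s t : Prop :=
  (forall w, w \notin V -> ireg t w = ireg s w) /\
  (forall b i, b \notin As -> cell t b i = cell s b i).

Lemma agree_refl V As s : agree V As s s.
Proof. by []. Qed.

Lemma agree_trans V As t s u : agree V As s t -> agree V As t u -> agree V As s u.
Proof.
move=> [h1 h2] [h3 h4]; split=> [w wV|b i bA]; first by rewrite h3// h1.
by rewrite h4// h2.
Qed.

Lemma agree_sub V As V' As' s t : {subset V <= V'} -> {subset As <= As'} ->
  agree V As s t -> agree V' As' s t.
Proof.
move=> hV hA [h1 h2]; split=> [w|b i] h.
  by apply: h1; apply: contra h; exact: hV.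
by apply: h2; apply: contra h; exact: hA.
Qed.

Lemma agree_set_reg V As s t v k : v \in V -> agree V As s t ->
  agree V As s (set_reg t v k).
Proof.
move=> vV [h1 h2]; split=> // w wV /=; rewrite h1//.
by case: eqP => // wv; rewrite wv vV in wV.
Qed.

Lemma agree_set_mem V As s t a k x : a \in As -> agree V As s t ->
  agree V As s (Defs.set_mem t a k x).
Proof.
move=> aA [h1 h2]; split=> // b i bA /=; rewrite h2//.
by case: eqP => //= ba; rewrite ba aA in bA.
Qed.

(* Filling an I x J block of array [a] (row stride [S]), possibly in place. *)
Definition Fill (v : nat) (eI : iexp) (w : nat) (eJ : iexp) (c : cmd) : cmd :=
  For v eI (For w eJ c).

Lemma pair_index_inj (S i j i' j' : nat) : (j < S)%N -> (j' < S)%N ->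
  (i * S + j = i' * S + j')%N -> i = i' /\ j = j'.
Proof.
move=> jS jS' e; have S0 : (0 < S)%N by exact: leq_ltn_trans jS.
have ei : i = i'.
  by rewrite -(addn0 i) -(divn_small jS) -divnMDl// e divnMDl// divn_small// addn0.
by split=> //; apply/eqP; rewrite -(eqn_add2l (i * S)) e ei.
Qed.

(** The body may rely on the exact state of the sweep: cells before [(i, j)] in row order hold [F],
    the others their old values. The bound [J <= S] keeps the cells of distinct pairs distinct. *)
Lemma runs_fill (V As : seq nat) (a S I J v w : nat) (eI eJ : iexp) (c : cmd)
    (F : nat -> nat -> R) s Q :
  v != w -> v \in V -> w \in V -> (J <= S)%N ->
  (forall t, agree V As s t -> ieval t eI = I /\ ieval t eJ = J) ->
  (forall i j t, (i < I)%N -> (j < J)%N -> agree V As s t -> outp t = outp s ->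
    ireg t v = i -> ireg t w = j ->
    (forall i' j', (i' < I)%N -> (j' < J)%N -> cell t a (i' * S + j') =
      if (i' < i)%N || (i' == i) && (j' < j)%N then F i' j' else cell s a (i' * S + j')) ->
    runs c t (fun u => [/\ agree V As t u, outp u = outp t,
      ireg u v = i /\ ireg u w = j, cell u a (i * S + j) = F i j &
      forall k, k != (i * S + j)%N -> cell u a k = cell t a k])) ->
  (forall t, agree V As s t -> outp t = outp s ->
    (forall i j, (i < I)%N -> (j < J)%N -> cell t a (i * S + j) = F i j) -> Q t) ->
  runs (Fill v eI w eJ c) s Q.
Proof.
move=> vw vV wV JS he hc hQ.
pose mem (i j : nat) (t : state R) := forall i' j', (i' < I)%N -> (j' < J)%N ->
  cell t a (i' * S + j') =
  if (i' < i)%N || (i' == i) && (j' < j)%N then F i' j' else cell s a (i' * S + j').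
apply: (@runs_for (fun i t => [/\ agree V As s t, outp t = outp s & mem i 0%N t]) I).
- split=> //; first exact: agree_set_reg (agree_refl _ _ _).
  by move=> i' j' _ _; rewrite ltn0 andbF.
- move=> i t iI [ast ot mt] ti.
  apply: (@runs_for (fun j u => [/\ agree V As s u, outp u = outp s, ireg u v = i & mem i j u]) J).
  + split=> //=; first exact: agree_set_reg.
    by rewrite (negbTE vw).
  + move=> j u jJ [asu ou ui mu] uj.
    apply: runs_conseq (hc i j u iI jJ asu ou ui uj mu) => z [auz oz [zi zj] zF zk].
    split=> //; split=> /=; last first.
    * move=> i' j' iI' jJ' /=.
      have [e|ne] := eqVneq (i' * S + j')%N (i * S + j)%N.
        have [-> ->] := pair_index_inj (leq_trans jJ' JS) (leq_trans jJ JS) e.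
        by rewrite zF eqxx ltnSn orbT.
      rewrite zk// mu//; congr (if _ || _ then _ else _).
      have [ii|] := eqVneq i' i => //=; rewrite ltnS [in RHS]leq_eqVlt.
      by case: eqP => // jj; move: ne; rewrite ii jj eqxx.
    * by rewrite (negbTE vw).
    * by rewrite oz.
    * exact: agree_set_reg (agree_trans asu auz).
  + by move=> j u [asu _ _ _] _; have [] := he u asu.
  + move=> u [asu ou ui mu] uJ; split=> //; split=> //=.
      exact: agree_set_reg.
    move=> i' j' iI' jJ' /=; rewrite mu// jJ' andbT ltn0 andbF orbF ltnS [in RHS]leq_eqVlt.
    by rewrite orbC.
- by move=> i t [ast _ _] _; have [] := he t ast.
- move=> t [ast ot mt] _; apply: hQ => // i j iI jJ.
  by rewrite mt// iI.
Qed.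

End ProgramLogic.

(** * The test of a single section *)

Section PositivityTest.
Variables (R : realType) (p : nat).
Implicit Types (s t u : state R).

(* Registers: 0 = n, 1 = size of K, 2 = W and 3 = H (columns and rows of a section),
   4 = bound on the grid coordinates, 5 and 6 = current grid coordinates, 7 = flag
   for [nu <= eps], 8 = number of the current section, 9 to 13 = matrix indices.
   Array 6 holds a real 2H x 2W matrix, array 7 its shifted Gram matrix, and array 8
   the radius of the grid, the squared tolerance and the spectral parameter. *)
Definition at2 (i : nat) (S : iexp) (j : nat) : iexp := IAdd (IMul (IReg i) S) (IReg j).

(* Truncated subtraction: the value is 1 if the two values agree and 0 otherwise. *)
Definition kronecker (e f : iexp) : iexp :=
  ISub (INat 1) (IAdd (ISub e f) (ISub f e)).

Lemma nat_kronecker (a b : nat) : (1 - (a - b + (b - a)))%N = (a == b).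
Proof. case: eqP => [->|]; lia. Qed.

Definition double_width : iexp := IMul (INat 2) (IReg 2).
Definition double_height : iexp := IMul (INat 2) (IReg 3).

(* Entry (r, c) of the shifted section number [IReg 8]; [z] is the cell of array 8
   with the corresponding coordinate of the spectral parameter. *)
Definition entry (arr z : nat) (r c : iexp) : rexp :=
  RSub (RCell arr (IAdd (IAdd (IMul (IReg 8) (IMul (IReg 3) (IReg 2)))
                              (IMul r (IReg 2))) c))
       (RMul (RCell 8 (INat z)) (ROfNat (kronecker r (IAdd c (INat p))))).

Definition build_realified (ar ai : nat) : cmd :=
  Fill 9 double_height 10 double_width
    (If (ILt (IReg 9) (IReg 3))
      (If (ILt (IReg 10) (IReg 2))
        (RSet 6 (at2 9 double_width 10) (entry ar 2 (IReg 9) (IReg 10)))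
        (RSet 6 (at2 9 double_width 10) (RSub (ROfNat (INat 0))
           (entry ai 3 (IReg 9) (ISub (IReg 10) (IReg 2))))))
      (If (ILt (IReg 10) (IReg 2))
        (RSet 6 (at2 9 double_width 10) (entry ai 3 (ISub (IReg 9) (IReg 3)) (IReg 10)))
        (RSet 6 (at2 9 double_width 10) (entry ar 2 (ISub (IReg 9) (IReg 3)) (ISub (IReg 10) (IReg 2)))))).

Definition build_gram : cmd :=
  Fill 12 double_width 13 double_width
    (Seq (RSet 7 (at2 12 double_width 13) (RSub (ROfNat (INat 0))
            (RMul (RCell 8 (INat 1)) (ROfNat (kronecker (IReg 12) (IReg 13))))))
         (For 9 double_height (RSet 7 (at2 12 double_width 13) (RAdd (RCell 7 (at2 12 double_width 13))
            (RMul (RCell 6 (at2 9 double_width 12)) (RCell 6 (at2 9 double_width 13))))))).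

(* After a nonpositive pivot the elimination runs on with meaningless values (possibly
   dividing by 0), which is harmless because the flag is already set. *)
Definition eliminate : cmd :=
  For 11 double_width (Seq
    (If (RLt (ROfNat (INat 0)) (RCell 7 (at2 11 double_width 11))) Skip (ISet 7 (INat 1)))
    (Fill 12 double_width 13 double_width
      (If (ILt (IReg 11) (IReg 12))
        (If (ILt (IReg 11) (IReg 13))
          (RSet 7 (at2 12 double_width 13) (RSub (RCell 7 (at2 12 double_width 13))
             (RDiv (RMul (RCell 7 (at2 12 double_width 11)) (RCell 7 (at2 11 double_width 13)))
                   (RCell 7 (at2 11 double_width 11)))))
          Skip)
        Skip))).

Definition test_section (ar ai : nat) : cmd :=
  Seq (build_realified ar ai) (Seq build_gram eliminate).

(* Real 2H x 2W matrix of multiplication by the complex matrix re + i im. *)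
Definition realify (H W : nat) (re im : nat -> nat -> R) (r c : nat) : R :=
  if (r < H)%N then (if (c < W)%N then re r c else - im r (c - W)%N)
  else (if (c < W)%N then im (r - H)%N c else re (r - H)%N (c - W)%N).

Definition gram (m : nat) (f : nat -> nat -> R) (e : R) (i j : nat) : R :=
  \sum_(r < m) f r i * f r j - e * (i == j)%:R.

Definition sect_entry s (H W arr z : nat) (r c : nat) : R :=
  cell s arr (ireg s 8 * (H * W) + r * W + c) - cell s 8 z * (r == (c + p)%N)%:R.

Lemma runs_fill_rset (V As : seq nat) (a S v w i j : nat) (e : iexp) (x : rexp)
    (F : nat -> nat -> R) t :
  a \in As -> ireg t v = i -> ireg t w = j -> ieval t e = (i * S + j)%N ->
  reval t x = F i j ->
  runs (RSet a e x) t (fun u => [/\ agree V As t u, outp u = outp t,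
      ireg u v = i /\ ireg u w = j, cell u a (i * S + j) = F i j &
      forall k, k != (i * S + j)%N -> cell u a k = cell t a k]).
Proof.
move=> aA tv tw te tx; apply: runs_rset; split=> //=.
- exact: agree_set_mem (agree_refl _ _ _).
- by rewrite te !eqxx.
- by move=> k kn; rewrite te eqxx (negbTE kn).
Qed.

Lemma build_realified_spec (ar ai H W : nat) s Q : ar != 6 -> ai != 6 ->
  ireg s 2 = W -> ireg s 3 = H ->
  (forall t, agree [:: 9; 10]%N [:: 6]%N s t -> outp t = outp s ->
    (forall r c, (r < 2 * H)%N -> (c < 2 * W)%N -> cell t 6 (r * (2 * W) + c) =
       realify H W (sect_entry s H W ar 2) (sect_entry s H W ai 3) r c) -> Q t) ->
  runs (build_realified ar ai) s Q.
Proof.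
move=> ar6 ai6 sW sH hQ.
apply: (@runs_fill R [:: 9; 10]%N [:: 6]%N 6 (2 * W) (2 * H) (2 * W) 9 10 double_height double_width _
  (realify H W (sect_entry s H W ar 2) (sect_entry s H W ai 3))) => //.
  by move=> t [h1 _]; rewrite /= !h1// sW sH.
move=> i j t iI jJ [h1 h2] ot ti tj _.
have tW : ireg t 2 = W by rewrite h1.
have tH : ireg t 3 = H by rewrite h1.
have entryE arr z (r c : iexp) : arr != 6 ->
    reval t (entry arr z r c) = sect_entry s H W arr z (ieval t r) (ieval t c).
  by move=> a6; rewrite /entry /sect_entry /= nat_kronecker tW tH (h1 8%N)// !h2// inE.
apply: runs_if; rewrite /= ti tH; case: ifPn => iH; apply: runs_if; rewrite /= tj tW;
  case: ifPn => jW; apply: runs_fill_rset => //; rewrite ?[ieval _ (at2 _ _ _)]/= ?ti ?tj ?tW//.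
- by rewrite /realify entryE// iH jW /= ti tj.
- have -> e : reval t (RSub (ROfNat (INat 0)) e) = - reval t e by rewrite /= sub0r.
  by rewrite /realify entryE// iH (negbTE jW) /= ti tj tW.
- by rewrite /realify entryE// (negbTE iH) jW /= ti tj tH.
- by rewrite /realify entryE// (negbTE iH) (negbTE jW) /= ti tj tH tW.
Qed.

Lemma build_gram_spec (H W : nat) (f : nat -> nat -> R) s Q :
  ireg s 2 = W -> ireg s 3 = H ->
  (forall r c, (r < 2 * H)%N -> (c < 2 * W)%N -> cell s 6 (r * (2 * W) + c) = f r c) ->
  (forall t, agree [:: 9; 12; 13]%N [:: 7]%N s t -> outp t = outp s ->
    (forall i j, (i < 2 * W)%N -> (j < 2 * W)%N -> cell t 7 (i * (2 * W) + j) =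
       gram (2 * H) f (cell s 8 1) i j) -> Q t) ->
  runs build_gram s Q.
Proof.
move=> sW sH sN hQ.
apply: (@runs_fill R [:: 9; 12; 13]%N [:: 7]%N 7 (2 * W) (2 * W) (2 * W) 12 13 double_width double_width _
  (gram (2 * H) f (cell s 8 1))) => //.
  by move=> t [h1 _]; rewrite /= !h1// sW.
move=> i j t iI jJ [h1 h2] ot ti tj _.
have tW : ireg t 2 = W by rewrite h1.
apply/runs_seq/runs_rset.
set t1 := Defs.set_mem _ _ _ _.
have t1E : [/\ agree [:: 9]%N [:: 7]%N t t1, outp t1 = outp t,
    cell t1 7 (i * (2 * W) + j) = - (cell s 8 1 * (i == j)%:R) &
    forall k, k != (i * (2 * W) + j)%N -> cell t1 7 k = cell t 7 k].
  split=> //=.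
  - exact: agree_set_mem (agree_refl _ _ _).
  - by rewrite ti tj tW eqxx /= nat_kronecker h2// sub0r.
  - by move=> k kn; rewrite ti tj tW (negbTE kn).
case: t1E => a1 o1 c1 k1; move: t1 a1 o1 c1 k1 => t1 a1 o1 c1 k1.
pose J (r : nat) u := [/\ agree [:: 9]%N [:: 7]%N t u, outp u = outp t,
    cell u 7 (i * (2 * W) + j) = \sum_(q < r) f q i * f q j - cell s 8 1 * (i == j)%:R &
    forall k, k != (i * (2 * W) + j)%N -> cell u 7 k = cell t 7 k].
apply: (@runs_for R J (2 * H)).
- split=> //=; first exact: agree_set_reg.
  by rewrite c1 big_ord0 sub0r.
- move=> r u rH [[g1 g2] ou cu ku] ur.
  have uW : ireg u 2 = W by rewrite g1.
  have ui : ireg u 12 = i by rewrite g1.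
  have uj : ireg u 13 = j by rewrite g1.
  apply: runs_rset; split; first by [].
  split=> //=.
  + exact: agree_set_reg (agree_set_mem _ _ _ (conj g1 g2)).
  + rewrite ui uj uW eqxx /= ur cu !g2// !h2// !sN//.
    by rewrite big_ord_recr /= addrAC.
  + by move=> k kn; rewrite ui uj uW (negbTE kn) ku.
- by move=> r u [[g1 _] _ _ _] _; rewrite /= g1// h1// sH.
- move=> u [[g1 g2] ou cu ku] _; split=> //.
  + by split=> [x xV|b k bA]; [apply: g1; apply: contra xV; rewrite !inE => ->|exact: g2].
  + by rewrite !g1.
Qed.

Lemma eliminate_spec (W : nat) (g : nat -> nat -> R) s Q :
  ireg s 2 = W ->
  (forall i j, (i < 2 * W)%N -> (j < 2 * W)%N -> cell s 7 (i * (2 * W) + j) = g i j) ->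
  (forall t, agree [:: 7; 11; 12; 13]%N [:: 7]%N s t -> outp t = outp s ->
     ireg t 7 = (if pivots_pos (2 * W) g then ireg s 7 else 1%N) -> Q t) ->
  runs eliminate s Q.
Proof.
move=> sW sG hQ.
pose J k t := [/\ agree [:: 7; 11; 12; 13]%N [:: 7]%N s t, outp t = outp s,
  (forall i j, (i < 2 * W)%N -> (j < 2 * W)%N -> cell t 7 (i * (2 * W) + j) = elim k g i j) &
  ireg t 7 = if [forall r : 'I_(2 * W), (r < k)%N ==> (0 < elim r g r r)] then ireg s 7 else 1%N].
apply: (@runs_for R J (2 * W)).
- split=> //=; first exact: agree_set_reg (agree_refl _ _ _).
  by rewrite ifT//; apply/forallP => r.
- move=> k t kW [[h1 h2] ot ct ft] tk.
  have tW : ireg t 2 = W by rewrite h1.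
  set fl := if [forall r : 'I_(2 * W), (r < k.+1)%N ==> (0 < elim r g r r)]
    then ireg s 7 else 1%N.
  apply: runs_seq.
  apply: (@runs_conseq R _ _ (fun u => [/\ agree [:: 7]%N [::] t u, outp u = outp t &
    ireg u 7 = fl])).
    2: {
      apply: runs_if; rewrite /= tk tW ct//.
      have fE : fl = if 0 < elim k g k k then ireg t 7 else 1%N.
        rewrite ft /fl; case: ifP => [/forallP h|/negbT].
          have -> : 0 < elim k g k k by have := h (Ordinal kW); rewrite /= ltnSn.
          rewrite ifT//; apply/forallP => r; apply/implyP => rk.
          by have := h r; rewrite ltnS (ltnW rk).
        rewrite negb_forall => /existsP [r]; rewrite negb_imply ltnS leq_eqVlt => /andP[/orP[/eqP rk|rk] hr].
          by rewrite -rk (negbTE hr).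
        case: ifP => // _; rewrite ifF//; apply/negbTE; rewrite negb_forall.
        by apply/existsP; exists r; rewrite negb_imply rk.
      case: ifPn => pv.
        by apply: runs_skip; split=> //; rewrite fE pv.
      apply: runs_iset; split=> //=; first exact: agree_set_reg (agree_refl _ _ _).
      by rewrite fE (negbTE pv).
    }
  move=> u [[a1 a2] ou fu].
  have ur w : w != 7%N -> ireg u w = ireg t w by move=> w7; rewrite a1// inE.
  have um i : cell u 7 i = cell t 7 i by rewrite a2.
  apply: (@runs_fill R [:: 12; 13]%N [:: 7]%N 7 (2 * W) (2 * W) (2 * W) 12 13 double_width double_width _
    (elim k.+1 g)) => //.
  + by move=> z [z1 _]; rewrite /= !z1// ur// tW.
  + move=> i j z iI jJ [z1 z2] oz zi zj zm.
    have zW : ireg z 2 = W by rewrite z1// ur.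
    have zk : ireg z 11 = k by rewrite z1// ur.
    (* An elimination step changes only entries with both indices above [k], so the pivot row and
       column read during the in-place sweep still have their old values, visited or not. *)
    have zold i' j' : (i' < 2 * W)%N -> (j' < 2 * W)%N -> ~~ ((k < i')%N && (k < j')%N) ->
        cell z 7 (i' * (2 * W) + j') = elim k g i' j'.
      move=> iI' jJ' /negbTE kij; rewrite zm//= /elim_step kij um ct//.
      by case: ifP.
    have zij : cell z 7 (i * (2 * W) + j) = elim k g i j.
      by rewrite zm// ltnn eqxx ltnn /= um ct.
    have skip : (k < i)%N && (k < j)%N = false -> runs Skip z (fun u0 => [/\ agree [:: 12; 13]%N [:: 7]%N z u0,
        outp u0 = outp z, ireg u0 12 = i /\ ireg u0 13 = j,
        cell u0 7 (i * (2 * W) + j) = elim k.+1 g i j &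
        forall k0, k0 != (i * (2 * W) + j)%N -> cell u0 7 k0 = cell z 7 k0]).
      by move=> kij; apply: runs_skip; split=> //=; rewrite zij /elim_step kij.
    apply: runs_if; rewrite /= zi zk; case: ifPn => ki; last first.
      by apply: skip; rewrite (negbTE ki).
    apply: runs_if; rewrite /= zj zk; case: ifPn => kj; last first.
      by apply: skip; rewrite (negbTE kj) andbF.
    apply: runs_fill_rset => //=; rewrite ?zi ?zj ?zW//.
    rewrite zk zij !zold// ?ltnn ?andbF//.
    by rewrite /elim_step ki kj.
  + move=> z [z1 z2] oz zm; split; first by rewrite z1// ur.
    split=> /=.
    * apply: agree_set_reg => //; split=> [w wV|b q bA].
        have w7 : w != 7%N by apply: contra wV => /eqP ->.
        by rewrite z1 ?ur ?h1//; apply: contra wV; rewrite !inE => /orP[]->; rewrite ?orbT.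
      by rewrite z2// a2// h2.
    * by rewrite oz ou.
    * exact: zm.
    * by rewrite z1// fu.
- by move=> k t [[h1 _] _ _ _] _; rewrite /= h1// sW.
- move=> t [ast ot _ ft] _; apply: hQ => //; rewrite ft.
  congr (if _ then _ else _); rewrite /pivots_pos.
  by apply: eq_forallb => r; rewrite ltn_ord.
Qed.

End PositivityTest.

(** * From complex singular values to real pivots *)

Section SingularValueTest.
Variable R : realType.

Lemma sum_double (F : nat -> R) (W : nat) :
  \sum_(0 <= j < 2 * W) F j = \sum_(j < W) (F j + F (W + j)%N).
Proof.
rewrite mul2n -addnn (big_cat_nat (n := W)) ?leq_addr//= big_split /= big_mkord.
congr (_ + _); rewrite -{1}(add0n W) big_addn addnK big_mkord.
by apply: eq_bigr => j _; rewrite addnC.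
Qed.

Lemma gram_sym (m n : nat) f (e : R) : symmetric_on n (gram m f e).
Proof.
move=> i j _ _; rewrite /gram eq_sym; congr (_ - _).
by apply: eq_bigr => r _; rewrite mulrC.
Qed.

Lemma gram_qform (m n : nat) f (e : R) y : qform 0 n (gram m f e) y =
  \sum_(0 <= r < m) (\sum_(0 <= j < n) f r j * y j) ^+ 2 - e * \sum_(0 <= j < n) y j ^+ 2.
Proof.
rewrite /qform big_mkord.
under eq_bigr => i _ do rewrite big_mkord.
under [X in _ = X - _]big_mkord.
rewrite big_mkord mulr_sumr.
under [X in _ = X - _]eq_bigr => r _ do rewrite big_mkord expr2 mulr_suml.
rewrite [X in _ = X - _]exchange_big /= -sumrB; apply: eq_bigr => i _.
under [X in _ = X - _]eq_bigr => r _ do rewrite mulr_sumr.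
rewrite exchange_big /=.
rewrite (eq_bigr (fun j : 'I_n => \sum_(r < m) f r i * y i * (f r j * y j) -
   e * ((i : nat) == j)%:R * y i * y j)); last first.
  move=> j _; rewrite /gram mulrBl mulrBl !mulr_suml; congr (_ - _).
  by apply: eq_bigr => r _; ring.
rewrite sumrB; congr (_ - _); rewrite (bigD1 i)//= big1 ?addr0 => [|j ji].
  by rewrite eqxx mulr1; ring.
by rewrite eq_sym val_eqE (negbTE ji) mulr0 !mul0r.
Qed.

Section Link.
Variables (H W : nat) (M : 'M[R[i]]_(H, W)) (re im : nat -> nat -> R).
Hypothesis reE : forall (r : 'I_H) (c : 'I_W), re r c = complex.Re (M r c).
Hypothesis imE : forall (r : 'I_H) (c : 'I_W), im r c = complex.Im (M r c).

(** Real parts in the first half of [y] and imaginary parts in the second, matching the blocks of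
    [realify]. *)
Let vec (y : nat -> R) : 'cV[R[i]]_W := \col_c (y c +i* y (W + c)%N).

Lemma vnorm_vec y : vnorm (vec y) ^+ 2 = \sum_(0 <= j < 2 * W) y j ^+ 2.
Proof.
by rewrite sqv_ReIm sum_double; apply: eq_bigr => c _; rewrite mxE.
Qed.

Lemma vnorm_mul_vec y : vnorm (M *m vec y) ^+ 2 =
  \sum_(0 <= r < 2 * H) (\sum_(0 <= j < 2 * W) realify H W re im r j * y j) ^+ 2.
Proof.
have ImD (a b : R[i]) : complex.Im (a + b) = complex.Im a + complex.Im b.
  by case: a b => ? ? [].
have Im_sum (F : 'I_W -> R[i]) : complex.Im (\sum_j F j) = \sum_j complex.Im (F j).
  by apply: (big_morph (@complex.Im R)) => //; exact: ImD.
rewrite sqv_ReIm sum_double; apply: eq_bigr => r _.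
rewrite !sum_double mxE Re_sum Im_sum; congr (_ ^+ 2 + _ ^+ 2); apply: eq_bigr => c _;
  rewrite mxE /realify !ltn_ord ?(ltnNge _ W) ?(ltnNge _ H) !leq_addr /= !addKn ?reE ?imE.
- by case: (M r c) => u v /=; rewrite mulNr.
- by case: (M r c) => u v /=; rewrite addrC.
Qed.

Lemma vec_surj (x : 'cV[R[i]]_W) : exists y, vec y = x.
Proof.
case: (posnP W) => [W0|W0].
  exists (fun=> 0); apply/colP => c; exfalso.
  by have : (0 < W)%N := leq_ltn_trans (leq0n c) (ltn_ord c); rewrite W0.
pose y (j : nat) : R := if (j < W)%N then complex.Re (x (insubd (Ordinal W0) j) 0)
  else complex.Im (x (insubd (Ordinal W0) (j - W)%N) 0).
exists y; apply/colP => c; rewrite mxE /y ltn_ord ltnNge leq_addr /= addKn.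
have -> : insubd (Ordinal W0) c = c by apply: val_inj; rewrite val_insubd ltn_ord.
by case: (x c 0).
Qed.

(** Positive pivots come with a uniform gap, giving [nu M >= sqrt (eps^2 + c)]. Otherwise a nonzero
    vector with nonpositive form witnesses [nu M <= eps], equality included. *)
Lemma pivots_pos_nu (eps : R) : (0 < W)%N -> 0 <= eps ->
  pivots_pos (2 * W) (gram (2 * H) (realify H W re im) (eps * eps)) = ~~ (nu M <= eps).
Proof.
move=> W0 eps0; have := pivots_posP (@gram_sym (2 * H) (2 * W) (realify H W re im) (eps * eps)).
case: ifP => _.
  move=> [c c0 hc]; rewrite -ltNge; apply/esym.
  have ec0 : 0 <= eps ^+ 2 + c by rewrite addr_ge0 ?sqr_ge0// ltW.
  apply: (@lt_le_trans _ _ (Num.sqrt (eps ^+ 2 + c))).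
    by rewrite -{1}(ger0_norm eps0) -sqrtr_sqr ltr_sqrt ?ltr_pwDr ?sqr_ge0// ltrDl.
  apply: nu_ge => // x x1; have [y yx] := vec_surj x.
  rewrite -(ler_pXn2r (n:=2))// ?nnegrE ?sqrtr_ge0 ?vnorm_ge0// sqr_sqrtr//.
  have := hc y; rewrite gram_qform -vnorm_mul_vec -vnorm_vec yx x1 expr1n; lra.
move=> [y [[j jW yj] hy]]; apply/esym/negbTE; rewrite negbK.
have x0 : 0 < vnorm (vec y).
  rewrite lt_def vnorm_ge0 andbT -sqrf_eq0 vnorm_vec.
  rewrite psumr_neq0; last by move=> k _; exact: sqr_ge0.
  apply/hasP; exists j; first by rewrite mem_index_iota.
  by rewrite /= lt_def sqr_ge0 sqrf_eq0 yj.
rewrite -(ler_pM2r x0); apply: (le_trans (nu_mul_le _ _)).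
rewrite -(ler_pXn2r (n:=2))// ?nnegrE ?mulr_ge0 ?vnorm_ge0//.
by move: hy; rewrite gram_qform -vnorm_mul_vec -vnorm_vec exprMn; lra.
Qed.

End Link.

End SingularValueTest.

(** An offset of one block row is an offset of [p] scalar rows; this is the form in which [entry]
    evaluates the shift. *)
Lemma sectIE (R : realType) (p n : nat) r c :
  sectI R p n r c = ((r : nat) == (c + p)%N)%:R.
Proof.
rewrite /sectI mxE.
have val_sig m (s : 'I_(\sum_(j < m) p)) :
    (s : nat) = (tagnat.sig1 s * p + tagnat.sig2 s)%N.
  rewrite -{1}(tagnat.sig2K s) tagnat.RankEsum; congr (_ + _)%N.
  have sm : (tagnat.sig1 s <= m)%N by exact: ltnW.
  by rewrite -(big_ord_widen m (fun _ => p) sm) sum_nat_const card_ord.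
rewrite (val_sig _ r) (val_sig _ c).
set r1 := tagnat.sig1 r; set r2 := tagnat.sig2 r.
set c1 := tagnat.sig1 c; set c2 := tagnat.sig2 c.
have [e|ne] := eqVneq (r1 : nat) c1.+1.
  rewrite mxE; congr (_%:R); rewrite e mulSn -val_eqE /=.
  move: (c1 * p)%N (nat_of_ord r2) (nat_of_ord c2) => a b d; lia.
rewrite mxE; case: eqP => // e.
have [] := @pair_index_inj p r1 r2 c1.+1 c2 (ltn_ord r2) (ltn_ord c2).
  by rewrite e mulSn; move: (c1 * p)%N (nat_of_ord r2) (nat_of_ord c2) => a b d; lia.
by move=> e'; rewrite e' eqxx in ne.
Qed.

Lemma nth_flatten_blocks (T : Type) (x0 : T) (L : nat) (ss : seq (seq T)) :
  all (fun s => size s == L) ss -> forall k q, (k < size ss)%N -> (q < L)%N ->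
  nth x0 (flatten ss) (k * L + q) = nth x0 (nth [::] ss k) q.
Proof.
elim: ss => // s ss IH /andP[/eqP sL hs] [|k] q kss qL /=.
  by rewrite nth_cat sL qL.
by rewrite nth_cat sL mulSn -addnA ltnNge leq_addr /= addKn IH.
Qed.

Lemma size_row_major (T : Type) (m n : nat) (M : 'M[T]_(m, n)) :
  size (row_major M) = (m * n)%N.
Proof. by rewrite /row_major size_allpairs !size_enum_ord. Qed.

Lemma nth_row_major (T : Type) (x0 : T) (m n : nat) (M : 'M[T]_(m, n)) (r : 'I_m) (c : 'I_n) :
  nth x0 (row_major M) (r * n + c) = M r c.
Proof.
have sz : all (fun s => size s == n) [seq [seq M i j | j <- enum 'I_n] | i <- enum 'I_m].
  by elim: (enum 'I_m) => //= i s ->; rewrite size_map size_enum_ord eqxx.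
rewrite /row_major (@nth_flatten_blocks _ x0 n _ sz)//; last by rewrite size_map size_enum_ord.
rewrite (nth_map r) ?size_enum_ord// (nth_map c) ?size_enum_ord//.
by rewrite !nth_ord_enum.
Qed.

Lemma nth_map_default (S T : Type) (f : S -> T) (x0 : S) (s : seq S) (k : nat) :
  nth (f x0) (map f s) k = f (nth x0 s k).
Proof.
have [ks|ks] := ltnP k (size s); first exact: nth_map.
by rewrite !nth_default ?size_map.
Qed.

Lemma nth_blocks (R : realType) (m n : nat) (g : R[i] -> R) (f : int -> 'M[R[i]]_(m, n))
    (K : seq int) (k : nat) (r : 'I_m) (c : 'I_n) : g 0 = 0 -> (k < size K)%N ->
  nth 0 [seq g z | z <- flatten [seq row_major (f j) | j <- K]] (k * (m * n) + r * n + c) =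
  g (f (nth 0 K k) r c).
Proof.
move=> g0 kK; rewrite -{1}g0 nth_map_default -addnA (@nth_flatten_blocks _ 0 (m * n)).
- by rewrite (nth_map 0)// nth_row_major.
- by elim: (K) => //= j s ->; rewrite size_row_major eqxx.
- by rewrite size_map.
- have rm := ltn_ord r; have cn := ltn_ord c.
  apply: (@leq_trans (r * n + n)); first by rewrite ltn_add2l.
  by rewrite -mulSnr leq_mul2r rm orbT.
Qed.

(** * The loops over sections and grid points *)

Section Program.
Variables (R : realType) (p : nat).
Implicit Types (s t u : state R).

Lemma flag_update (b1 b2 : pred nat) (k : nat) :
  (if b2 k then 1%N else if b1 k then 1%N else has [pred j | b1 j || b2 j] (iota 0 k) : nat) =
  has [pred j | b1 j || b2 j] (iota 0 k.+1).
Proof.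
rewrite -(addn1 k) iotaD has_cat add0n /= orbF.
by case: (b1 k) (b2 k) => -[] //=; rewrite ?orbT ?orbF.
Qed.

Lemma test_section_spec (H W ar ai : nat) (M : 'M[R[i]]_(H, W)) (eps : R) s Q :
  ar != 6 -> ai != 6 -> (0 < W)%N -> 0 <= eps ->
  ireg s 2 = W -> ireg s 3 = H -> cell s 8 1 = eps * eps ->
  (forall (r : 'I_H) (c : 'I_W), sect_entry p s H W ar 2 r c = complex.Re (M r c)) ->
  (forall (r : 'I_H) (c : 'I_W), sect_entry p s H W ai 3 r c = complex.Im (M r c)) ->
  (forall t, agree [:: 7; 9; 10; 11; 12; 13]%N [:: 6; 7]%N s t -> outp t = outp s ->
     ireg t 7 = (if nu M <= eps then 1%N else ireg s 7) -> Q t) ->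
  runs (test_section p ar ai) s Q.
Proof.
move=> ar6 ai6 W0 eps0 sW sH s8 hre him hQ.
apply: runs_seq; apply: (build_realified_spec ar6 ai6 sW sH) => t a1 o1 c1.
have [g1 g2] := a1.
have tW : ireg t 2 = W by rewrite g1.
have tH : ireg t 3 = H by rewrite g1.
apply: runs_seq; apply: (build_gram_spec tW tH c1) => u a2 o2 c2.
have [g3 g4] := a2.
apply: (eliminate_spec (W := W) _ c2); first by rewrite g3// g1.
move=> v a3 o3 f3; apply: hQ.
- apply: (@agree_trans _ _ _ t); first by apply: agree_sub a1; apply/allP.
  apply: (@agree_trans _ _ _ u); first by apply: agree_sub a2; apply/allP.
  by apply: agree_sub a3; apply/allP.
- by rewrite o3 o2.
- rewrite f3 g2// s8 (pivots_pos_nu hre him W0 eps0) g3// g1//.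
  by case: (nu M <= eps).
Qed.

Definition scan : cmd :=
  For 8 (IReg 1) (Seq (test_section p 2 3) (test_section p 4 5)).

Lemma scan_spec (H W L : nat) (M1 M2 : nat -> 'M[R[i]]_(H, W)) (eps : R) s Q :
  (0 < W)%N -> 0 <= eps -> ireg s 1 = L -> ireg s 2 = W -> ireg s 3 = H ->
  ireg s 7 = 0%N -> cell s 8 1 = eps * eps ->
  (forall k (r : 'I_H) (c : 'I_W), (k < L)%N ->
     let e arr z := cell s arr (k * (H * W) + r * W + c) - cell s 8 z * ((r : nat) == (c + p)%N)%:R in
     [/\ e 2%N 2%N = complex.Re (M1 k r c), e 3%N 3%N = complex.Im (M1 k r c),
         e 4%N 2%N = complex.Re (M2 k r c) & e 5%N 3%N = complex.Im (M2 k r c)]) ->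
  (forall t, agree [:: 7; 8; 9; 10; 11; 12; 13]%N [:: 6; 7]%N s t -> outp t = outp s ->
     ireg t 7 = has [pred k | (nu (M1 k) <= eps) || (nu (M2 k) <= eps)] (iota 0 L) -> Q t) ->
  runs scan s Q.
Proof.
move=> W0 eps0 sL sW sH s7 s8 hM hQ.
pose V := [:: 7; 8; 9; 10; 11; 12; 13]%N; pose P := [pred k | (nu (M1 k) <= eps) || (nu (M2 k) <= eps)].
pose J k t := [/\ agree V [:: 6; 7]%N s t, outp t = outp s & ireg t 7 = has P (iota 0 k)].
apply: (@runs_for R J L).
- by split=> //=; exact: agree_set_reg (agree_refl _ _ _).
- move=> k t kL [ast ot ft] tk; have [h1 h2] := ast.
  have tE arr z (r : 'I_H) (c : 'I_W) : arr \notin [:: 6; 7]%N ->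
      sect_entry p t H W arr z r c =
      cell s arr (k * (H * W) + r * W + c) - cell s 8 z * ((r : nat) == (c + p)%N)%:R.
    by move=> h; rewrite /sect_entry tk !h2.
  apply: runs_seq; apply: (@test_section_spec H W 2 3 (M1 k) eps) => //.
  + by rewrite h1.
  + by rewrite h1.
  + by rewrite h2.
  + by move=> r c; rewrite tE//; case: (hM k r c kL).
  + by move=> r c; rewrite tE//; case: (hM k r c kL).
  move=> u a1 o1 f1; have [g1 g2] := a1.
  have uE arr z (r : 'I_H) (c : 'I_W) : arr \notin [:: 6; 7]%N ->
      sect_entry p u H W arr z r c = sect_entry p t H W arr z r c.
    by move=> h; rewrite /sect_entry !g1// !g2.
  apply: (@test_section_spec H W 4 5 (M2 k) eps) => //.
  + by rewrite g1// h1.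
  + by rewrite g1// h1.
  + by rewrite g2// h2.
  + by move=> r c; rewrite uE// tE//; case: (hM k r c kL).
  + by move=> r c; rewrite uE// tE//; case: (hM k r c kL).
  move=> v a2 o2 f2; have [g3 g4] := a2; split; first by rewrite g3// g1.
  split=> /=.
  + apply: agree_set_reg => //; apply: (agree_trans ast).
    apply: (@agree_trans _ _ _ u); first by apply: agree_sub a1; apply/allP.
    by apply: agree_sub a2; apply/allP.
  + by rewrite o2 o1.
  + change (ireg v 7 = has P (iota 0 k.+1)).
    rewrite f2 f1 ft; exact: (flag_update (fun j => nu (M1 j) <= eps) (fun j => nu (M2 j) <= eps)).
- by move=> k t [[h1 _] _ _] _; rewrite /= h1.
- by move=> t [ast ot ft] _; exact: hQ.
Qed.

Definition sqdist : rexp :=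
  RAdd (RMul (RCell 8 (INat 2)) (RCell 8 (INat 2))) (RMul (RCell 8 (INat 3)) (RCell 8 (INat 3))).

Definition emit_pt : cmd := Emit (RCell 8 (INat 2)) (RCell 8 (INat 3)).

(* Integer coordinates range over [-m, m], shifted to [0, 2m] by register 4. *)
Definition grid_coord (v : nat) : rexp :=
  RDiv (RSub (ROfNat (IReg v)) (ROfNat (IReg 4))) (ROfNat (IReg 0)).

(* The point 0 is on the grid even if the radius is 0. *)
Definition point : cmd :=
  Seq (RSet 8 (INat 2) (grid_coord 5))
  (Seq (RSet 8 (INat 3) (grid_coord 6))
  (Seq (ISet 7 (INat 0))
  (Seq scan
    (If (ILt (INat 0) (IReg 7))
      (If (RLt sqdist (RMul (RCell 8 (INat 0)) (RCell 8 (INat 0)))) emit_pt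
        (If (RLt (ROfNat (INat 0)) sqdist) Skip emit_pt))
      Skip)))).

Section Run.
Variables (n L m H W : nat) (M1 M2 : nat -> 'M[R[i]]_(H, W)) (r0 eps : R).
Variables (D : 'M[R[i]]_(H, W)) (s0 : state R).
Hypotheses (W_gt0 : (0 < W)%N) (eps_ge0 : 0 <= eps).
Hypothesis DE : forall r c, D r c = ((r : nat) == (c + p)%N)%:R.
Hypothesis s0M : forall k (r : 'I_H) (c : 'I_W), (k < L)%N ->
  let e arr := cell s0 arr (k * (H * W) + r * W + c) in
  [/\ e 2%N = complex.Re (M1 k r c), e 3%N = complex.Im (M1 k r c),
      e 4%N = complex.Re (M2 k r c) & e 5%N = complex.Im (M2 k r c)].

(** Everything that the grid loops only read. They write to registers above 4, to arrays 6 and 7,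
    and to cells 2 and 3 of array 8. *)
Definition ready s :=
  [/\ ireg s 0 = n, ireg s 1 = L, ireg s 2 = W, ireg s 3 = H & ireg s 4 = m] /\
  [/\ cell s 8 0 = r0, cell s 8 1 = eps * eps &
      forall b k, (b < 6)%N -> cell s b k = cell s0 b k].

Definition grid_pt (a b : nat) : R[i] :=
  Complex ((a%:R - m%:R) / n%:R) ((b%:R - m%:R) / n%:R).

Definition accepted (z : R[i]) : bool :=
  has [pred k | (nu (M1 k - z *: D) <= eps) || (nu (M2 k - z *: D) <= eps)] (iota 0 L) &&
  ((complex.Re z ^+ 2 + complex.Im z ^+ 2 < r0 ^+ 2) ||
   ~~ (0 < complex.Re z ^+ 2 + complex.Im z ^+ 2)).

Lemma ready_set_reg s v k : (4 < v)%N -> ready s -> ready (set_reg s v k).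
Proof.
move=> v4 [[h0 h1 h2 h3 h4] h]; split=> //; split=> /=; case: eqP => // e;
  by rewrite -e in v4.
Qed.

Lemma input_array (b : nat) : (b < 6)%N -> b \notin [:: 6; 7]%N /\ b != 8%N.
Proof. by do 6 case: b => [//|b]. Qed.

Lemma point_spec (a b : nat) s : ready s -> ireg s 5 = a -> ireg s 6 = b ->
  runs point s (fun t => [/\ ready t, ireg t 5 = a, ireg t 6 = b &
    outp t = if accepted (grid_pt a b) then rcons (outp s) (grid_pt a b) else outp s]).
Proof.
move=> [[h0 h1 h2 h3 h4] [c0 c1 cs]] sa sb.
apply/runs_seq/runs_rset/runs_seq/runs_rset/runs_seq/runs_iset.
set z := grid_pt a b.
set t := set_reg _ _ _.
have tr v : v != 7%N -> ireg t v = ireg s v by move=> /negbTE v7; rewrite /t /= v7.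
have t7 : ireg t 7 = 0%N by [].
have tc b' k : b' != 8%N -> cell t b' k = cell s b' k by move=> /negbTE b8; rewrite /t /= b8.
have t80 : cell t 8 0 = r0 by rewrite /t /= c0.
have t81 : cell t 8 1 = eps * eps by rewrite /t /= c1.
have t82 : cell t 8 2 = complex.Re z by rewrite /t /= sa h4 h0.
have t83 : cell t 8 3 = complex.Im z by rewrite /t /= sb h4 h0.
have ot : outp t = outp s by [].
move: t tr t7 tc t80 t81 t82 t83 ot => t tr t7 tc t80 t81 t82 t83 ot.
have DRe (k : nat) (M : nat -> 'M[R[i]]_(H, W)) (r : 'I_H) (c : 'I_W) :
    complex.Re ((M k - z *: D) r c) =
    complex.Re (M k r c) - complex.Re z * ((r : nat) == (c + p)%N)%:R.
  rewrite !mxE DE; case: (M k r c) (z) => u1 u2 [v1 v2].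
  by case: (_ == _); rewrite ?mulr1 ?mulr0 /= ?oppr0.
have DIm (k : nat) (M : nat -> 'M[R[i]]_(H, W)) (r : 'I_H) (c : 'I_W) :
    complex.Im ((M k - z *: D) r c) =
    complex.Im (M k r c) - complex.Im z * ((r : nat) == (c + p)%N)%:R.
  rewrite !mxE DE; case: (M k r c) (z) => u1 u2 [v1 v2].
  by case: (_ == _); rewrite ?mulr1 ?mulr0 /= ?oppr0.
apply: runs_seq.
apply: (@scan_spec H W L (fun k => M1 k - z *: D) (fun k => M2 k - z *: D) eps) => //.
- by rewrite tr.
- by rewrite tr.
- by rewrite tr.
- move=> k r c kL /=; rewrite t82 t83 !DRe !DIm !tc// !cs//.
  by case: (s0M r c kL) => -> -> -> ->.
move=> u [a1 a2] ou fu.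
have ur : [/\ ready u, ireg u 5 = a & ireg u 6 = b].
  split; [split|..].
  - by split; rewrite a1// tr.
  - split; [by rewrite a2|by rewrite a2|].
    move=> b' k b6; have [b67 b8] := input_array b6.
    by rewrite a2// tc// cs.
  - by rewrite a1// tr.
  - by rewrite a1// tr.
case: ur => ru ua ub.
have c2 : cell u 8 2 = complex.Re z by rewrite a2.
have c3 : cell u 8 3 = complex.Im z by rewrite a2.
have zE : Complex (complex.Re z) (complex.Im z) = z by [].
have em : accepted z -> runs emit_pt u (fun t => [/\ ready t, ireg t 5 = a, ireg t 6 = b &
    outp t = if accepted z then rcons (outp s) z else outp s]).
  by move=> az; apply: runs_emit; split=> //=; rewrite az c2 c3 ou ot zE.
have sk : ~~ accepted z -> runs Skip u (fun t => [/\ ready t, ireg t 5 = a, ireg t 6 = b &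
    outp t = if accepted z then rcons (outp s) z else outp s]).
  by move=> /negbTE az; apply: runs_skip; split=> //=; rewrite az ou.
have u80 : cell u 8 0 = r0 by rewrite a2.
apply: runs_if; rewrite /= fu lt0b; case: ifPn => hz; last first.
  by apply: sk; rewrite /accepted (negbTE hz).
apply: runs_if; rewrite /= c2 c3 u80 -!expr2; case: ifPn => zr.
  by apply: em; rewrite /accepted hz zr.
apply: runs_if; rewrite /= c2 c3 -!expr2; case: ifPn => z0.
  by apply: sk; rewrite /accepted hz (negbTE zr) z0.
by apply: em; rewrite /accepted hz z0 orbT.
Qed.

Definition grid_size : iexp := IAdd (IMul (INat 2) (IReg 4)) (INat 1).

Definition scan_grid : cmd := For 5 grid_size (For 6 grid_size point).

Lemma scan_grid_spec s Q : ready s -> outp s = [::] ->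
  (forall t, (forall z, z \in outp t <-> exists a b, [/\ (a < 2 * m + 1)%N, (b < 2 * m + 1)%N,
      accepted (grid_pt a b) & z = grid_pt a b]) -> Q t) ->
  runs scan_grid s Q.
Proof.
move=> rs os hQ.
pose listed (f : nat -> nat -> bool) t := forall z, z \in outp t <->
  exists a b, [/\ f a b, accepted (grid_pt a b) & z = grid_pt a b].
(* The pairs visited before [(i, j)] in row order. *)
pose g i j a b := ((a < i) || (a == i) && (b < j))%N && (b < 2 * m + 1)%N.
apply: (@runs_for R (fun i t => ready t /\ listed (g i 0%N) t) (2 * m + 1)).
- split; first exact: ready_set_reg.
  by move=> z; rewrite /= os in_nil; split=> // -[a [b []]]; rewrite /g ltn0 andbF.
- move=> i t iN [rt lt] ti.
  apply: (@runs_for R (fun j u => [/\ ready u, ireg u 5 = i & listed (g i j) u]) (2 * m + 1)).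
  + by split; [exact: ready_set_reg|exact: ti|exact: lt].
  + move=> j u jN [ru ui lu] uj.
    apply: runs_conseq (point_spec ru ui uj) => v [rv vi vj ov]; split; first exact: vj.
    split; [exact: ready_set_reg|exact: vi|].
    have gS a b : g i j.+1 a b <-> g i j a b \/ a = i /\ b = j.
      rewrite /g; split; last by case=> [|[-> ->]]; lia.
      move=> h; have [[-> ->]|ne] : (a = i /\ b = j) \/ (a != i) || (b != j).
        by case: eqP; case: eqP; rewrite ?orbT; intuition.
      by right.
      left; lia.
    move=> z; rewrite /= ov; split.
      case: ifPn => acc; last first.
        move=> /lu [a [b [gab ab ->]]]; exists a, b; split=> //; apply/gS; by left.
      rewrite mem_rcons in_cons => /orP[/eqP ->|/lu [a [b [gab ab ->]]]].
        by exists i, j; split=> //; apply/gS; right.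
      by exists a, b; split=> //; apply/gS; left.
    move=> [a [b [/gS [gab|[-> ->]] ab ->]]]; last by rewrite ab mem_rcons in_cons eqxx.
    have : grid_pt a b \in outp u by apply/lu; exists a, b.
    by case: ifP => // _ h; rewrite mem_rcons in_cons h orbT.
  + by move=> j u [[[_ _ _ _ u4] _] _ _] _; rewrite /= u4.
  + move=> u [ru ui lu] _; split=> //; split; first exact: ready_set_reg.
    move=> z; rewrite -[outp _]/(outp u); apply: iff_trans (lu z) _.
    have gE a b : g i (2 * m + 1)%N a b = g i.+1 0%N a b by rewrite /g; lia.
    by split=> -[a [b [gab ab ->]]]; exists a, b; split=> //; rewrite ?gE// -gE.
- by move=> i t [[[_ _ _ _ t4] _] _] _; rewrite /= t4.
- move=> t [rt lt] _; apply: hQ => z; apply: iff_trans (lt z) _.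
  have gE a b : g (2 * m + 1)%N 0%N a b = (a < 2 * m + 1)%N && (b < 2 * m + 1)%N.
    by rewrite /g; lia.
  split=> -[a [b]]; first by rewrite gE => -[/andP[aN bN] ab ->]; exists a, b.
  by move=> [aN bN ab ->]; exists a, b; rewrite gE aN bN.
Qed.

End Run.

End Program.

Definition outer_radius : rexp :=
  RAdd (RAdd (RCell 0 (INat 0)) (RCell 0 (INat 1))) (RCell 0 (INat 2)).

Definition tolerance : rexp :=
  RAdd (RMul (RAdd (RCell 0 (INat 0)) (RCell 0 (INat 2)))
             (RDiv (ROfNat (INat 22)) (RMul (ROfNat (INat 7)) (ROfNat (IAdd (IReg 0) (INat 1))))))
       (RDiv (ROfNat (INat 3)) (ROfNat (IReg 0))).

(** Only [p] is built in; all else is read from the initial state. A ceiling is not an arithmetic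
    operation, so register 4 is counted up until it reaches [n] times the radius. *)
Definition grid_program (p : nat) : cmd :=
  Seq (ISet 2 (IMul (IReg 0) (INat p)))
  (Seq (ISet 3 (IMul (IAdd (IReg 0) (INat 2)) (INat p)))
  (Seq (RSet 8 (INat 0) outer_radius)
  (Seq (RSet 8 (INat 1) (RMul tolerance tolerance))
  (Seq (ISet 4 (INat 0))
  (Seq (While (RLt (ROfNat (IReg 4)) (RMul (ROfNat (IReg 0)) (RCell 8 (INat 0))))
         (ISet 4 (IAdd (IReg 4) (INat 1))))
  (scan_grid p)))))).

(** Minimality gives the exact number of turns of the counting loop. *)
Lemma least_nat_ge (R : realType) (x : R) :
  exists m : nat, x <= m%:R /\ forall k, (k < m)%N -> k%:R < x.
Proof.
have ex : exists m : nat, x <= m%:R.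
  exists (Num.truncn `|x|).+1; apply: le_trans (ler_norm x) _.
  by apply: ltW; exact: truncnS_gt.
case: (ex_minnP ex) => m hm hmin; exists m; split=> // k km.
by rewrite ltNge; apply/negP => /hmin; rewrite leqNgt km.
Qed.

Lemma grid_program_spec (R : realType) (p n L H W : nat) (M1 M2 : nat -> 'M[R[i]]_(H, W))
    (D : 'M[R[i]]_(H, W)) (a b c : R) (s : state R) Q
    (r := a + b + c) (e := eps_star a c n + 3%:R / n%:R) :
  (0 < W)%N -> H = ((n + 2) * p)%N -> W = (n * p)%N -> 0 <= e ->
  (forall r c, D r c = ((r : nat) == (c + p)%N)%:R) ->
  (forall k (r : 'I_H) (c : 'I_W), (k < L)%N ->
    let f arr := cell s arr (k * (H * W) + r * W + c) in
    [/\ f 2%N = complex.Re (M1 k r c), f 3%N = complex.Im (M1 k r c),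
        f 4%N = complex.Re (M2 k r c) & f 5%N = complex.Im (M2 k r c)]) ->
  ireg s 0 = n -> ireg s 1 = L -> cell s 0 0 = a -> cell s 0 1 = b -> cell s 0 2 = c ->
  outp s = [::] ->
  (forall t m, n%:R * r <= m%:R ->
    (forall z, z \in outp t <-> exists i j, [/\ (i < 2 * m + 1)%N, (j < 2 * m + 1)%N,
      accepted L M1 M2 r e D (grid_pt R n m i j) & z = grid_pt R n m i j]) -> Q t) ->
  runs (grid_program p) s Q.
Proof.
move=> W0 HE WE e0 DE sM sn sL sa sb sc os hQ.
have [m [hm hmin]] := least_nat_ge (n%:R * r).
apply/runs_seq/runs_iset/runs_seq/runs_iset/runs_seq/runs_rset/runs_seq/runs_rset.
apply/runs_seq/runs_iset.
set t := set_reg _ _ _.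
have rt : ready n L 0 H W r e s t.
  split; split=> //=.
  - by rewrite sn WE.
  - by rewrite sn HE.
  - by rewrite sa sb sc.
  - by rewrite sn sa sc addn1.
  - by move=> b' k b6; have [_ /negbTE ->] := input_array b6.
have ot : outp t = [::] by [].
move: t rt ot => t rt ot; apply: runs_seq.
apply: (@runs_while R (fun i u => ready n L i H W r e s u /\ outp u = [::]) m) => //.
- move=> i u im [[[h0 h1 h2 h3 h4] [c0 c1 cs]] ou]; split.
    by rewrite /= h4 h0 c0; exact: hmin.
  by apply: runs_iset; split=> //; split; split=> //=; rewrite h4 addn1.
- move=> u [ru ou]; have [[h0 h1 h2 h3 h4] [c0 c1 cs]] := ru; split.
    by rewrite /= h4 h0 c0 -leNgt.
  apply: (scan_grid_spec W0 e0 DE sM ru ou) => v hv; exact: hQ hm hv.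
Qed.

Lemma shift_int (R : realType) (n m : nat) (r : R) (k : int) : (0 < n)%N ->
  n%:R * r <= m%:R -> `|k%:~R / n%:R| <= r ->
  exists2 a : nat, (a < 2 * m + 1)%N & k%:~R = a%:R - m%:R :> R.
Proof.
move=> n0 hm hk; have n0' : 0 < n%:R :> R by rewrite ltr0n.
have : `|k%:~R| <= m%:R :> R.
  apply: le_trans hm; move: hk.
  by rewrite normrM normfV (gtr0_norm n0') ler_pdivrMr// mulrC.
rewrite -intr_norm -[m%:R]/((m : int)%:~R) ler_int => km.
have [a aE] : exists a : nat, k + Posz m = Posz a by exists (absz (k + Posz m)); lia.
exists a; first lia.
by rewrite -[a%:R]/((a : int)%:~R) -aE rmorphD /= addrK.
Qed.

Lemma cmod_sqrE (R : realType) (z : R[i]) :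
  cmod z ^+ 2 = complex.Re z ^+ 2 + complex.Im z ^+ 2.
Proof. by case: z => a b /=; rewrite sqr_sqrtr// addr_ge0 ?sqr_ge0. Qed.

(** The bound [m] only limits the search; membership is decided by comparing squares. The disc
    scaled by [r = 0] is the origin alone, where the strict comparison fails, hence the second
    disjunct. *)
Lemma GridP (R : realType) (n m : nat) (r : R) (z : R[i]) : (0 < n)%N -> 0 <= r ->
  n%:R * r <= m%:R ->
  Grid n r z <-> exists i j, [/\ (i < 2 * m + 1)%N, (j < 2 * m + 1)%N,
    (complex.Re z ^+ 2 + complex.Im z ^+ 2 < r ^+ 2) ||
    ~~ (0 < complex.Re z ^+ 2 + complex.Im z ^+ 2) & z = grid_pt R n m i j].
Proof.
move=> n0 r0 hm; rewrite -cmod_sqrE; split.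
  move=> gz; have zr := grid_cmod r0 gz; case: gz => -[a [b zE]] [u /= u1 uz].
  have [|i iN ai] := @shift_int R n m r a n0 hm.
    by apply: le_trans zr; have := cmod_ge_Re z; rewrite {1}zE.
  have [|j jN bj] := @shift_int R n m r b n0 hm.
    by apply: le_trans zr; have := cmod_ge_Im z; rewrite {1}zE.
  exists i, j; split=> //; last by rewrite zE ai bj.
  have [r1|r1] := ltP 0 r.
    rewrite ltr_pXn2r ?nnegrE ?cmod_ge0// -uz cmodM cmodC ger0_norm//.
    by rewrite gtr_pMr// u1.
  have -> : cmod z = 0 by apply/eqP; rewrite eq_le cmod_ge0 andbT (le_trans zr).
  by rewrite expr0n ltxx orbT.
move=> [i [j [_ _ hz zE]]].
have zI : z = Complex ((Posz i - Posz m)%:~R / n%:R) ((Posz j - Posz m)%:~R / n%:R).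
  by rewrite zE /grid_pt !rmorphB.
rewrite zI; apply: grid_mem; rewrite -zI.
case/orP: hz => hz; [right|left].
  by move: hz; rewrite ltr_pXn2r ?nnegrE ?cmod_ge0.
by apply: ComplexField.Normc.eq0_normc; apply/eqP;
  rewrite -sqrf_eq0 eq_le sqr_ge0 andbT leNgt.
Qed.

Lemma grid_program_computes (R : realType) (p : nat) (p_gt0 : (0 < p)%N)
    (calA : tridiag R p -> nat -> {fset int}) (calB : tridiag R p -> R * R * R)
    (calBP : is_bound_map calB) (A : tridiag R p) (n : nat) : (0 < n)%N ->
  computes (grid_program p)
    (initial_state n (calA A n) (fun k => calC A k n) (calB A))
    (Gamma_fin calA calB A n).
Proof.
move=> n0; case calBE : (calB A) => [[a b] c].
have [a0 b0 c0] := bounds_ge0 calBP calBE.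
have r0 : 0 <= a + b + c by rewrite !addr_ge0.
have e0 : 0 <= eps_star a c n + 3%:R / n%:R.
  by rewrite /eps_star !(addr_ge0, mulr_ge0, divr_ge0).
set K := enum_fset (calA A n).
have [t et ht] : runs (grid_program p)
    (initial_state n (calA A n) (fun k => calC A k n) (a, b, c))
    (fun t => forall z, z \in outp t <-> Gamma_fin calA calB A n z).
  apply: (@grid_program_spec R p n (size K) _ _ (fun k => sect (mat A) n (nth 0 K k))
    (fun k => sect (mat_adj A) n (nth 0 K k)) (sectI R p n) a b c) => //.
  - exact: sum_dim_gt0.
  - by rewrite sum_nat_const card_ord addn2.
  - by rewrite sum_nat_const card_ord.
  - exact: sectIE.
  - move=> k i j kK; split; exact: (@nth_blocks R _ _ _ _ K k i j erefl kK).
  - move=> t m hm ht z; apply: iff_trans (ht z) _.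
    apply: iff_trans (iff_sym (Gamma_finP _ calBE n z)); split.
      move=> [i [j [iN jN]]]; rewrite /accepted => /andP[hk hr] ->; split; last first.
        by apply/(GridP _ n0 r0 hm); exists i, j.
      case/hasP: hk => k; rewrite mem_iota add0n => kK hk.
      exists (nth 0 K k); first exact: mem_nth.
      by apply/approx_eigP; apply/orP.
    move=> [[k kK /approx_eigP/orP hk] /(GridP _ n0 r0 hm)[i [j [iN jN hr zE]]]].
    exists i, j; split=> //; rewrite -zE /accepted hr andbT.
    apply/hasP; exists (index k K); first by rewrite mem_iota add0n index_mem.
    by rewrite /= nth_index.
by exists t => //; apply/seteqP; split=> z /=; move/ht.
Qed.

Theorem proposition1p10 (R : realType) (p : nat) (p_gt0 : (0 < p)%N) :
  exists prog : cmd,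
  forall (calA : tridiag R p -> nat -> {fset int})
         (calB : tridiag R p -> R * R * R),
  is_index_map calA -> is_bound_map calB ->
  forall A : tridiag R p,
  [/\ forall n : nat, (0 < n)%N ->
        computes prog
          (initial_state n (calA A n) (fun k => calC A k n) (calB A))
          (Gamma_fin calA calB A n),
      dH (Gamma_fin calA calB A n) (Spec A) @[n --> \oo] --> (0 : \bar R)%E,
      dH (Gamma_hat calA calB A n) (Spec A) @[n --> \oo] --> (0 : \bar R)%E
    & forall n : nat, (0 < n)%N -> Spec A `<=` Gamma_hat calA calB A n].
Proof.
exists (grid_program p) => calA calB calAP calBP A; split.
- by move=> n; exact: grid_program_computes.
- case calBE : (calB A) => [[a b] c]; exact: (dH_Gamma_fin p_gt0 calAP calBP calBE).
- case calBE : (calB A) => [[a b] c]; exact: (dH_Gamma_hat p_gt0 calAP calBP calBE).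
- case calBE : (calB A) => [[a b] c] n; exact: (Spec_subset_Gamma_hat p_gt0 calAP calBP calBE).
Qed.
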